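(* Let $\epsilon>0$. There exists a randomized algorithm running in time $n^{O(\log n/\epsilon^4)}$ that, given an instance of submodular Max-Sum Diversification, finds a set $S\subseteq U$ of size $p$ such that for any optimal solution $S^{\mathrm{OPT}}$ of the instance, $$\mathbb{E}[\mathrm{div}(S)]\ge (1-\epsilon)\,\mathrm{disp}(S^{\mathrm{OPT}})+(1-1/e-\epsilon)\,f(S^{\mathrm{OPT}}).$$
   Context: Submodular Max-Sum Diversification: given a finite metric space $(U,d)$ with $|U|=n$, an integer $p\ge 2$, and a monotone submodular set function $f:2^U\to\mathbb{R}_{\ge0}$ accessible via a value oracle, select $S\subseteq U$ of size $p$ maximizing $\mathrm{div}(S):=\mathrm{disp}(S)+f(S)$, where $\mathrm{disp}(S):=\sum_{\{u,v\}\subseteq S}d(u,v)$ over unordered pairs of distinct elements. *)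

(* Defs.v *)
From mathcomp Require Import all_boot all_order all_algebra.
From mathcomp Require Import reals sequences exp.

Set Implicit Arguments.
Unset Strict Implicit.
Unset Printing Implicit Defensive.

Import Order.TTheory GRing.Theory Num.Theory.
Local Open Scope ring_scope.

(** * Submodular Max-Sum Diversification

    An algorithm receives its ground set as [n] labelled points, so [U] is
    ['I_n]. *)

Section Problem.
Variables (R : realType) (n : nat).
Implicit Types (d : 'I_n -> 'I_n -> R) (f : {set 'I_n} -> R) (S : {set 'I_n}).

Definition is_metric d : Prop :=
  [/\ forall u v, 0 <= d u v,
      forall u v, d u v = 0 <-> u = v,
      forall u v, d u v = d v u
    & forall u v w, d u w <= d u v + d v w].

Definition monotone f : Prop :=
  forall A B : {set 'I_n}, A \subset B -> f A <= f B.

Definition submodular f : Prop :=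
  forall A B : {set 'I_n}, f (A :|: B) + f (A :&: B) <= f A + f B.

(* Each unordered pair of distinct points is listed once, smaller label first. *)
Definition disp d S : R := \sum_(u in S) \sum_(v in S | (u < v)%N) d u v.

Definition diversity d f S : R := disp d S + f S.

Definition msd_instance (p : nat) d f : Prop :=
  [/\ (2 <= p <= n)%N, is_metric d, forall S, 0 <= f S, monotone f
    & submodular f].

Definition optimal (p : nat) d f S : Prop :=
  #|S| = p /\
  forall S' : {set 'I_n}, #|S'| = p -> diversity d f S' <= diversity d f S.

End Problem.

(** * Machine model

    A program is a piece of syntax, independent of the instance, for a random
    access machine with
    - countably many zero-initialised arrays of naturals and as many of reals
      (a program names finitely many of them; a scalar is a cell of an array);
    - unit-cost addition, truncated subtraction and comparison of naturals;
      there is no unit-cost multiplication or division of naturals, so a number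
      produced in [t] steps has only [O(t)] more bits than the literals of the
      program;
    - unit-cost field operations and comparison on reals, without rounding and
      without real literals;
    - unit-cost access to a distance, to the value oracle and to a fair coin.
    Every node of an evaluated expression and every executed command costs one
    step, so a long expression is not cheaper than the loop it unrolls. *)

Inductive nexp : Type :=
| NLit of nat
| NGet of nat & nexp             (* array name, index *)
| NAdd of nexp & nexp
| NSub of nexp & nexp.

Inductive rexp : Type :=
| RNat of nexp                   (* n%:R *)
| RGet of nat & nexp
| RAdd of rexp & rexp
| RSub of rexp & rexp
| RMul of rexp & rexp
| RDiv of rexp & rexp            (* x / 0 = 0 *)
| RDist of nexp & nexp           (* distance of two labels, 0 out of range *)
| RVal of nat.                   (* value oracle, on the set whose indicator
                                    is stored in the named natural array *)

Inductive bexp : Type :=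
| BNle of nexp & nexp
| BRle of rexp & rexp
| BNot of bexp
| BAnd of bexp & bexp.

Inductive cmd : Type :=
| Skip
| NSet of nat & nexp & nexp      (* array name, index, new content *)
| RSet of nat & nexp & rexp
| Flip of nat & nexp             (* store a fair coin, as 0 or 1 *)
| Seq of cmd & cmd
| If of bexp & cmd & cmd
| While of bexp & cmd.

Fixpoint ncost (e : nexp) : nat :=
  match e with
  | NLit _ => 1
  | NGet _ e1 => (ncost e1).+1
  | NAdd e1 e2 | NSub e1 e2 => (ncost e1 + ncost e2).+1
  end.

Fixpoint rcost (e : rexp) : nat :=
  match e with
  | RNat e1 | RGet _ e1 => (ncost e1).+1
  | RAdd e1 e2 | RSub e1 e2 | RMul e1 e2 | RDiv e1 e2 =>
      (rcost e1 + rcost e2).+1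
  | RDist e1 e2 => (ncost e1 + ncost e2).+1
  | RVal _ => 1
  end.

Fixpoint bcost (b : bexp) : nat :=
  match b with
  | BNle e1 e2 => (ncost e1 + ncost e2).+1
  | BRle e1 e2 => (rcost e1 + rcost e2).+1
  | BNot b1 => (bcost b1).+1
  | BAnd b1 b2 => (bcost b1 + bcost b2).+1
  end.

Definition update (T : Type) (m : nat -> nat -> T) (a i : nat) (x : T) :
    nat -> nat -> T :=
  fun a' i' => if (a' == a) && (i' == i) then x else m a' i'.

Section Semantics.
Variables (R : realType) (n : nat).
Variables (d : 'I_n -> 'I_n -> R) (f : {set 'I_n} -> R).

(* [coins] is the part of the random tape that has not been read yet. *)
Record state : Type := State {
  nmem : nat -> nat -> nat;
  rmem : nat -> nat -> R;
  coins : seq bool }.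

Definition stored_set (a : nat) (s : state) : {set 'I_n} :=
  [set u : 'I_n | nmem s a u != 0%N].

Definition dist_at (i j : nat) : R :=
  match insub i : option 'I_n, insub j : option 'I_n with
  | Some u, Some v => d u v
  | _, _ => 0
  end.

Fixpoint neval (s : state) (e : nexp) : nat :=
  match e with
  | NLit k => k
  | NGet a e1 => nmem s a (neval s e1)
  | NAdd e1 e2 => (neval s e1 + neval s e2)%N
  | NSub e1 e2 => (neval s e1 - neval s e2)%N
  end.

Fixpoint reval (s : state) (e : rexp) : R :=
  match e with
  | RNat e1 => (neval s e1)%:R
  | RGet a e1 => rmem s a (neval s e1)
  | RAdd e1 e2 => reval s e1 + reval s e2
  | RSub e1 e2 => reval s e1 - reval s e2
  | RMul e1 e2 => reval s e1 * reval s e2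
  | RDiv e1 e2 => reval s e1 / reval s e2
  | RDist e1 e2 => dist_at (neval s e1) (neval s e2)
  | RVal a => f (stored_set a s)
  end.

Fixpoint beval (s : state) (b : bexp) : bool :=
  match b with
  | BNle e1 e2 => (neval s e1 <= neval s e2)%N
  | BRle e1 e2 => reval s e1 <= reval s e2
  | BNot b1 => ~~ beval s b1
  | BAnd b1 b2 => beval s b1 && beval s b2
  end.

(* [exec c s t s']: started in [s], [c] halts in [s'] after exactly [t] steps.
   [Flip] on an exhausted tape is stuck. *)
Inductive exec : cmd -> state -> nat -> state -> Prop :=
| exec_Skip s : exec Skip s 1 s
| exec_NSet a i e s :
    exec (NSet a i e) s (ncost i + ncost e).+1
      (State (update (nmem s) a (neval s i) (neval s e)) (rmem s) (coins s))
| exec_RSet a i e s :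
    exec (RSet a i e) s (ncost i + rcost e).+1
      (State (nmem s) (update (rmem s) a (neval s i) (reval s e)) (coins s))
| exec_Flip a i s b w : coins s = b :: w ->
    exec (Flip a i) s (ncost i).+1
      (State (update (nmem s) a (neval s i) (nat_of_bool b)) (rmem s) w)
| exec_Seq c1 c2 s s1 s2 t1 t2 :
    exec c1 s t1 s1 -> exec c2 s1 t2 s2 ->
    exec (Seq c1 c2) s (t1 + t2).+1 s2
| exec_If b c1 c2 s s' t :
    exec (if beval s b then c1 else c2) s t s' ->
    exec (If b c1 c2) s (bcost b + t).+1 s'
| exec_WhileF b c s : ~~ beval s b ->
    exec (While b c) s (bcost b).+1 s
| exec_WhileT b c s s1 s2 t1 t2 : beval s b ->
    exec c s t1 s1 -> exec (While b c) s1 t2 s2 ->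
    exec (While b c) s (bcost b + t1 + t2).+1 s2.

(* On start, cell 0 of natural arrays 0 and 1 holds [n] and [p]. *)
Definition init_state (p : nat) (w : seq bool) : state :=
  State (update (update (fun _ _ => 0%N) 0 0 n) 1 0 p) (fun _ _ => 0) w.

(* Within [T] steps on tape [w], [A] halts with the indicator of [S] in natural
   array 2. *)
Definition outputs (A : cmd) (p T : nat) (w : seq bool) (S : {set 'I_n}) :
    Prop :=
  exists (t : nat) (s : state),
    [/\ exec A (init_state p w) t s, (t <= T)%N & stored_set 2 s = S].

End Semantics.

(* Expectation over [T] independent fair coins. *)
Definition coin_expectation (R : realType) (T : nat)
    (X : T.-tuple bool -> R) : R :=
  (\sum_(w : T.-tuple bool) X w) / 2 ^+ T.

(* Main.v *)
(** The algorithm is deterministic: it tries every guess of a short list of numbers and keeps the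
    best set found.  Write [O] for the optimum, and for a partial solution [A] put mass 1 on [A] and
    mass [rho = (p - |A|) / |O \ A|] on [O \ A].  If [A] were completed by random elements of
    [O \ A], the dispersion would be about half the quadratic form of this measure, and [f] would be
    at least [f O - exp (- rho) (f O - f A)].  The sum of the two is a pessimistic estimator: it
    starts at [disp O + (1 - 1/e) f O], and it hardly decreases when one repeatedly adds the label
    maximising the distance to the measure plus [exp (- rho)] times the marginal of [f].  Averaging
    over [O \ A] shows this, and [rho] is the right rate because it also accounts for labels of [O]
    that are picked.

    The distances to the measure are all estimated by [O (log n / eps^2)] weighted sample points,
    which exist by a Chernoff bound with importance sampling and are therefore guessed.  They stay
    valid for a stage of [eps (p - |A|)] additions.  Each stage adds [eps^2] times the optimum to a
    bounded quantity unless stopping is already harmless, so [O (1 / eps^2)] stages suffice, and the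
    guess has [O (log n / eps^4)] entries.  When fewer than [1 / eps] labels are missing, they are
    guessed explicitly. *)

(* Why the weight is [exp (- rho)]: when the rate falls by [dr], the weight of the deficit
   [f O - f A] grows by about [exp (- rho) * dr]. As [dr * |O \ A|] is about the mass newly placed,
   the average marginal over [O \ A], at least the deficit divided by [|O \ A|], pays for this
   growth. Distances balance in the same way: mass put on new labels is mass taken off [O \ A]. Only
   second-order terms are lost, and they are small because a stage is short compared with [O \ A].

   The obstacle is that the measure and the rate depend on the unknown [O]. All that the algorithm
   may learn about them is a bounded number of naturals at most [n], since guesses are enumerated as
   numbers in base [n + 1]. Hence the importance sampling with integer divisors at most [n], the
   weight of [f] rounded to an integer, and the label [n] as a blank. Whatever the guess, the
   candidate has size [p], so wrong guesses are harmless.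

   All losses are multiples of [V = disp O + f O]. They add up to [212 e V], whence
   [e = eps / 220]. *)
Require Import Defs.
From mathcomp Require Import all_boot all_order all_algebra.
From mathcomp Require Import reals sequences exp boolp.
From mathcomp Require Import zify ring lra.
Set Implicit Arguments.
Unset Strict Implicit.
Unset Printing Implicit Defensive.
Import Order.TTheory GRing.Theory Num.Theory.
Local Open Scope ring_scope.

(** * Bilinear form of a metric *)

Section Form.
Variables (R : realType) (n : nat) (d : 'I_n -> 'I_n -> R).
Hypothesis d_metric : is_metric d.
Implicit Types (x y z : 'I_n -> R) (A B S T Y : {set 'I_n}) (u v : 'I_n).

Lemma d_ge0 u v : 0 <= d u v. Proof. by case: d_metric. Qed.
Lemma dC u v : d u v = d v u. Proof. by case: d_metric. Qed.
Lemma dxx u : d u u = 0. Proof. by case: d_metric => _ /(_ u u) [_ ->]. Qed.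
Lemma d_triangle u v w : d u w <= d u v + d v w. Proof. by case: d_metric. Qed.

(** Sets enter as weights 0 and 1, so that sets and fractional measures share one bilinear
    calculus. *)
Definition ind A v : R := (v \in A)%:R.

Definition pull x v : R := \sum_u x u * d v u.

Definition form x y : R := \sum_v y v * pull x v.

Lemma ind_ge0 A v : 0 <= ind A v. Proof. exact: ler0n. Qed.

Lemma sum_ind A : \sum_v ind A v = #|A|%:R.
Proof. by rewrite -sum1_card natr_sum [RHS]big_mkcond; apply: eq_bigr => v _; rewrite /ind; case: (v \in A). Qed.

Lemma sum_indM A (F : 'I_n -> R) : \sum_v ind A v * F v = \sum_(v in A) F v.
Proof.
rewrite [RHS]big_mkcond; apply: eq_bigr => v _; rewrite /ind.
by case: (v \in A); rewrite ?mul1r ?mul0r.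
Qed.

Lemma pull_ind A v : pull (ind A) v = \sum_(u in A) d v u.
Proof. exact: sum_indM. Qed.

Lemma form_ind x A : form x (ind A) = \sum_(v in A) pull x v.
Proof. exact: sum_indM. Qed.

Lemma formC x y : form x y = form y x.
Proof.
rewrite /form /pull; under eq_bigr do rewrite big_distrr /=.
rewrite exchange_big; apply: eq_bigr => u _; rewrite big_distrr /=.
by apply: eq_bigr => v _; rewrite dC; ring.
Qed.

Lemma form_linr x a b y z :
  form x (fun v => a * y v + b * z v) = a * form x y + b * form x z.
Proof.
rewrite /form !big_distrr -big_split; apply: eq_bigr => v _ /=; ring.
Qed.

Lemma form_linl x a b y z :
  form (fun v => a * y v + b * z v) x = a * form y x + b * form z x.
Proof. by rewrite formC form_linr formC (formC x z). Qed.

Lemma form_sq a b x y :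
  form (fun v => a * x v + b * y v) (fun v => a * x v + b * y v) =
  a ^+ 2 * form x x + 2 * a * b * form x y + b ^+ 2 * form y y.
Proof. by rewrite form_linl !form_linr (formC y x); ring. Qed.

Lemma pull_lin a b x y v :
  pull (fun w => a * x w + b * y w) v = a * pull x v + b * pull y v.
Proof.
rewrite /pull !big_distrr -big_split; apply: eq_bigr => u _ /=; ring.
Qed.

Lemma eq_pull x y : x =1 y -> pull x =1 pull y.
Proof. by move=> e v; apply: eq_bigr => u _; rewrite e. Qed.

Lemma eq_form x x' y y' : x =1 x' -> y =1 y' -> form x y = form x' y'.
Proof. by move=> e e'; apply: eq_bigr => v _; rewrite e' (eq_pull e). Qed.

Lemma pull_ge0 x v : (forall u, 0 <= x u) -> 0 <= pull x v.
Proof. by move=> h; apply: sumr_ge0 => u _; rewrite mulr_ge0 ?d_ge0. Qed.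

Lemma form_ge0 x y : (forall u, 0 <= x u) -> (forall u, 0 <= y u) -> 0 <= form x y.
Proof. by move=> hx hy; apply: sumr_ge0 => v _; rewrite mulr_ge0 ?pull_ge0. Qed.

Lemma ler_pull x y v : (forall u, x u <= y u) -> pull x v <= pull y v.
Proof. by move=> h; apply: ler_sum => u _; rewrite ler_wpM2r ?d_ge0. Qed.

Lemma ler_form x x' y y' : (forall u, 0 <= x u) -> (forall u, 0 <= y u) ->
  (forall u, x u <= x' u) -> (forall u, y u <= y' u) -> form x y <= form x' y'.
Proof.
move=> hx hy hxx hyy; apply: ler_sum => v _.
by apply: ler_pM => //; [exact: pull_ge0|exact: ler_pull].
Qed.

Lemma dispE S : form (ind S) (ind S) = 2 * disp d S.
Proof.
rewrite form_ind; under eq_bigr do rewrite pull_ind.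
(* One of the two copies of [disp] is transposed; together they list every ordered pair of distinct
   elements, and the diagonal contributes 0. *)
rewrite /disp mulr_natl mulr2n [X in _ = _ + X](exchange_big_dep (mem S)) /=; last by move=> i j _ /andP[].
rewrite -big_split /=; apply: eq_bigr => u uS.
rewrite (bigID (fun v : 'I_n => (u < v)%N)) /=; congr (_ + _).
rewrite (bigID (fun v : 'I_n => v == u)) /= (big1 _ (fun i => _ && (i == u))); last first.
  by move=> i /andP[_ /eqP ->]; rewrite dxx.
rewrite add0r; apply: eq_big => [v|v _]; last exact: dC.
rewrite uS /= -andbA; congr andb.
by rewrite -leqNgt ltn_neqAle andbC.
Qed.

Lemma disp_ge0 S : 0 <= disp d S.
Proof. by rewrite -(pmulr_rge0 _ (ltr0n R 2)) -dispE form_ge0 // => v; exact: ind_ge0. Qed.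

Lemma indU A B : [disjoint A & B] -> ind (A :|: B) =1 (fun v => 1 * ind A v + 1 * ind B v).
Proof.
move=> dAB v; rewrite /ind inE !mul1r; case: (boolP (v \in A)) => //= vA; last by rewrite add0r.
by rewrite (disjointFr dAB vA) addr0.
Qed.

Lemma dispU A B : [disjoint A & B] ->
  disp d (A :|: B) = disp d A + form (ind A) (ind B) + disp d B.
Proof.
move=> dAB; apply: (mulfI (x := 2)); first by rewrite pnatr_eq0.
rewrite -dispE (eq_form (indU dAB) (indU dAB)) form_linl !form_linr.
rewrite !mulrDr -!dispE (formC (ind B)); ring.
Qed.

Lemma le_ind A B : A \subset B -> forall v, ind A v <= ind B v.
Proof.
move=> sAB v; rewrite /ind ler_nat; case: (boolP (v \in A)) => // vA.
by rewrite (subsetP sAB _ vA).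
Qed.

Lemma le_disp A B : A \subset B -> disp d A <= disp d B.
Proof.
move=> sAB; rewrite -(ler_pM2l (ltr0n R 2)) -!dispE.
by apply: ler_form; try exact: ind_ge0; exact: le_ind.
Qed.

Lemma disp1U v S : v \notin S -> disp d (v |: S) = disp d S + pull (ind S) v.
Proof.
move=> vS; rewrite setUC dispU; last by rewrite disjoint_sym disjoints1.
rewrite form_ind big_set1 (_ : disp d [set v] = 0) ?addr0 //.
by apply/eqP; rewrite -(mulrI_eq0 _ (mulfI (x := 2) _)) ?pnatr_eq0 // -dispE form_ind big_set1 pull_ind big_set1 dxx.
Qed.

Lemma pullD1 t S v : t \in S -> pull (ind S) v = d v t + pull (ind (S :\ t)) v.
Proof. by move=> tS; rewrite !pull_ind (big_setD1 t). Qed.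

Lemma dispD1 t S : t \in S -> disp d S = disp d (S :\ t) + pull (ind S) t.
Proof.
move=> tS; rewrite (pullD1 _ tS) dxx add0r -disp1U ?setD1K //.
by rewrite !inE eqxx.
Qed.

End Form.

(** * Elementary bounds on an instance *)

Section SetFunction.
Variables (R : realType) (n : nat) (f : {set 'I_n} -> R).
Hypothesis f_sub : submodular f.
Implicit Types (A B S T : {set 'I_n}).

(** Diminishing returns: submodularity for [v |: A] and [B], whose union is [v |: B] and whose
    intersection is [A]. *)
Lemma marginal_anti A B v : A \subset B -> v \notin B ->
  f (v |: B) - f B <= f (v |: A) - f A.
Proof.
move=> sAB vB; have := f_sub (v |: A) B.
have -> : (v |: A) :|: B = v |: B by rewrite -setUA (setUidPr sAB).
have -> : (v |: A) :&: B = A.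
  rewrite setIUl (setIidPl sAB) (_ : [set v] :&: B = set0) ?set0U //.
  by apply/eqP; rewrite setI_eq0 disjoints1.
lra.
Qed.

Lemma sum_marginals S T : f (S :|: T) - f S <= \sum_(v in T :\: S) (f (v |: S) - f S).
Proof.
move: {2}#|T :\: S| (erefl #|T :\: S|) => k; elim: k T => [|k IH] T.
  move/eqP; rewrite cards_eq0 => /eqP h; rewrite h big_set0.
  by move/eqP: h; rewrite setD_eq0 => h; rewrite (setUidPl h) subrr.
move=> hk; have [v vTS] : exists v, v \in T :\: S by apply/set0Pn; rewrite -card_gt0 hk.
have e : (T :\ v) :\: S = (T :\: S) :\ v by rewrite setDDl setUC -setDDl.
have {IH} := IH (T :\ v); rewrite e => /(_ _) H.
have {}H := H _; rewrite (big_setD1 v vTS) /=.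
have hk' : #|(T :\: S) :\ v| = k by move: hk; rewrite (cardsD1 v) vTS => -[].
move: (H hk') => {}H; case/setDP: vTS => vT vS.
have eU : S :|: T = v |: (S :|: T :\ v) by rewrite setUCA setD1K.
have := @marginal_anti S (S :|: T :\ v) v (subsetUl _ _) _.
rewrite !inE eqxx (negPf vS) /= -eU => /(_ isT); move: H; lra.
Qed.

(** Deleting the elements of [S] one by one loses at most [f S] in all, and by diminishing returns
    each deletion loses at least as much as it would from the full [S]. *)
Lemma sum_removals S : 0 <= f set0 -> \sum_(v in S) (f S - f (S :\ v)) <= f S.
Proof.
move=> f0.
suff H k (T : {set 'I_n}) : #|T| = k -> T \subset S ->
    \sum_(v in T) (f S - f (S :\ v)) <= f S - f (S :\: T).
  by apply: le_trans (H _ S erefl (subxx _)) _; rewrite setDv gerBl.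
elim: k T => [|k IH] T.
  by move/eqP; rewrite cards_eq0 => /eqP -> _; rewrite big_set0 setD0 subrr.
move=> hk sTS; have [v vT] : exists v, v \in T by apply/set0Pn; rewrite -card_gt0 hk.
have hk' : #|T :\ v| = k by move: hk; rewrite (cardsD1 v) vT => -[].
have {IH} := IH _ hk' (subset_trans (subsetDl _ _) sTS).
rewrite (big_setD1 v vT) /=.
have vS := subsetP sTS _ vT.
have := @marginal_anti (S :\: T) (S :\ v) v.
rewrite setD1K // (_ : v |: (S :\: T) = S :\: (T :\ v)); last first.
  apply/setP => u; rewrite !inE; have [->|_] := eqVneq u v; rewrite ?vS /=; done.
rewrite setDS ?sub1set // !inE eqxx /= => /(_ isT isT); lra.
Qed.

End SetFunction.

Section Optimum.
Variables (R : realType) (n p : nat) (d : 'I_n -> 'I_n -> R) (f : {set 'I_n} -> R).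
Variables (O : {set 'I_n}).
Hypotheses (inst : msd_instance p d f) (O_opt : optimal p d f O).
Implicit Types (A B S T : {set 'I_n}).

Lemma instance_size : (2 <= p <= n)%N. Proof. by case: inst. Qed.
Lemma instance_metric : is_metric d. Proof. by case: inst. Qed.
Lemma instance_ge0 S : 0 <= f S. Proof. by case: inst. Qed.
Lemma instance_monotone : monotone f. Proof. by case: inst. Qed.
Lemma instance_submodular : submodular f. Proof. by case: inst. Qed.
#[local] Hint Resolve instance_metric instance_monotone instance_submodular : core.
Let p_gt0 : 0 < p%:R :> R. Proof. by rewrite ltr0n; move: instance_size; lia. Qed.

Definition opt_value : R := diversity d f O.
Notation V := opt_value.

Lemma cardO : #|O| = p. Proof. by case: O_opt. Qed.

Lemma enlarge T : (#|T| <= p)%N -> exists S, T \subset S /\ #|S| = p.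
Proof.
move=> hT; move: {2}(p - #|T|)%N (erefl (p - #|T|)%N) => k; elim: k T hT => [|k IH] T hT hk.
  by exists T; split=> //; lia.
have [v vT] : exists v, v \in ~: T.
  by apply/set0Pn; rewrite -card_gt0 cardsCs setCK card_ord; move: instance_size; lia.
have vT' : v \notin T by move: vT; rewrite inE.
have hc : #|v |: T| = #|T|.+1 by rewrite cardsU1 vT'.
have [||S [sS cS]] := IH (v |: T); try by rewrite hc; lia.
by exists S; split=> //; apply: subset_trans sS; exact: subsetUr.
Qed.

Lemma le_diversity A B : A \subset B -> diversity d f A <= diversity d f B.
Proof. by move=> h; rewrite lerD ?le_disp ?instance_monotone. Qed.

Lemma diversity_le_opt T : (#|T| <= p)%N -> diversity d f T <= V.
Proof.
move=> /enlarge[S [sTS cS]]; apply: le_trans (le_diversity sTS) _.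
by case: O_opt => _; apply.
Qed.

Lemma disp_le_opt T : (#|T| <= p)%N -> disp d T <= V.
Proof. by move=> /diversity_le_opt; apply: le_trans; rewrite lerDl instance_ge0. Qed.

Lemma opt_ge0 : 0 <= V.
Proof. by rewrite addr_ge0 ?disp_ge0 ?instance_ge0. Qed.

(* Swapping [v] for each [t] in [O] in turn cannot improve [O]; average over [t]. *)
Lemma pull_opt_outside v : v \notin O -> pull d (ind R O) v <= 4 * V / p%:R.
Proof.
move=> vO; have hp := instance_size.
have H t : t \in O -> disp d O - pull d (ind R O) t + pull d (ind R O) v - d v t + f (O :\ t) <= V.
  move=> tO; have vOt : v \notin O :\ t by rewrite !inE (negPf vO) andbF.
  have := @diversity_le_opt (v |: O :\ t); rewrite cardsU1 vOt.
  have := cardsD1 t O; rewrite tO cardO => -> /= /(_ (leqnn _)); rewrite /diversity disp1U //.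
  have := @instance_monotone (O :\ t) (v |: O :\ t) (subsetUr _ _).
  rewrite (dispD1 instance_metric tO) (pullD1 _ v tO); lra.
have {H} : \sum_(t in O) (disp d O - pull d (ind R O) t + pull d (ind R O) v - d v t + f (O :\ t)) <= \sum_(t in O) V.
  by apply: ler_sum.
rewrite !sumr_const cardO.
(* Summed over [t], the swaps give [(p - 1) * pull v <= 2 disp O + f O <= 2 V], and [p <= 2 (p - 1)]
   turns this into [4 V / p]. *)
have e : \sum_(t in O) (disp d O - pull d (ind R O) t + pull d (ind R O) v - d v t + f (O :\ t)) =
  p%:R * disp d O - form d (ind R O) (ind R O) + p%:R * pull d (ind R O) v - pull d (ind R O) v
   + (p%:R * f O - \sum_(t in O) (f O - f (O :\ t))).
  rewrite form_ind (pull_ind _ _ v) !big_split /= !sumrN !sumr_const cardO !mulr_natl; ring.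
rewrite e dispE //.
have := sum_removals instance_submodular O (instance_ge0 _) => h1.
rewrite ler_pdivlMr // -mulr_natl /opt_value /diversity.
have p2 : 2 <= p%:R :> R by rewrite (ler_nat R 2 p); lia.
have := disp_ge0 instance_metric O; have := instance_ge0 O; have : 0 <= pull d (ind R O) v by apply: pull_ge0 => // u; exact: ind_ge0.
nra.
Qed.

(** The part of [T] inside [O] contributes at most [2 * disp O]; each of the at most [p] labels
    outside contributes at most [4 V / p]. *)
Lemma form_opt_le T : (#|T| <= p)%N -> form d (ind R O) (ind R T) <= 6 * V.
Proof.
move=> hT; rewrite form_ind (big_setID O) /= -[6]/(2+4)%:R natrD mulrDl lerD //.
  apply: (@le_trans _ _ (form d (ind R O) (ind R O))); last first.
    by rewrite dispE // ler_pM2l // disp_le_opt ?cardO.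
  rewrite -form_ind; apply: ler_form => // u; try exact: ind_ge0.
  by apply: le_ind; exact: subsetIr.
apply: (@le_trans _ _ (\sum_(v in T :\: O) (4 * V / p%:R))).
  by apply: ler_sum => v /setDP[_ vO]; exact: pull_opt_outside.
rewrite sumr_const -[_ *+ #|_|]mulr_natr mulrAC ler_pdivrMr //.
rewrite ler_wpM2l ?mulr_ge0 ?opt_ge0 // ler_nat.
by apply: leq_trans hT; exact: subset_leq_card (subsetDl _ _).
Qed.

Lemma pull_opt v : pull d (ind R O) v <= 2 * V.
Proof.
have hV := opt_ge0.
case: (boolP (v \in O)) => vO.
  have : disp d O <= V by apply: disp_le_opt; rewrite cardO.
  rewrite (dispD1 instance_metric vO).
  have := disp_ge0 instance_metric (O :\ v); lra.
apply: le_trans (pull_opt_outside vO) _; rewrite ler_pdivrMr //.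
have p2 : 2 <= p%:R :> R by rewrite (ler_nat R 2 p); move: instance_size; lia.
nra.
Qed.

Lemma pull_small T v : (#|T| < p)%N -> pull d (ind R T) v <= V.
Proof.
move=> hT; case: (boolP (v \in T)) => vT; last first.
  apply: (@le_trans _ _ (disp d (v |: T))); first by rewrite disp1U // lerDr disp_ge0.
  by apply: disp_le_opt; rewrite cardsU1 vT.
have : disp d T <= V by apply: disp_le_opt; exact: ltnW.
rewrite (dispD1 instance_metric vT).
have := disp_ge0 instance_metric (T :\ v); lra.
Qed.

End Optimum.

(** * The estimator *)

Section Potential.
Variables (R : realType) (n p : nat) (d : 'I_n -> 'I_n -> R) (f : {set 'I_n} -> R).
Variables (O : {set 'I_n}).
Hypotheses (inst : msd_instance p d f) (O_opt : optimal p d f O).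
Implicit Types (A B S T Y : {set 'I_n}).
Local Notation V := (opt_value d f O).
Local Notation met := (instance_metric inst).
Local Notation cardO := (cardO O_opt).

(** If [O \ A] is empty, division by 0 gives rate 0, the right value since no label is missing
    then. *)
Definition completion_rate A : R := (p - #|A|)%:R / #|O :\: A|%:R.
Local Notation rho := completion_rate.

Definition completion A v : R := 1 * ind R A v + rho A * ind R (O :\: A) v.
Local Notation mix := completion.

Definition estimator A : R :=
  form d (mix A) (mix A) / 2 + (f O - expR (- rho A) * (f O - f A)).
Local Notation potential := estimator.

(** Truncated at 0 because [f A] may exceed [f O]; a nonnegative deficit can be multiplied through
    inequalities. *)
Definition deficit A : R := Num.max (f O - f A) 0.
Local Notation gap := deficit.

Lemma card_rest A : (p - #|A| <= #|O :\: A|)%N.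
Proof. by rewrite cardsD cardO leq_sub2l // subset_leq_card // subsetIr. Qed.

Lemma rest_gt0 A : (#|A| < p)%N -> (0 < #|O :\: A|)%N.
Proof. by move=> h; apply: leq_trans (card_rest A); rewrite subn_gt0. Qed.

Lemma rho_ge0 A : 0 <= rho A. Proof. by rewrite divr_ge0. Qed.

Lemma rho_le1 A : rho A <= 1.
Proof.
rewrite /rho; have [->|h] := eqVneq #|O :\: A| 0%N; first by rewrite invr0 mulr0.
by rewrite ler_pdivrMr ?ltr0n ?lt0n // mul1r ler_nat card_rest.
Qed.

Lemma mix_ge0 A v : 0 <= mix A v.
Proof. by rewrite /mix mul1r addr_ge0 ?ind_ge0 // mulr_ge0 ?rho_ge0 ?ind_ge0. Qed.

Lemma card_restU A Y : [disjoint A & Y] ->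
  (#|O :\: (A :|: Y)| + #|Y :&: O| = #|O :\: A|)%N.
Proof.
move=> dAY; rewrite -(cardsID Y (O :\: A)) addnC setDDl; congr (_ + _)%N.
congr (#|pred_of_set _|); apply/setP => v; rewrite !inE.
by case: (boolP (v \in Y)) => //= vY; rewrite ?andbF // (disjointFl dAY vY) andbT.
Qed.

(** Both sides compare the mass on the remaining labels of [O]: with the old rate it is
    [p - |A| - rho A * |Y :&: O|], with the new one [p - |A| - |Y|]. *)
Lemma rhoU A Y : [disjoint A & Y] -> (#|A| + #|Y| <= p)%N -> (0 < #|O :\: (A :|: Y)|)%N ->
  (rho A - rho (A :|: Y)) * #|O :\: (A :|: Y)|%:R = #|Y|%:R - rho A * #|Y :&: O|%:R.
Proof.
move=> dAY hp hm; have hm' := card_restU dAY.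
have cU : #|A :|: Y| = (#|A| + #|Y|)%N by rewrite cardsU disjoint_setI0 // cards0 subn0.
rewrite mulrBl /rho divfK; last by rewrite pnatr_eq0 -lt0n.
have e : #|O :\: A|%:R = #|O :\: (A :|: Y)|%:R + #|Y :&: O|%:R :> R by rewrite -natrD hm'.
have h0 : #|O :\: A|%:R != 0 :> R by rewrite pnatr_eq0; lia.
rewrite cU !natrB; try lia; rewrite natrD.
have -> : #|O :\: (A :|: Y)|%:R = #|O :\: A|%:R - #|Y :&: O|%:R :> R by rewrite e addrK.
by field.
Qed.

Lemma le_rhoU A Y : [disjoint A & Y] -> (#|A| + #|Y| <= p)%N -> rho (A :|: Y) <= rho A.
Proof.
move=> dAY hp; case: (posnP #|O :\: (A :|: Y)|) => [h|h].
  by rewrite {1}/rho h invr0 mulr0 rho_ge0.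
rewrite -subr_ge0 -(pmulr_lge0 (x := #|O :\: (A :|: Y)|%:R)) ?ltr0n // rhoU // subr_ge0.
apply: (@le_trans _ _ (1 * #|Y :&: O|%:R)); first by rewrite ler_wpM2r ?rho_le1.
by rewrite mul1r ler_nat subset_leq_card ?subsetIl.
Qed.

Lemma sum_mix A : (#|A| < p)%N -> \sum_v mix A v = p%:R.
Proof.
move=> hA; rewrite big_split /= -!big_distrr /= !sum_ind mul1r /rho divfK.
  by rewrite -natrD subnKC // ltnW.
by rewrite pnatr_eq0; have := card_rest A; lia.
Qed.

(** The change is a nonnegative increment on [Y] minus a uniform decrease [dr] on all of [O \ A]. A
    label of [Y :&: O] undergoes both, so an increment of [1 - rho (A :|: Y)] takes it from [rho A]
    to 1. *)
Lemma mixU A Y : [disjoint A & Y] -> let dr := rho A - rho (A :|: Y) in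
  mix (A :|: Y) =1 (fun v => 1 * mix A v +
    1 * (1 * (1 * ind R Y v + - rho (A :|: Y) * ind R (Y :&: O) v) + - dr * ind R (O :\: A) v)).
Proof.
move=> dAY dr v; rewrite /mix /dr /ind !inE.
case: (boolP (v \in A)) => vA /=; first by rewrite (disjointFr dAY vA) /=; ring.
by case: (v \in Y); case: (v \in O) => /=; ring.
Qed.

(** In the expansion of the square at [mix A + D], the term [form D D] is bounded below by its only
    negative part, the interaction of the added mass with the mass taken off [O \ A]. *)
Lemma form_mix_growth A Y (l := form d (mix A)) (dr := rho A - rho (A :|: Y)) :
  [disjoint A & Y] -> (#|A| + #|Y| <= p)%N ->
  l (ind R Y) - rho (A :|: Y) * l (ind R (Y :&: O)) - dr * l (ind R (O :\: A))
    - dr * form d (ind R Y) (ind R (O :\: A))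
  <= form d (mix (A :|: Y)) (mix (A :|: Y)) / 2 - form d (mix A) (mix A) / 2.
Proof.
move=> dAY hp; have hr := le_rhoU dAY hp; have r0 := rho_ge0 (A :|: Y).
have fC := formC met; have fge := form_ge0 met.
rewrite (eq_form _ (mixU dAY) (mixU dAY)) -/dr.
set y := fun v => 1 * ind R Y v + - rho (A :|: Y) * ind R (Y :&: O) v.
set o := ind R (O :\: A); set D := fun v => 1 * y v + - dr * o v.
have -> : form d (fun v => 1 * mix A v + 1 * D v) (fun v => 1 * mix A v + 1 * D v) =
   form d (mix A) (mix A) + 2 * l D + form d D D.
  by rewrite (form_sq met) /l; ring.
have -> : l D = l (ind R Y) - rho (A :|: Y) * l (ind R (Y :&: O)) - dr * l o.
  by rewrite /D /l !form_linr; ring.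
have -> : form d D D = form d y y - 2 * dr * form d y o + dr ^+ 2 * form d o o.
  by rewrite /D (form_sq met); ring.
have y0 v : 0 <= y v.
  rewrite /y /ind !inE; case: (v \in Y) => /=; last by rewrite !mulr0 addr0.
  by have := rho_le1 (A :|: Y); case: (v \in O) => /=; lra.
have yY v : y v <= ind R Y v.
  by rewrite /y mul1r gerDl mulNr oppr_le0 mulr_ge0 ?ind_ge0.
have o0 v : 0 <= o v by exact: ind_ge0.
have h1 := fge _ _ y0 y0; have h2 := fge _ _ o0 o0.
have h3 : form d y o <= form d (ind R Y) o by apply: (ler_form met).
have dr0 : 0 <= dr by rewrite /dr subr_ge0.
have := ler_wpM2l dr0 h3.
have := mulr_ge0 (sqr_ge0 dr) h2; lra.
Qed.

Lemma potential_growth A Y (l := form d (mix A)) (dr := rho A - rho (A :|: Y)) :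
  [disjoint A & Y] -> (#|A| + #|Y| <= p)%N ->
  potential A + l (ind R Y) - rho (A :|: Y) * l (ind R (Y :&: O)) - dr * l (ind R (O :\: A))
    - dr * form d (ind R Y) (ind R (O :\: A))
    + expR (- rho (A :|: Y)) * (f (A :|: Y) - f A)
    - (expR (- rho (A :|: Y)) - expR (- rho A)) * gap A
  <= potential (A :|: Y).
Proof.
move=> dAY hp; have := form_mix_growth dAY hp; rewrite /l /dr /potential.
have h : expR (- rho A) <= expR (- rho (A :|: Y)) by rewrite ler_expR lerN2 le_rhoU.
have hg : f O - f A <= gap A by rewrite /gap le_max lexx.
have : 0 <= (expR (- rho (A :|: Y)) - expR (- rho A)) * (gap A - (f O - f A)).
  by rewrite mulr_ge0 // subr_ge0.
lra.
Qed.

Lemma gap_le_marginals S : gap S <= \sum_(v in O :\: S) (f (v |: S) - f S).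
Proof.
rewrite /gap ge_max; apply/andP; split.
  apply: le_trans (sum_marginals (instance_submodular inst) S O); rewrite lerB //.
  by apply: (instance_monotone inst); exact: subsetUr.
by apply: sumr_ge0 => v _; rewrite subr_ge0; apply: (instance_monotone inst); exact: subsetUr.
Qed.

Lemma gap_ge0 A : 0 <= gap A. Proof. by rewrite /gap le_max lexx orbT. Qed.

(** At full size the rate is 0: the measure is [ind A] and the deficit has weight 1. *)
Lemma potential_full A : #|A| = p -> potential A = diversity d f A.
Proof.
move=> hA; have r0 : rho A = 0 by rewrite /rho hA subnn mul0r.
rewrite /potential (@eq_form _ _ d (mix A) (ind R A) (mix A) (ind R A)); first last.
- by move=> v; rewrite /mix r0; ring.
- by move=> v; rewrite /mix r0; ring.
rewrite (dispE met) r0 oppr0 expR0 /diversity; lra.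
Qed.

(** With nothing selected the measure is [ind O] and the rate is 1, which is the origin of
    [1 - 1 / e]. *)
Lemma potential0 : disp d O + (1 - (expR 1)^-1) * f O <= potential set0.
Proof.
have p2 := instance_size inst.
have r1 : rho set0 = 1 by rewrite /rho setD0 cards0 subn0 cardO divff // pnatr_eq0; lia.
rewrite /potential (@eq_form _ _ d (mix set0) (ind R O) (mix set0) (ind R O)); first last.
- by move=> v; rewrite /mix r1 /ind !inE /=; ring.
- by move=> v; rewrite /mix r1 /ind !inE /=; ring.
rewrite (dispE met) r1 expRN; have := instance_ge0 inst set0.
have : 0 <= (expR 1)^-1 :> R by rewrite invr_ge0 expR_ge0.
move=> h1 h2; have := mulr_ge0 h1 h2; lra.
Qed.

Lemma form_mixE A : form d (mix A) (mix A) =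
  2 * (disp d A + rho A * form d (ind R A) (ind R (O :\: A)) + rho A ^+ 2 * disp d (O :\: A)).
Proof.
by rewrite /mix (form_sq met) !(dispE met); ring.
Qed.

(** The three terms of the expansion contribute at most [V], [6 V] and [V], and all are doubled. *)
Lemma form_mix_le A : (#|A| <= p)%N -> form d (mix A) (mix A) <= 16 * V.
Proof.
move=> hA; rewrite form_mixE.
have h1 := disp_le_opt inst O_opt hA.
have h2 : disp d (O :\: A) <= V.
  apply: (disp_le_opt inst O_opt); rewrite -cardO subset_leq_card //; exact: subsetDl.
have h3 : form d (ind R A) (ind R (O :\: A)) <= 6 * V.
  apply: le_trans (form_opt_le inst O_opt hA); rewrite (formC met).
  apply: (ler_form met) => v; try exact: ind_ge0; last by [].
  by apply: le_ind; exact: subsetDl.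
have r0 := rho_ge0 A; have r1 := rho_le1 A.
have V0 := opt_ge0 O inst.
have h4 : rho A * form d (ind R A) (ind R (O :\: A)) <= 1 * (6 * V).
  by apply: ler_pM => //; apply: (form_ge0 met) => v; exact: ind_ge0.
have h5 : rho A ^+ 2 * disp d (O :\: A) <= 1 * V.
  by apply: ler_pM => //; rewrite ?disp_ge0 ?sqr_ge0 ?expr_le1 //; exact: met.
lra.
Qed.

Lemma pull_mix_le A v : (#|A| < p)%N -> pull d (mix A) v <= 3 * V.
Proof.
move=> hA; rewrite pull_lin mul1r.
have h1 := pull_small inst O_opt v hA.
have h2 : pull d (ind R (O :\: A)) v <= 2 * V.
  apply: le_trans (pull_opt inst O_opt v).
  by apply: (ler_pull met) => u; apply: le_ind; exact: subsetDl.
have h3 : rho A * pull d (ind R (O :\: A)) v <= 1 * (2 * V).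
  apply: ler_pM; rewrite ?rho_ge0 ?rho_le1 //.
  by apply: (pull_ge0 met) => u; exact: ind_ge0.
lra.
Qed.

End Potential.

(** * Sampling *)

Section Sampling.
Variable R : realType.

(** From [expR t * (1 - t) <= 1] and [(1 - t) * (1 + t + 2 t^2) = 1 + t^2 (1 - 2 t) >= 1]. *)
Lemma expR_le_quad (t : R) : `|t| <= 1 / 2 -> expR t <= 1 + t + 2 * t ^+ 2.
Proof.
rewrite ler_norml => /andP[t1 t2].
have h1 := expR_ge1Dx (- t); have h2 := expR_gt0 t.
have e : expR t * expR (- t) = 1 by rewrite -expRD subrr expR0.
have h3 : expR t * (1 - t) <= 1 by rewrite -[leRHS]e ler_pM2l.
nra.
Qed.

Lemma sum1_inhabited (I : finType) (P : I -> R) : \sum_i P i = 1 -> exists i : I, true.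
Proof.
case: (pickP (@predT I)) => [i _ _|h]; first by exists i.
by rewrite big_pred0 // => /esym/eqP; rewrite oner_eq0.
Qed.

Lemma exists_le_mean (I : finType) (P F : I -> R) (c : R) :
  (forall i, 0 <= P i) -> \sum_i P i = 1 -> \sum_i P i * F i <= c -> exists i, F i <= c.
Proof.
move=> P0 P1 hc.
have [i0 _] := sum1_inhabited P1.
case: (@arg_minP _ _ _ i0 xpredT F isT) => i _ hi; exists i; apply: le_trans hc.
rewrite -[leLHS]mul1r -P1 big_distrl /=; apply: ler_sum => j _.
by rewrite ler_wpM2l ?P0 ?hi.
Qed.

(** The linear term of the quadratic bound vanishes in the mean, leaving
    [1 + 2 lam^2 <= expR (2 lam^2)]. The offset [c] will be the sum of the samples fixed before. *)
Lemma exp_mean_le (I : finType) (P y : I -> R) (c lam : R) :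
  (forall i, 0 <= P i) -> \sum_i P i = 1 -> \sum_i P i * y i = 0 ->
  (forall i, `|y i| <= 1) -> `|lam| <= 1 / 2 ->
  \sum_i P i * expR (lam * (y i + c)) <= expR (lam * c) * expR (2 * lam ^+ 2).
Proof.
move=> P0 P1 Py y1 hl.
have -> : \sum_i P i * expR (lam * (y i + c)) = expR (lam * c) * \sum_i P i * expR (lam * y i).
  by rewrite big_distrr; apply: eq_bigr => i _ /=; rewrite mulrDr expRD; ring.
rewrite ler_pM2l ?expR_gt0 //; apply: le_trans (expR_ge1Dx _).
apply: (@le_trans _ _ (\sum_i (P i + lam * (P i * y i) + 2 * lam ^+ 2 * P i))).
  apply: ler_sum => i _.
  have hly : `|lam * y i| <= 1 / 2.
    by rewrite normrM -[leRHS]mulr1 ler_pM.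
  apply: le_trans (ler_wpM2l (P0 i) (expR_le_quad hly)) _.
  have : (y i) ^+ 2 <= 1 by rewrite -real_normK ?num_real // expr_le1.
  have := P0 i; have := sqr_ge0 lam; rewrite exprMn => a b c'.
  have := mulr_ge0 (mulr_ge0 b a) (_ : 0 <= 1 - y i ^+ 2); rewrite subr_ge0 => /(_ c'); lra.
by rewrite !big_split /= -!big_distrr /= P1 Py; lra.
Qed.

(** A Chernoff bound by conditional expectations. The sum over [u] of the exponentials of both signs
    starts at [2 |U|]; each sample is chosen so that this sum grows at most by the factor
    [expR (2 lam^2)], and in the end it dominates every single deviation. *)
Lemma exists_sample_centered (I U : finType) (P : I -> R) (y : U -> I -> R) (k : nat) (lam : R) :
  (forall i, 0 <= P i) -> \sum_i P i = 1 -> (forall u, \sum_i P i * y u i = 0) ->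
  (forall u i, `|y u i| <= 1) -> 0 < lam -> lam <= 1 / 2 ->
  exists q : seq I, size q = k /\
    forall u, `|\sum_(i <- q) y u i| <= ln (2 * #|U|%:R) / lam + 2 * lam * k%:R.
Proof.
move=> P0 P1 Py y1 l0 l1.
have [q [sq hq]] : exists q : seq I, size q = k /\
    \sum_u (expR (lam * \sum_(i <- q) y u i) + expR (- lam * \sum_(i <- q) y u i))
      <= 2 * #|U|%:R * expR (2 * lam ^+ 2 * k%:R).
  elim: k => [|k [q [sq IH]]].
    exists [::]; split=> //; rewrite mulr0 expR0 mulr1.
    under eq_bigr do rewrite !big_nil !mulr0 expR0.
    by rewrite sumr_const -[_ *+ #|_|]mulr_natr.
  pose F (j : I) := \sum_u (expR (lam * (y u j + \sum_(i <- q) y u i))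
     + expR (- lam * (y u j + \sum_(i <- q) y u i))).
  have [j hj] : exists j, F j <= 2 * #|U|%:R * expR (2 * lam ^+ 2 * k.+1%:R).
    apply: (exists_le_mean P0 P1); rewrite /F.
    under eq_bigr do rewrite big_distrr /=.
    rewrite exchange_big /= -(natr1 k) [_ * (k%:R + 1)]mulrDr mulr1 expRD mulrA.
    apply: le_trans (ler_wpM2r (expR_ge0 _) IH); rewrite big_distrl; apply: ler_sum => u _ /=.
    under eq_bigr do rewrite mulrDr.
    rewrite big_split mulrDl /= lerD //; first by apply: exp_mean_le => //; rewrite gtr0_norm.
    by rewrite -(sqrrN lam); apply: exp_mean_le => //; rewrite normrN gtr0_norm.
  by exists (j :: q); split=> /=; [rewrite sq | under eq_bigr do rewrite !big_cons].
exists q; split=> // u; set s := \sum_(i <- q) y u i.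
have U0 : 0 < 2 * #|U|%:R :> R.
  by rewrite mulr_gt0 // ltr0n; apply/card_gt0P; exists u.
have hs : expR (lam * `|s|) <= 2 * #|U|%:R * expR (2 * lam ^+ 2 * k%:R).
  apply: le_trans hq; rewrite (bigD1 u) //= -/s.
  have h v : 0 <= expR (lam * \sum_(i <- q) y v i) + expR (- lam * \sum_(i <- q) y v i).
    by rewrite addr_ge0 ?expR_ge0.
  have : 0 <= \sum_(v | v != u) (expR (lam * \sum_(i <- q) y v i) + expR (- lam * \sum_(i <- q) y v i)).
    by apply: sumr_ge0 => v _; exact: h.
  have := expR_ge0 (lam * s); have := expR_ge0 (- lam * s).
  by case: (ger0P s) => _; rewrite ?mulrN -?mulNr; lra.
have : lam * `|s| <= ln (2 * #|U|%:R) + 2 * lam ^+ 2 * k%:R.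
  rewrite -ler_expR expRD lnK //.
rewrite -ler_pdivlMl // => /le_trans; apply.
rewrite le_eqVlt; apply/orP; left; apply/eqP; field; lra.
Qed.

Lemma exists_sample (I U : finType) (P : I -> R) (X : U -> I -> R) (h M : U -> R) (k : nat) (lam : R) :
  (forall i, 0 <= P i) -> \sum_i P i = 1 -> (forall u, \sum_i P i * X u i = h u) ->
  (forall u i, `|X u i - h u| <= M u) -> 0 < lam -> lam <= 1 / 2 ->
  exists q : seq I, size q = k /\
    forall u, `|\sum_(i <- q) X u i - k%:R * h u| <= M u * (ln (2 * #|U|%:R) / lam + 2 * lam * k%:R).
Proof.
move=> P0 P1 hX hM l0 l1.
have M0 u (i : I) : 0 <= M u by apply: (le_trans _ (hM u i)); exact: normr_ge0.
(* Where [M u] is 0, [X u] is constantly [h u] and the quotient is 0, so [ey] holds there as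
   well. *)
pose y u i := (X u i - h u) / M u.
have ey u i : X u i = h u + M u * y u i.
  have [e|e] := eqVneq (M u) 0; last by rewrite mulrCA divff // mulr1 addrC subrK.
  by have := hM u i; rewrite e mul0r addr0 normr_le0 subr_eq0 => /eqP.
have [||q [sq hq]] := @exists_sample_centered I U P y k lam P0 P1 _ _ l0 l1.
- move=> u; rewrite /y; under eq_bigr do rewrite mulrA mulrBr.
  by rewrite -big_distrl big_split /= sumrN hX -big_distrl /= P1 mul1r subrr mul0r.
- move=> u i; rewrite /y normrM normfV (ger0_norm (M0 u i)).
  have [e|e] := eqVneq (M u) 0; first by rewrite e invr0 mulr0.
  by rewrite ler_pdivrMr ?mul1r // lt_def e M0 // i.
exists q; split=> // u.
have Mu : 0 <= M u by have [i _] := sum1_inhabited P1; exact: M0 i.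
apply: le_trans (ler_wpM2l Mu (hq u)); under eq_bigr do rewrite ey.
rewrite big_split /= big_const_seq count_predT sq iter_addr_0 -big_distrr /= -[h u *+ k]mulr_natl.
by rewrite [_ + M u * _]addrC addrK normrM ger0_norm.
Qed.

End Sampling.

(** * One stage of the greedy choice *)

(* The arithmetic of [stage_bounds]: [s] is the length of the stage, [m] the size of [O :\: A], [r']
   the rate of [A], [z] the number of labels of [O] among those picked, [V'] the optimum over [p],
   [Q] the future gain of [A], [W] the value gained, [dr] the decrease of the rate. *)
Lemma stage_estimate (R : realType) (e s m r' z V' Q W pot pot' T' h dr bG dL c : R) :
  0 < e -> e <= 1 / 4 -> 0 < m -> 0 <= s -> s <= e * m -> 0 <= z -> z <= s -> 0 <= r' -> r' <= 1 ->
  0 <= V' -> 0 <= Q -> 0 <= W -> 0 <= h -> 0 <= bG -> bG <= Q -> W <= dL -> h <= dL ->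
  0 <= dr -> dr * (m - z) = s - r' * z ->
  c = (1 - e) * ((Q - W) / m) - 2 * (e * V') ->
  (s - r' * z) * c - e * W <= T' ->
  s * c <= (1 + e) * W ->
  pot + T' - dr * Q - dr * h - 2 * dr ^+ 2 * bG <= pot' ->
  s / m * Q <= 2 * (dL + s * V') /\
  pot <= pot' + 26 * (e * (dL + s * V')).
Proof.
move=> e0 e1 m0 s0 sm z0 zs r0 r1 V0 Q0 W0 h0 G0 GQ WL hL dr0 hdr hc hT hW hpot.
(* [g] is the length of the stage relative to [O \ A]; [g <= e] turns second-order losses into
   multiples of [e]. *)
set g := s / m; have g0 : 0 <= g by rewrite divr_ge0 // ltW.
have ge : g <= e by rewrite ler_pdivrMr.
have es : s = g * m by rewrite /g divfK // gt_eqF.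
have drg : dr <= 2 * g.
  rewrite -(ler_pM2r m0) -mulrA -es.
  have : dr * z <= dr * (1 / 4 * m) by rewrite ler_wpM2l //; nra.
  have := mulr_ge0 r0 z0; have := mulr_ge0 dr0 (ltW m0); nra.
have hsc : s * c = g * ((1 - e) * (Q - W)) - 2 * (e * (s * V')).
  by rewrite hc /g; ring.
have sV0 : 0 <= s * V' by rewrite mulr_ge0.
have hQ : g * Q <= 2 * (W + s * V').
  have : g * W <= e * W by rewrite ler_wpM2r.
  have : e * (s * V') <= 1 / 4 * (s * V') by rewrite ler_wpM2r.
  have gQ0 : 0 <= g * Q by exact: mulr_ge0.
  have h34 : 3 / 4 <= 1 - e by lra.
  have : 3 / 4 * (g * Q) <= (1 - e) * (g * Q) by rewrite ler_wpM2r.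
  have : 0 <= e * (g * W) by rewrite mulr_ge0 ?(ltW e0) // mulr_ge0.
  have : e * W <= 1 / 4 * W by rewrite ler_wpM2r.
  move: hW; rewrite hsc; lra.
split; first by lra.
have hTc : (s - r' * z) / m * Q - g * (e * Q + W) - 2 * (e * (s * V')) <= (s - r' * z) * c.
  have k1 : r' * z <= 1 * z by rewrite ler_wpM2r.
  have k0 : 0 <= s - r' * z by lra.
  have ks : s - r' * z <= s by rewrite gerBl mulr_ge0.
  have -> : c = Q / m - ((e * Q + (1 - e) * W) / m + 2 * (e * V')) by rewrite hc; ring.
  rewrite mulrBr -[X in X - _ - _]mulrA [m^-1 * Q]mulrC.
  have : (s - r' * z) * ((e * Q + (1 - e) * W) / m + 2 * (e * V')) <=
         s * ((e * Q + W) / m + 2 * (e * V')).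
    have ew : (1 - e) * W <= 1 * W by rewrite ler_wpM2r //; lra.
    have ew0 : 0 <= (1 - e) * W by rewrite mulr_ge0 //; lra.
    have eQ0 : 0 <= e * Q by rewrite mulr_ge0 // ltW.
    have eV0 : 0 <= e * V' by rewrite mulr_ge0 // ltW.
    have mi0 : 0 <= m^-1 by rewrite invr_ge0 ltW.
    have : 0 <= (e * Q + (1 - e) * W) / m by rewrite mulr_ge0 // addr_ge0.
    have : (e * Q + (1 - e) * W) / m <= (e * Q + W) / m by rewrite ler_wpM2r //; lra.
    by move=> x1 x2; apply: ler_pM => //; lra.
  have -> : s * ((e * Q + W) / m + 2 * (e * V')) = g * (e * Q + W) + 2 * (e * (s * V')) by rewrite /g; ring.
  lra.
have hdrQ : dr * Q <= (s - r' * z) / m * Q + 2 * (e * (g * Q)).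
  have : dr * Q = (s - r' * z) / m * Q + dr * (z / m) * Q.
    by rewrite -hdr; field; rewrite gt_eqF.
  have : dr * (z / m) * Q <= 2 * e * g * Q.
    rewrite ler_wpM2r // ler_pM ?divr_ge0 ?(ltW m0) //; first by lra.
    by rewrite /g ler_wpM2r // invr_ge0 ltW.
  lra.
have hdG : 2 * dr ^+ 2 * bG <= 8 * (e * (g * Q)).
  have : dr ^+ 2 * bG <= (2 * e * (2 * g)) * Q.
    by rewrite expr2 ler_pM ?mulr_ge0 // ler_pM //; lra.
  lra.
have hdh : dr * h <= 2 * e * dL by rewrite ler_pM //; lra.
have hgW : g * W <= e * W by rewrite ler_wpM2r.
have hQe : e * (g * Q) <= e * (2 * (W + s * V')) by rewrite ler_wpM2l // ltW.
have hWe : e * W <= e * dL by rewrite ler_wpM2l // ltW.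
have : 0 <= e * (s * V') by rewrite mulr_ge0 // ltW.
(* The main terms [(s - r' z) / m * Q] of [hTc] and [hdrQ] cancel. There remain [11 e g Q], at most
   [22 e (W + s V')], and further [2 e W], [2 e s V'] and [2 e dL]; with [W <= dL] the total is
   within [26 e (dL + s V')]. *)
lra.
Qed.

Lemma rate_le_half (R : realType) (m z s r dr : R) : 0 < m -> s <= 1 / 4 * m -> z <= s ->
  0 <= r * z -> 0 <= dr -> dr * (m - z) = s - r * z -> dr <= 1 / 2.
Proof.
move=> m0 sm zs hz dr0 hdr; rewrite leNgt; apply/negP => hlt.
have h1 : 1 / 2 * (3 / 4 * m) <= dr * (m - z) by apply: ler_pM => //; lra.
lra.
Qed.

Section Stage.
Variables (R : realType) (n p : nat) (d : 'I_n -> 'I_n -> R) (f : {set 'I_n} -> R).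
Variables (O : {set 'I_n}).
Hypotheses (inst : msd_instance p d f) (O_opt : optimal p d f O).
Implicit Types (A B S T Y : {set 'I_n}).
Local Notation V := (opt_value d f O).
Local Notation met := (instance_metric inst).
Local Notation rho := (completion_rate R p O).
Local Notation mix := (completion R p O).
Local Notation gap := (deficit f O).

Definition accrued T : R := disp d T + f T + form d (ind R T) (ind R O).
Local Notation progress := accrued.

(** The first-order yield of adding all of [O \ A], with the measure and the weight of [f] frozen at
    [A]. *)
Definition future_gain A : R := form d (mix A) (ind R (O :\: A)) + expR (- rho A) * gap A.
Local Notation future := future_gain.

Definition stage_value A T : R := form d (mix A) (ind R (T :\: A)) + expR (- rho A) * (f T - f A).
Local Notation stage_gain := stage_value.

Definition greedy_choice (lh : 'I_n -> R) (bh : R) T v : Prop :=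
  v \notin T /\ forall u, u \notin T -> lh u + bh * f (u |: T) <= lh v + bh * f (v |: T).

Let p_gt0 : 0 < p%:R :> R. Proof. by rewrite ltr0n; move: (instance_size inst); lia. Qed.

Lemma form_mix_ge0 A T : 0 <= form d (mix A) (ind R T).
Proof. by apply: (form_ge0 met) => v; [exact: mix_ge0|exact: ind_ge0]. Qed.

Lemma future_ge0 A : 0 <= future A.
Proof. by rewrite addr_ge0 ?form_mix_ge0 // mulr_ge0 ?expR_ge0 ?gap_ge0. Qed.

Lemma beta_le1 A : expR (- rho A) <= 1 :> R.
Proof. by rewrite -expR0 ler_expR oppr_le0 rho_ge0. Qed.

Lemma stage_gainS A T v : A \subset T -> v \notin T ->
  stage_gain A (v |: T) = stage_gain A T + (pull d (mix A) v + expR (- rho A) * (f (v |: T) - f T)).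
Proof.
move=> sAT vT; have vA : v \notin A by apply: contra vT; exact: subsetP.
rewrite /stage_gain !form_ind.
have -> : (v |: T) :\: A = v |: (T :\: A).
  by apply/setP => u; rewrite !inE; case: eqP => // ->; rewrite vA.
by rewrite big_setU1 /=; [ring|rewrite inE negb_and vT orbT].
Qed.

(** The labels of [O :\: T] together offer at least [future A] minus what [T] has collected, and
    there are at most [|O :\: A|] of them. The greedy label therefore reaches the average, up to the
    estimation errors of both labels compared. *)
Lemma stage_gain_step A T v e lh bh : (#|A| < p)%N -> A \subset T -> (0 < #|O :\: T|)%N ->
  0 <= e -> e <= 1 ->
  (forall u, `|lh u - pull d (mix A) u| <= e * (pull d (mix A) u + V / p%:R)) ->
  `|bh - expR (- rho A)| <= e * expR (- rho A) ->
  greedy_choice lh bh T v ->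
  (1 - e) * ((future A - stage_gain A T) / #|O :\: A|%:R) <=
  (1 + e) * (pull d (mix A) v + expR (- rho A) * (f (v |: T) - f T)) + 2 * (e * (V / p%:R)).
Proof.
move=> hA sAT hN e0 e1 hl hb [vT hv].
set b := expR (- rho A) in hb *; set l := pull d (mix A) in hl *.
have l0 u : 0 <= l u by apply: (pull_ge0 met) => w; exact: mix_ge0.
have b0 : 0 <= b := expR_ge0 _.
have V0 : 0 <= V / p%:R by rewrite divr_ge0 ?(opt_ge0 _ inst).
have marg0 u : 0 <= f (u |: T) - f T by rewrite subr_ge0; apply: (instance_monotone inst); exact: subsetUr.
set a := l v + b * (f (v |: T) - f T).
have a0 : 0 <= a by rewrite addr_ge0 ?mulr_ge0.
have key u : u \in O :\: T ->
    (1 - e) * (l u + b * (f (u |: T) - f T)) <= (1 + e) * a + 2 * (e * (V / p%:R)).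
  case/setDP => _ uT; have := hv u uT.
  have := hl u; have := hl v; rewrite !ler_norml => /andP[_ hv2] /andP[hu1 _].
  move: hb; rewrite ler_norml => /andP[hb1 hb2] hs.
  have := ler_wpM2r (marg0 v) hb2; have := ler_wpM2r (marg0 u) hb1.
  rewrite /a; nra.
have hsum : (1 - e) * (future A - stage_gain A T) <=
    #|O :\: T|%:R * ((1 + e) * a + 2 * (e * (V / p%:R))).
  have -> : #|O :\: T|%:R * ((1 + e) * a + 2 * (e * (V / p%:R))) =
      \sum_(u in O :\: T) ((1 + e) * a + 2 * (e * (V / p%:R))) by rewrite sumr_const mulr_natl.
  apply: (@le_trans _ _ (\sum_(u in O :\: T) (1 - e) * (l u + b * (f (u |: T) - f T)))); last exact: ler_sum.
  rewrite -big_distrr /= ler_wpM2l ?subr_ge0 //.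
  rewrite big_split /= -big_distrr /= /future /stage_gain -/b.
  have h1 : form d (mix A) (ind R (O :\: A)) <= \sum_(u in O :\: T) l u + form d (mix A) (ind R (T :\: A)).
    rewrite -form_ind; have := form_linr d (mix A) 1 1 (ind R (O :\: T)) (ind R (T :\: A)).
    rewrite !mul1r => <-; apply: (ler_form met) => u; rewrite ?ind_ge0 ?mix_ge0 //.
    rewrite /ind !inE; case: (u \in A); case: (u \in O); case: (u \in T) => //=; lra.
  have h2 : gap A - (f T - f A) <= \sum_(u in O :\: T) (f (u |: T) - f T).
    apply: (le_trans _ (gap_le_marginals O inst T)).
    have hm := @marg0; have : f A <= f T by apply: (instance_monotone inst).
    rewrite /gap /Num.max /=; case: ifP; case: ifP; lra.
  have := ler_wpM2l b0 h2; lra.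
have m0 : 0 < #|O :\: A|%:R :> R.
  by rewrite ltr0n; apply: leq_trans hN _; apply: subset_leq_card; exact: setDS.
rewrite [leLHS]mulrA ler_pdivrMr //; apply: le_trans hsum _.
rewrite mulrC ler_wpM2l //; last first.
  by rewrite ler_nat; apply: subset_leq_card; exact: setDS.
have h1 : 0 <= (1 + e) * a by apply: mulr_ge0 => //; lra.
have h2 : 0 <= e * (V / p%:R) by exact: mulr_ge0.
lra.
Qed.

Lemma stage_gain_le A T : A \subset T -> (#|T| <= p)%N ->
  [/\ 0 <= stage_gain A T, stage_gain A T <= progress T - progress A &
     form d (ind R (T :\: A)) (ind R (O :\: A)) <= progress T - progress A].
Proof.
move=> sAT hT; set Y := T :\: A.
have dAY : [disjoint A & Y] by rewrite -setI_eq0 /Y; apply/eqP/setP => v; rewrite !inE; case: (v \in A).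
have eT : T = A :|: Y by rewrite /Y -{1}(setID T A) (setIidPr sAT).
have fT : 0 <= f T - f A by rewrite subr_ge0; apply: (instance_monotone inst).
have b0 := expR_ge0 (- rho A); have b1 := beta_le1 A.
have ind0 := @ind_ge0 R n.
have hbf : expR (- rho A) * (f T - f A) <= 1 * (f T - f A) by rewrite ler_wpM2r.
have h0 : 0 <= form d (ind R A) (ind R Y) by apply: (form_ge0 met).
have h1 : 0 <= form d (ind R (O :\: A)) (ind R Y) by apply: (form_ge0 met).
have h2 : form d (ind R (O :\: A)) (ind R Y) <= form d (ind R Y) (ind R O).
  rewrite (formC met); apply: (ler_form met) => // v.
  by apply: le_ind; exact: subsetDl.
have hP : progress T - progress A = form d (ind R A) (ind R Y) + disp d Y + (f T - f A) + form d (ind R Y) (ind R O).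
  rewrite /progress {1 3}eT (dispU met dAY).
  rewrite (eq_form d (indU R dAY) (fun=> erefl)) (form_linl met); ring.
have hY := disp_ge0 met Y.
have hr : rho A * form d (ind R (O :\: A)) (ind R Y) <= 1 * form d (ind R (O :\: A)) (ind R Y).
  by rewrite ler_wpM2r ?(rho_le1 O_opt).
split; rewrite ?hP /stage_gain -/Y.
- by rewrite addr_ge0 ?form_mix_ge0 ?mulr_ge0.
- by rewrite /mix (form_linl met); lra.
- by rewrite (formC met); lra.
Qed.

End Stage.

(** * A whole stage of greedy additions with frozen estimates *)

Section StageRun.
Variables (R : realType) (n p : nat) (d : 'I_n -> 'I_n -> R) (f : {set 'I_n} -> R).
Variables (O : {set 'I_n}).
Hypotheses (inst : msd_instance p d f) (O_opt : optimal p d f O).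
Implicit Types (A B S T Y : {set 'I_n}).
Local Notation V := (opt_value d f O).
Local Notation met := (instance_metric inst).
Local Notation rho := (completion_rate R p O).
Local Notation mix := (completion R p O).
Local Notation potential := (estimator p d f O).
Local Notation gap := (deficit f O).
Local Notation stage_gain := (stage_value p d f O).
Local Notation future := (future_gain p d f O).
Local Notation progress := (accrued d f O).

Let p_gt0 : 0 < p%:R :> R. Proof. by rewrite ltr0n; move: (instance_size inst); lia. Qed.

Section Run.
Variables (A : {set 'I_n}) (e : R) (s : nat) (lh : 'I_n -> R) (bh : R) (S : nat -> {set 'I_n}).
Hypotheses (A_lt : (#|A| < p)%N) (e_gt0 : 0 < e) (e_le : e <= 1 / 4).
Hypothesis s_le : s%:R <= e * (p - #|A|)%:R.
Hypothesis lh_close :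
  forall u, `|lh u - pull d (mix A) u| <= e * (pull d (mix A) u + V / p%:R).
Hypothesis bh_close : `|bh - expR (- rho A)| <= e * expR (- rho A).
Hypothesis S0 : S 0%N = A.
Hypothesis S_step : forall j, (j < s)%N ->
  exists2 v, greedy_choice f lh bh (S j) v & S j.+1 = v |: S j.

Lemma run_card j : (j <= s)%N -> A \subset S j /\ #|S j| = (#|A| + j)%N.
Proof.
elim: j => [|j IH] hj; first by rewrite S0 addn0 subxx.
have [hA hc] := IH (ltnW hj); have [v [vS _] ->] := S_step hj.
split; first by apply: subset_trans hA (subsetUr _ _).
by rewrite cardsU1 vS hc add1n addnS.
Qed.

Let V0 : 0 <= V / p%:R. Proof. by rewrite divr_ge0 ?(opt_ge0 _ inst). Qed.

Lemma steps_lt : (s < p - #|A|)%N.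
Proof.
rewrite -(ltr_nat R); apply: le_lt_trans s_le _.
have : 0 < (p - #|A|)%:R :> R by rewrite ltr0n subn_gt0.
by move=> h; rewrite gtr_pMl //; have := e_le; lra.
Qed.

(* A picked label of [O] counts for [1 - rho A] only, since it already carried mass [rho A]. *)
Lemma run_gain (W : R) (c : R) j : (j <= s)%N ->
  c = (1 - e) * ((future A - W) / #|O :\: A|%:R) - 2 * (e * (V / p%:R)) ->
  (forall i, (i < j)%N -> stage_gain A (S i) <= W) ->
  let Z := (S j :\: A) :&: O in
  (j%:R - rho A * #|Z|%:R) * c - e * stage_gain A (S j)
    <= form d (mix A) (ind R (S j :\: A)) - rho A * form d (mix A) (ind R Z)
       + expR (- rho A) * (f (S j) - f A)
  /\ j%:R * c <= (1 + e) * stage_gain A (S j).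
Proof.
move=> + hc; elim: j => [|j IH] hj hW /=.
  rewrite S0 setDv set0I cards0 /stage_value setDv !form_ind !big_set0 subrr; split; lra.
have {IH} [|IH1 IH2] := IH (ltnW hj); first by move=> i hi; apply: hW; exact: ltnW.
have [hA hcd] := run_card (ltnW hj); have [v hv e1] := S_step hj; rewrite e1.
have vS : v \notin S j by case: hv.
have vA : v \notin A by apply: contra vS; exact: subsetP.
have hs := steps_lt.
have hN : (0 < #|O :\: S j|)%N.
  by apply: (rest_gt0 O_opt); rewrite hcd; move: hs hj; clear; lia.
have := stage_gain_step inst A_lt hA hN (ltW e_gt0) _ lh_close bh_close hv.
have e1' : e <= 1 by have := e_le; lra.
move=> /(_ e1') hstep; rewrite (stage_gainS p d f O hA vS).
set a := pull d (mix A) v + _ in hstep *.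
have b0 : 0 <= expR (- rho A) * (f (v |: S j) - f (S j)).
  by rewrite mulr_ge0 ?expR_ge0 // subr_ge0; apply: (instance_monotone inst); exact: subsetUr.
have l0 : 0 <= pull d (mix A) v by apply: (pull_ge0 met) => u; exact: mix_ge0.
have a0 : 0 <= a by rewrite addr_ge0.
have m0 : 0 < #|O :\: A|%:R :> R by rewrite ltr0n (rest_gt0 O_opt).
(* [c] is computed with the bound [W] on all gains instead of the current gain, so one value serves
   every step of the run. *)
have hca : c <= (1 + e) * a.
  rewrite hc lerBlDr; apply: le_trans hstep; rewrite ler_wpM2l ?subr_ge0 // ler_wpM2r ?invr_ge0 ?(ltW m0) //.
  by rewrite lerB // hW.
have ea0 : 0 <= e * a by rewrite mulr_ge0 // ltW.
clear hstep hW hc; split; last by rewrite -(natr1 j); lra.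
have r0 := rho_ge0 R p O A; have r1 := rho_le1 O_opt A.
have eY : (v |: S j) :\: A = v |: (S j :\: A).
  by apply/setP => u; rewrite !inE; case: eqP => // ->; rewrite vA.
have vY : v \notin S j :\: A by rewrite inE negb_and vS orbT.
have hl : form d (mix A) (ind R (v |: (S j :\: A))) =
    pull d (mix A) v + form d (mix A) (ind R (S j :\: A)) by rewrite !form_ind big_setU1.
rewrite eY hl; set b := expR (- rho A) in b0 IH1 *.
have ha : a = pull d (mix A) v + b * (f (v |: S j) - f (S j)) by []; clearbody a.
case: (boolP (v \in O)) => vO; last first.
  have -> : (v |: (S j :\: A)) :&: O = (S j :\: A) :&: O.
    by apply/setP => u; rewrite !inE; case: eqP => // ->; rewrite (negPf vO) !andbF.
  rewrite -(natr1 j); move: IH1; lra.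
have -> : (v |: (S j :\: A)) :&: O = v |: ((S j :\: A) :&: O).
  by apply/setP => u; rewrite !inE; case: eqP => // ->; rewrite vO.
have vZ : v \notin (S j :\: A) :&: O by rewrite inE (negPf vY).
have hl2 : form d (mix A) (ind R (v |: ((S j :\: A) :&: O))) =
    pull d (mix A) v + form d (mix A) (ind R ((S j :\: A) :&: O)) by rewrite !form_ind big_setU1.
rewrite hl2 cardsU1 vZ /= natrD -(natr1 j).
have k1 : (1 - rho A) * c <= (1 - rho A) * ((1 + e) * a) by rewrite ler_wpM2l // subr_ge0.
have k2 : rho A * (b * (f (v |: S j) - f (S j))) >= 0 by rewrite mulr_ge0.
have k3 : 0 <= rho A * (e * a) by rewrite mulr_ge0.
have k4 : (1 - rho A) * a = (1 - rho A) * pull d (mix A) v + b * (f (v |: S j) - f (S j)) - rho A * (b * (f (v |: S j) - f (S j))) by rewrite ha; ring.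
move: IH1; lra.
Qed.

Lemma stage_bounds :
  s%:R / #|O :\: A|%:R * future A <= 2 * (progress (S s) - progress A + s%:R * (V / p%:R)) /\
  potential A <= potential (S s) + 26 * (e * (progress (S s) - progress A + s%:R * (V / p%:R))).
Proof.
have [hA hc] := run_card (leqnn s); have hs := steps_lt.
have mono j : (j < s)%N -> stage_gain A (S j) <= stage_gain A (S j.+1).
  move=> hj; have [hAj _] := run_card (ltnW hj); have [v [vS _] ->] := S_step hj.
  rewrite (stage_gainS p d f O hAj vS) lerDl addr_ge0 ?mulr_ge0 ?expR_ge0 //.
    by apply: (pull_ge0 met) => u; exact: mix_ge0.
  by rewrite subr_ge0; apply: (instance_monotone inst); exact: subsetUr.
(* Gains only increase along the run, so the final one can play the role of [W] in [run_gain]. *)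
have hW i : (i < s)%N -> stage_gain A (S i) <= stage_gain A (S s).
  move=> hi; have : (i <= s)%N := ltnW hi; move: hi => _.
  elim: s mono {hc hs hA} => [_|k IH mono]; first by rewrite leqn0 => /eqP ->.
  rewrite leq_eqVlt => /orP[/eqP -> //|hik]; apply: le_trans (mono _ (leqnn _)).
  by apply: IH => // j hj; apply: mono; exact: ltnW.
have [hT hQ] := run_gain (leqnn s) erefl hW.
have hp : (#|S s| <= p)%N by rewrite hc; move: hs; clear; lia.
have [w0 w1 w2] := stage_gain_le inst O_opt hA hp.
have eT : S s = A :|: (S s :\: A) by rewrite -{1}(setID (S s) A) (setIidPr hA).
have dAY : [disjoint A & S s :\: A].
  by rewrite -setI_eq0; apply/eqP/setP => v; rewrite !inE; case: (v \in A).
have cY : #|S s :\: A| = s by rewrite cardsD (setIidPr hA) hc addKn.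
have hpot := potential_growth inst O_opt dAY; rewrite cY -eT in hpot.
have {hpot} hpot := hpot (_ : (#|A| + s <= p)%N).
have mz := card_restU O dAY; rewrite -eT in mz.
have hAsp : (#|A| + s < p)%N by move: hs; clear; lia.
have m0 : 0 < #|O :\: A|%:R :> R by rewrite ltr0n (rest_gt0 O_opt).
have hrho := @rhoU R n p O _ _ dAY; rewrite -eT cY in hrho.
have hdr : (rho A - rho (S s)) * (#|O :\: A|%:R - #|(S s :\: A) :&: O|%:R) = s%:R - rho A * #|(S s :\: A) :&: O|%:R.
  rewrite -hrho ?(ltnW hAsp) ?(rest_gt0 O_opt) ?hc //.
  by congr (_ * _); rewrite -mz natrD addrK.
have dr0 : 0 <= rho A - rho (S s).
  by have := le_rhoU O_opt dAY; rewrite -eT cY subr_ge0; apply; exact: ltnW.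
have zs : (#|(S s :\: A) :&: O| <= s)%N by rewrite -[leqRHS]cY subset_leq_card // subsetIl.
have b0 := expR_ge0 (- rho A); have G0 := gap_ge0 f O A.
refine (stage_estimate e_gt0 e_le m0 (ler0n _ s) _ (ler0n _ #|(S s :\: A) :&: O|) _ (rho_ge0 R p O A)
   (rho_le1 O_opt A) V0 (future_ge0 O inst A) w0 _ _ _ w1 w2 dr0 hdr erefl hT hQ (bG := expR (- rho A) * gap A) _).
- by apply: le_trans s_le _; rewrite ler_wpM2l ?(ltW e_gt0) // ler_nat (card_rest O_opt).
- by rewrite ler_nat.
- by apply: (form_ge0 met) => v; exact: ind_ge0.
- by rewrite mulr_ge0.
- by rewrite /future_gain lerDr (form_mix_ge0 O inst).
have {}hpot := hpot (ltnW hAsp).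
set dr := rho A - rho (S s) in hdr dr0 hpot *.
have hdr2 : dr <= 1 / 2.
  have sm : s%:R <= 1 / 4 * #|O :\: A|%:R :> R.
    apply: le_trans s_le _; apply: ler_pM => //; rewrite ?(ltW e_gt0) // ler_nat.
    exact: card_rest O_opt A.
  have zs' : #|(S s :\: A) :&: O|%:R <= s%:R :> R by rewrite ler_nat.
  by apply: rate_le_half hdr => //; rewrite mulr_ge0 ?rho_ge0.
(* The linear part of this growth of the deficit's weight joins the loss [dr * Q] of
   [stage_estimate], the quadratic part its loss [2 * dr ^+ 2 * bG]. *)
have hE : expR (- rho (S s)) <= expR (- rho A) * (1 + dr + 2 * dr ^+ 2).
  have -> : - rho (S s) = - rho A + dr by rewrite /dr; ring.
  rewrite expRD ler_wpM2l // expR_le_quad // ger0_norm //.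
have hE2 : expR (- rho A) <= expR (- rho (S s)) by rewrite ler_expR lerN2 -subr_ge0.
have F0 : 0 <= f (S s) - f A by rewrite subr_ge0; apply: (instance_monotone inst).
have r_le : rho (S s) <= rho A by rewrite -subr_ge0.
have hr := ler_wpM2r (form_mix_ge0 O inst A ((S s :\: A) :&: O)) r_le.
have hG := ler_wpM2r G0 hE; have hF := ler_wpM2r F0 hE2.
by move: hpot; rewrite /future_gain; lra.
Qed.

End Run.
End StageRun.

(** * Completing the set *)

Lemma sum_pairs (R : comNzRingType) (I : finType) (x P : I -> R) :
  \sum_v \sum_u x v * x u * (P v + P u) = 2 * ((\sum_u x u) * \sum_v x v * P v).
Proof.
transitivity (\sum_v (x v * P v * (\sum_u x u) + x v * \sum_u x u * P u)).
  apply: eq_bigr => v _; rewrite !big_distrr -big_split /=.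
  by apply: eq_bigr => u _; ring.
by rewrite big_split /= -!big_distrl /=; ring.
Qed.

Section Finish.
Variables (R : realType) (n p : nat) (d : 'I_n -> 'I_n -> R) (f : {set 'I_n} -> R).
Variables (O : {set 'I_n}).
Hypotheses (inst : msd_instance p d f) (O_opt : optimal p d f O).
Implicit Types (A B S T Y : {set 'I_n}).
Local Notation V := (opt_value d f O).
Local Notation met := (instance_metric inst).
Local Notation rho := (completion_rate R p O).
Local Notation mix := (completion R p O).
Local Notation potential := (estimator p d f O).
Local Notation gap := (deficit f O).
Local Notation future := (future_gain p d f O).

Let p_gt0 : 0 < p%:R :> R. Proof. by rewrite ltr0n; move: (instance_size inst); lia. Qed.

(** The triangle inequality through [t], averaged over [t] with weights [x]. *)
Lemma dist_le_pulls (x : 'I_n -> R) u v : (forall t, 0 <= x t) ->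
  (\sum_t x t) * d u v <= pull d x u + pull d x v.
Proof.
move=> x0; rewrite big_distrl -big_split; apply: ler_sum => t _ /=.
by rewrite -mulrDr ler_wpM2l // (dC met v t) (d_triangle met).
Qed.

(** Averaging the triangle inequality over [O] bounds [p * d u v] by two pulls; summed over the
    pairs of [O \ A] these give [2 |O \ A|] times a form of at most [2 V]. *)
Lemma form_rest_le A :
  form d (ind R (O :\: A)) (ind R (O :\: A)) <= #|O :\: A|%:R * (4 * V / p%:R).
Proof.
set o := ind R (O :\: A); have o0 t : 0 <= o t := ind_ge0 _ _ _.
have h u v : p%:R * d u v <= pull d (ind R O) u + pull d (ind R O) v.
  by have := @dist_le_pulls (ind R O) u v (ind_ge0 _ _); rewrite sum_ind (cardO O_opt).
rewrite mulrA ler_pdivlMr // mulrC /form /pull big_distrr /=.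
apply: (@le_trans _ _ (\sum_v \sum_u o v * o u * (pull d (ind R O) v + pull d (ind R O) u))).
  apply: ler_sum => v _; rewrite !big_distrr; apply: ler_sum => u _ /=.
  have -> : p%:R * (o v * (o u * d v u)) = o v * o u * (p%:R * d v u) by ring.
  by rewrite ler_wpM2l ?mulr_ge0.
have -> : \sum_v \sum_u o v * o u * (pull d (ind R O) v + pull d (ind R O) u) =
    2 * (#|O :\: A|%:R * form d (ind R O) o).
  rewrite -sum_ind; exact: sum_pairs.
have : form d (ind R O) o <= 2 * V.
  have hO : (#|O| <= p)%N by rewrite (cardO O_opt).
  have := disp_le_opt inst O_opt hO; rewrite -(ler_pM2l (ltr0n R 2)) -(dispE met).
  apply: le_trans; apply: (ler_form met) => // t; try exact: ind_ge0.
  by apply: le_ind; exact: subsetDl.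
have : 0 <= #|O :\: A|%:R :> R by [].
move=> h1 h2; have := ler_wpM2l h1 h2; lra.
Qed.

(* The average of [estimator (v |: A)] over [v] in [O :\: A] is large enough. *)
Lemma exists_next A : (#|A| < p)%N ->
  exists2 v, v \in O :\: A & potential A <= potential (v |: A) + 4 * V / p%:R.
Proof.
move=> hA; set m := #|O :\: A|; have m0 : (0 < m)%N := rest_gt0 O_opt hA.
have V0 : 0 <= 4 * V / p%:R by rewrite divr_ge0 // mulr_ge0 // (opt_ge0 _ inst).
have mR : 0 < m%:R :> R by rewrite ltr0n.
(* The rate after adding any one label of [O :\: A]; for [m = 1] division by 0 yields the correct
   rate 0. *)
pose r1 : R := (p - #|A|).-1%:R / m.-1%:R.
have hv v : v \in O :\: A ->
   [/\ rho (A :|: [set v]) = r1, [disjoint A & [set v]], (#|A| + #|[set v]| <= p)%N & [set v] :&: O = [set v]].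
  case/setDP=> vO vA; have dA : [disjoint A & [set v]] by rewrite disjoint_sym disjoints1.
  have eO : [set v] :&: O = [set v] by apply/setIidPl; rewrite sub1set.
  split; rewrite ?cards1 ?addn1 //.
  have := card_restU O dA; rewrite eO cards1 addn1 => hm.
  rewrite /completion_rate /r1 /m -hm /= cardsU cards1 (_ : A :&: [set v] = set0) ?cards0.
    by rewrite subn0 addn1 subnS.
  by apply/eqP; rewrite setI_eq0.
have r1m : (rho A - r1) * m%:R = 1 - r1.
  have [v vO] : exists v, v \in O :\: A by apply/set0Pn; rewrite -card_gt0.
  have [e dA hp eO] := hv v vO.
  have := card_restU O dA; rewrite eO cards1 addn1 => hm.
  case: (posnP #|O :\: (A :|: [set v])|) => h.
    have m1 : m = 1%N by rewrite /m -hm h.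
    have := card_rest O_opt A; rewrite -/m m1 => h1.
    have r1' : (p - #|A| = 1)%N by apply/eqP; rewrite eqn_leq h1 subn_gt0.
    by rewrite /completion_rate -/m /r1 m1 r1' /= invr0 mulr0 divr1 !subr0 mulr1.
  have := @rhoU R n p O A [set v] dA hp h; rewrite e eO cards1 mulr1.
  by rewrite /m -hm -(natr1 #|O :\: (A :|: [set v])|) mulrDr => ->; ring.
set dr := rho A - r1 in r1m.
have r10 : 0 <= r1 by rewrite divr_ge0.
have dr0 : 0 <= dr.
  have [v vO] : exists v, v \in O :\: A by apply/set0Pn; rewrite -card_gt0.
  have [e dA hp _] := hv v vO.
  by rewrite /dr subr_ge0 -e; rewrite (le_rhoU O_opt).
pose L := form d (mix A) (ind R (O :\: A)).
pose q := form d (ind R (O :\: A)) (ind R (O :\: A)).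
have G0 := gap_ge0 f O A.
have hsum : - (4 * V / p%:R) <= \sum_(v in O :\: A) (potential (v |: A) - potential A).
  apply: (@le_trans _ _ (\sum_(v in O :\: A) ((1 - r1) * pull d (mix A) v - dr * L
       - dr * pull d (ind R (O :\: A)) v + expR (- r1) * (f (v |: A) - f A)
       - (expR (- r1) - expR (- rho A)) * gap A))); last first.
    apply: ler_sum => v vO; have [e dA hp eO] := hv v vO.
    have := potential_growth inst O_opt dA hp; rewrite e eO !(setUC A) -/dr -/L.
    rewrite (form_ind _ _ [set v]) big_set1 (formC met (ind R [set v])) (form_ind _ _ [set v]) big_set1; lra.
  rewrite !big_split /= !sumrN !sumr_const -!big_distrr /= -!form_ind -/L -/q -/m.
  rewrite -[dr * L *+ m]mulr_natr -[_ * gap A *+ m]mulr_natr.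
  have hm := gap_le_marginals O inst A.
  (* By [r1m] the first-order terms are balanced in the sum over [v]. The loss that remains is
     [dr * q], kept below [4 V / p] by [dr * m = 1 - r1 <= 1]. *)
  have hq : dr * q <= 4 * V / p%:R.
    have : q <= m%:R * (4 * V / p%:R) := form_rest_le A.
    move=> /(ler_wpM2l dr0)/le_trans; apply; rewrite (mulrA dr) r1m ler_piMl //; lra.
  have hE : expR (- r1) - expR (- rho A) <= expR (- r1) * dr.
    have -> : - rho A = - r1 + - dr by rewrite /dr; ring.
    rewrite expRD; have := ler_wpM2l (expR_ge0 (- r1)) (expR_ge1Dx (- dr)); lra.
  have h1 := ler_wpM2r (ler0n R m) (ler_wpM2r G0 hE).
  have e1 : expR (- r1) * dr * gap A * m%:R = (1 - r1) * (expR (- r1) * gap A) by rewrite -r1m; ring.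
  have h2 : expR (- r1) * gap A <= expR (- r1) * \sum_(v in O :\: A) (f (v |: A) - f A).
    by rewrite ler_wpM2l ?expR_ge0.
  have h3 : 0 <= r1 * (expR (- r1) * gap A) by rewrite mulr_ge0 // mulr_ge0 ?expR_ge0.
  have e2 : dr * L * m%:R = (1 - r1) * L by rewrite -r1m; ring.
  move: h2; rewrite big_split /= sumrN => h2; lra.
apply: contrapT => hno.
have : \sum_(v in O :\: A) (potential (v |: A) - potential A) < \sum_(v in O :\: A) - (4 * V / p%:R).
  apply: ltr_sum; last by move=> v vO; rewrite ltNge; apply/negP => h; apply: hno; exists v => //; lra.
  by have [v vO] := card_gt0P m0; apply/hasP; exists v; rewrite ?mem_index_enum.
move/(le_lt_trans hsum); rewrite sumr_const -/m -[_ *+ m]mulr_natr.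
have : 1 <= m%:R :> R by rewrite ler1n.
move/(ler_wpM2l V0); lra.
Qed.

Lemma exists_completion A : (#|A| <= p)%N -> exists Y,
  [/\ [disjoint A & Y], #|Y| = (p - #|A|)%N &
   potential A <= diversity d f (A :|: Y) + (p - #|A|)%:R * (4 * V / p%:R)].
Proof.
move: {2}(p - #|A|)%N (erefl (p - #|A|)%N) => k; elim: k A => [|k IH] A hk hA.
  have cA : #|A| = p by move: hk hA; clear; lia.
  exists set0; split; rewrite ?cards0 ?setU0 -?setI_eq0 ?setI0 //.
  by rewrite (potential_full O inst cA) hk mul0r addr0.
have hA' : (#|A| < p)%N by move: hk; clear; lia.
have [v /setDP[vO vA] hv] := exists_next hA'.
have cv : #|v |: A| = #|A|.+1 by rewrite cardsU1 vA.
have [||Y [dY cY hY]] := IH (v |: A); first by rewrite cv; move: hk; clear; lia.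
  by rewrite cv.
have vY : v \notin Y by rewrite (disjointFr dY) // setU11.
exists (v |: Y); split.
- rewrite -setI_eq0 setIUr; move: dY; rewrite -setI_eq0 setIUl => /eqP h.
  apply/eqP; rewrite (_ : A :&: [set v] = set0) ?set0U; last first.
    by apply/eqP; rewrite setI_eq0 disjoint_sym disjoints1.
  by apply/eqP; rewrite -subset0 -h subsetUr.
- by rewrite cardsU1 vY cY cv; move: hk; clear; lia.
rewrite setUCA setUA; apply: le_trans hv _; move: hY; rewrite cv hk.
have -> : (p - #|A|.+1)%N = k by move: hk; clear; lia.
rewrite -natr1 mulrDl; lra.
Qed.

Lemma expR_ge_quarter (x : R) : x <= 1 -> 1 / 4 <= expR (- x).
Proof.
move=> x1; apply: (@le_trans _ _ (expR (- (1 / 2)) * expR (- (1 / 2)))).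
  have h := expR_ge1Dx (- (1 / 2) : R); have -> : 1 / 4 = (1 + - (1 / 2)) * (1 + - (1 / 2)) :> R by field.
  by apply: ler_pM => //; lra.
by rewrite -expRD ler_expR; lra.
Qed.

(** What stopping forfeits is already contained in [rho A * future A], except that the deficit has
    the weight [expR (- rho A) >= 1 / 4] there; hence the factor 4. *)
Lemma potential_le_stop A e : (#|A| <= p)%N -> rho A * future A <= e * V ->
  potential A <= diversity d f A + 4 * (e * V).
Proof.
move=> hA hQ; have r0 := rho_ge0 R p O A; have r1 := rho_le1 O_opt A.
have hq := expR_ge_quarter r1.
have G0 := gap_ge0 f O A; have hg : f O - f A <= gap A by rewrite /deficit le_max lexx.
have h1 : (1 - expR (- rho A)) * (f O - f A) <= rho A * gap A.
  have : (1 - expR (- rho A)) * (f O - f A) <= (1 - expR (- rho A)) * gap A.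
    by rewrite ler_wpM2l // subr_ge0 beta_le1.
  have : (1 - expR (- rho A)) * gap A <= rho A * gap A.
    by rewrite ler_wpM2r //; have := expR_ge1Dx (- rho A); lra.
  lra.
have h2 : 1 / 4 * (rho A * gap A) <= expR (- rho A) * (rho A * gap A) by rewrite ler_wpM2r // mulr_ge0.
have ind0 := @ind_ge0 R n.
have h3 : 0 <= rho A * form d (ind R A) (ind R (O :\: A)) by rewrite mulr_ge0 // (form_ge0 met).
have h4 : 0 <= rho A ^+ 2 * disp d (O :\: A) by rewrite mulr_ge0 ?sqr_ge0 // (disp_ge0 met).
have hf : future A = form d (ind R A) (ind R (O :\: A)) + rho A * (2 * disp d (O :\: A)) + expR (- rho A) * gap A.
  by rewrite /future_gain /completion (form_linl met) (dispE met); ring.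
rewrite hf in hQ; rewrite /estimator /diversity (form_mixE O inst); lra.
Qed.

End Finish.

(** * The algorithm as a function of the guess *)

Section Algorithm.
Variables (R : realType) (n p : nat) (d : 'I_n -> 'I_n -> R) (f : {set 'I_n} -> R).
Implicit Types (S : {set 'I_n}) (G : nat -> nat).

Definition has_label S (i : nat) : bool := if insub i is Some v then v \in S else false.

Definition add_label (i : nat) S : {set 'I_n} := [set u : 'I_n | (u == i :> nat) || (u \in S)].

(** Labels out of range, repeated labels and additions to a full set are ignored, so every guess is
    legal and [n] acts as a blank. *)
Definition add1 S (i : nat) : {set 'I_n} :=
  if [&& (i < n)%N, ~~ has_label S i & (#|S| < p)%N] then add_label i S else S.

Fixpoint pull_digits (G : nat -> nat) (k : nat) (i : nat) : R :=
  if k is j.+1 then pull_digits G j i + dist_at d i (G (j + j)%N) / (G (j + j).+1)%:R else 0.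

(** The estimates are [2 p / k * l] and [2 b / k]; multiplying by [k / 2] leaves natural
    coefficients. Using [f] in place of its marginal shifts all scores alike. *)
Definition score (l : nat -> R) (b : nat) S (i : nat) : R :=
  p%:R * l i + b%:R * f (add_label i S).

(** The comparison is not strict and scores will be nonnegative, so the first free label displaces
    the start [(n, 0)]. *)
Fixpoint pick_best (sc : nat -> R) S (m : nat) : nat * R :=
  if m is i.+1 then
    let best := pick_best sc S i in
    if ~~ has_label S i && (best.2 <= sc i) then (i, sc i) else best
  else (n, 0).

Definition greedy_step (l : nat -> R) (b : nat) S : {set 'I_n} :=
  add1 S (pick_best (score l b S) S n).1.

(* Digits 0 and 1 of a stage are its length and the weight of [f]; then come [k] pairs (label, divisor). *)
Definition run_stage k G S : {set 'I_n} :=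
  iter (G 0%N) (greedy_step (pull_digits (fun i => G i.+2) k) (G 1%N)) S.

Definition shift (a : nat) G : nat -> nat := fun i => G (a + i)%N.

Fixpoint run_stages k G (t : nat) : {set 'I_n} :=
  if t is t'.+1 then run_stage k (shift (t' * (k + k + 2)) G) (run_stages k G t') else set0.

Fixpoint add_list G (j : nat) S : {set 'I_n} :=
  if j is i.+1 then add1 (add_list G i S) (G i) else S.

(** The [k] explicit labels serve the case of few missing labels; the final pass over all labels
    fills the set up to size [p]. *)
Definition candidate k L G : {set 'I_n} :=
  add_list id n (add_list (shift (L * (k + k + 2)) G) k (run_stages k G L)).

Lemma has_label_ord S (v : 'I_n) : has_label S v = (v \in S).
Proof. by rewrite /has_label valK. Qed.

Lemma add_label_ord S (v : 'I_n) : add_label v S = v |: S.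
Proof. by apply/setP => u; rewrite !inE. Qed.

Lemma add1_ord S (v : 'I_n) : add1 S v = if (v \notin S) && (#|S| < p)%N then v |: S else S.
Proof. by rewrite /add1 ltn_ord has_label_ord add_label_ord. Qed.

Lemma add1_out S i : (n <= i)%N -> add1 S i = S.
Proof. by rewrite /add1 ltnNge => ->. Qed.

Lemma add1_sub S i : S \subset add1 S i.
Proof. by rewrite /add1; case: ifP => // _; apply/subsetP => u uS; rewrite inE uS orbT. Qed.

Lemma add1_card S i : (#|S| <= p)%N -> (#|add1 S i| <= p)%N.
Proof.
move=> h; case: (ltnP i n) => hi; last by rewrite add1_out.
rewrite -[i]/(val (Ordinal hi)) add1_ord; case: ifP => // /andP[vS hS].
by rewrite cardsU1 vS.
Qed.

Lemma add_list_sub G j S : S \subset add_list G j S.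
Proof. by elim: j => //= j IH; apply: subset_trans IH (add1_sub _ _). Qed.

Lemma add_list_card G j S : (#|S| <= p)%N -> (#|add_list G j S| <= p)%N.
Proof. by move=> h; elim: j => //= j IH; exact: add1_card. Qed.

Lemma run_stage_card k G S : (#|S| <= p)%N -> (#|run_stage k G S| <= p)%N.
Proof. by move=> h; rewrite /run_stage; elim: (G 0%N) => //= j IH; exact: add1_card. Qed.

Lemma run_stages_card k G t : (#|run_stages k G t| <= p)%N.
Proof. by elim: t => [|t IH] /=; rewrite ?cards0 // run_stage_card. Qed.

(** A visited label ends up in the set unless the set is already full, and there are at least [p]
    labels to visit. *)
Lemma fill_card S : (p <= n)%N -> (#|S| <= p)%N -> #|add_list id n S| = p.
Proof.
move=> pn hS; apply/eqP; rewrite eqn_leq add_list_card //=.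
suff h j : (j <= n)%N -> (p <= #|add_list id j S|)%N \/
    (forall u : 'I_n, (u < j)%N -> u \in add_list id j S).
  have [//|hall] := h n (leqnn n); apply: leq_trans pn _.
  rewrite -[leqLHS]card_ord; apply: subset_leq_card; apply/subsetP => u _; exact: hall.
elim: j => [|j IH] hj; first by right.
case: (ltnP #|add_list id j S| p) => hp; last first.
  by left; apply: leq_trans hp (subset_leq_card (add1_sub _ _)).
have [h|h] := IH (ltnW hj); first by rewrite leqNgt hp in h.
right=> u /=; rewrite ltnS leq_eqVlt => /orP[/eqP eu|hu]; last first.
  by apply: (subsetP (add1_sub _ _)); exact: h.
rewrite -eu add1_ord; case: ifP => [_|]; first exact: setU11.
by rewrite eu hp andbT => /negbFE.
Qed.

Lemma candidate_card k L G : (p <= n)%N -> #|candidate k L G| = p.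
Proof. by move=> pn; apply: fill_card => //; apply: add_list_card; exact: run_stages_card. Qed.

Lemma eq_add_list G G' j S : (forall i, (i < j)%N -> G i = G' i) -> add_list G j S = add_list G' j S.
Proof. by elim: j => //= j IH h; rewrite IH ?h // => i hi; apply: h; exact: ltnW. Qed.

Lemma pick_best_spec sc S m : (forall i, 0 <= sc i) -> (m <= n)%N ->
  0 <= (pick_best sc S m).2 /\
  ((exists2 i, (i < m)%N & ~~ has_label S i) ->
   [/\ ((pick_best sc S m).1 < m)%N, ~~ has_label S (pick_best sc S m).1,
      (pick_best sc S m).2 = sc (pick_best sc S m).1 &
     forall i, (i < m)%N -> ~~ has_label S i -> sc i <= (pick_best sc S m).2]).
Proof.
move=> sc0; elim: m => [|m IH] hm /=; first by split=> // -[].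
have {IH} [IH0 IH] := IH (ltnW hm).
case: (boolP (has_label S m)) => hl /=.
  split=> // -[i hi hiS]; have im : (i < m)%N.
    by move: hi; rewrite ltnS leq_eqVlt => /orP[/eqP e|//]; rewrite e hl in hiS.
  have [h1 h2 h3 h4] := IH (ex_intro2 _ _ i im hiS); split=> //; first exact: ltnW.
  move=> j hj hjS; apply: h4 => //.
  by move: hj; rewrite ltnS leq_eqVlt => /orP[/eqP e|//]; rewrite e hl in hjS.
case: ifP => [le|/negbT nle] /=; split=> //.
  move=> _; split=> // i; rewrite ltnS leq_eqVlt => /orP[/eqP -> //|hi] hiS.
  by have [_ _ _ h] := IH (ex_intro2 _ _ i hi hiS); apply: le_trans le; exact: h.
move=> _; have [i im hi] : exists2 i, (i < m)%N & ~~ has_label S i.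
  apply: contrapT => hno; move/negP: nle; apply.
  suff -> : (pick_best sc S m).2 = 0 by exact: sc0.
  have : forall i, (i < m)%N -> has_label S i.
    by move=> i him; apply/negPn/negP => h; apply: hno; exists i.
  clear; elim: m => //= m IH h; rewrite h //=; apply: IH => i hi; apply: h; exact: ltnW.
have [h1 h2 h3 h4] := IH (ex_intro2 _ _ i im hi); split=> //; first exact: ltnW.
move=> j; rewrite ltnS leq_eqVlt => /orP[/eqP -> _|hj]; last exact: h4.
by rewrite ltW // ltNge.
Qed.

Lemma greedy_step_spec l b S : (forall i, 0 <= l i) -> (forall T, 0 <= f T) ->
  (#|S| < p)%N -> (p <= n)%N ->
  exists v : 'I_n, [/\ v \notin S, greedy_step l b S = v |: S &
    forall u : 'I_n, u \notin S ->
      p%:R * l u + b%:R * f (u |: S) <= p%:R * l v + b%:R * f (v |: S)].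
Proof.
move=> l0 f0 hS pn.
have sc0 i : 0 <= score l b S i by rewrite /score addr_ge0 ?mulr_ge0.
have [v0 v0S] : exists v0 : 'I_n, v0 \notin S.
  have [v0] : exists v0, v0 \in ~: S.
    apply/set0Pn; rewrite -card_gt0 cardsCs setCK card_ord subn_gt0; exact: leq_trans hS pn.
  by rewrite inE; exists v0.
have [_ hb] := @pick_best_spec (score l b S) S n sc0 (leqnn n).
have [|h1 h2 h3 h4] := hb; first by exists v0; rewrite ?has_label_ord.
set i := (pick_best (score l b S) S n).1 in h1 h2 h3.
pose v := Ordinal h1; have ev : i = v by [].
have vS : v \notin S by rewrite -has_label_ord -ev.
exists v; split=> //.
  by rewrite /greedy_step -/i ev add1_ord vS hS.
move=> u uS; have := h4 u (ltn_ord u); rewrite has_label_ord => /(_ uS).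
by rewrite h3 ev /score !add_label_ord.
Qed.

End Algorithm.

(** * Existence of a good guess *)

Section SampleDigits.
Variables (R : realType) (n p : nat) (d : 'I_n -> 'I_n -> R) (f : {set 'I_n} -> R).
Variables (O : {set 'I_n}).
Hypotheses (inst : msd_instance p d f) (O_opt : optimal p d f O).
Implicit Types (A B S T Y : {set 'I_n}).
Local Notation V := (opt_value d f O).
Local Notation met := (instance_metric inst).
Local Notation mix := (completion R p O).

Lemma dist_at_ord (u v : 'I_n) : dist_at d u v = d u v.
Proof. by rewrite /dist_at !valK. Qed.

Lemma dist_at_out i : dist_at d i n = 0.
Proof.
rewrite /dist_at; case: insub => [u|//].
by rewrite insubN // ltnn.
Qed.

(* [v] is drawn with probability [completion A v * c v / (2 p)], where [c v] is [1] plus the rounded value of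
   [p l v / (16 V)]; this makes every term at most [32 (l u + V / p)].  The missing probability goes
   to label [n], which is at distance 0 of everything. *)
Lemma exists_digits A (e : R) (k : nat) : (#|A| < p)%N -> 0 < V -> 0 < e -> e <= 1 -> (0 < k)%N ->
  8192 * ln (2 * n%:R) <= e ^+ 2 * k%:R ->
  exists q : seq (nat * nat), [/\ size q = k, all (fun x => (x.1 <= n) && (x.2 <= n))%N q &
    forall u : 'I_n, `|2 * p%:R / k%:R * (\sum_(x <- q) dist_at d u x.1 / x.2%:R) - pull d (mix A) u|
       <= e * (pull d (mix A) u + V / p%:R)].
Proof.
move=> hA V0 e0 e1 k0 hk; have hp := instance_size inst.
have p0 : 0 < p%:R :> R by rewrite ltr0n; move: hp; clear; lia.
have p2 : 2 <= p%:R :> R by rewrite (ler_nat R 2 p); move: hp; clear; lia.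
have kR : 0 < k%:R :> R by rewrite ltr0n.
set l := pull d (mix A).
have x0 := mix_ge0 R p O A.
have l0 u : 0 <= l u by apply: (pull_ge0 met).
pose c (v : 'I_n) := (Num.truncn (p%:R * l v / (16 * V))).+1.
have c0 v : 0 < (c v)%:R :> R by rewrite ltr0n.
have cl v : p%:R * l v / (16 * V) <= (c v)%:R by rewrite ltW // truncnS_gt.
have arg0 v : 0 <= p%:R * l v / (16 * V).
  by rewrite divr_ge0 ?mulr_ge0 ?(ltW p0) ?(ltW V0).
have cu v : (c v)%:R <= 1 + p%:R * l v / (16 * V).
  by rewrite /c -natr1 addrC lerD2l truncn_le.
(* Since [l v <= 3 V], the divisor is at most [1 + 3 p / 16 <= p] and fits in one digit. *)
have cn v : (c v <= n)%N.
  have h : (c v)%:R <= p%:R :> R.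
    apply: le_trans (cu v) _.
    have : p%:R * l v / (16 * V) <= 3 / 16 * p%:R.
      rewrite ler_pdivrMr ?mulr_gt0 //; have := pull_mix_le inst O_opt v hA; rewrite -/l => h3.
      have := ler_wpM2l (ltW p0) h3; lra.
    lra.
  by rewrite ler_nat in h; case/andP: hp => _; exact: leq_trans.
pose w v : R := mix A v * (c v)%:R / (2 * p%:R).
have w0 v : 0 <= w v by rewrite !mulr_ge0 ?invr_ge0 ?mulr_ge0 ?(ltW p0) // ltW.
(* The mass contributes [p], and [p / (16 V)] times a form of at most [16 V] contributes another
   [p]. *)
have w1 : \sum_v w v <= 1.
  rewrite -big_distrl /= ler_pdivrMr ?mulr_gt0 // mul1r.
  apply: (@le_trans _ _ (\sum_v (mix A v + p%:R / (16 * V) * (mix A v * l v)))).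
    apply: ler_sum => v _; apply: le_trans (ler_wpM2l (x0 v) (cu v)) _.
    by rewrite le_eqVlt; apply/orP; left; apply/eqP; ring.
  rewrite big_split /= (sum_mix O_opt hA) -big_distrr /=.
  have : \sum_v mix A v * l v <= 16 * V := form_mix_le inst O_opt (ltnW hA).
  have pV : 0 <= p%:R / (16 * V) by rewrite divr_ge0 ?mulr_ge0 ?(ltW p0) ?(ltW V0).
  move/(ler_wpM2l pV); rewrite divfK; first by lra.
  by rewrite mulf_neq0 // gt_eqF.
pose P (i : option 'I_n) := if i is Some v then w v else 1 - \sum_v w v.
pose X (u : 'I_n) (i : option 'I_n) := if i is Some v then 2 * p%:R / (c v)%:R * d u v else 0.
have bigo (F : option 'I_n -> R) : \sum_i F i = F None + \sum_v F (Some v).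
  rewrite (bigD1 None) //=; congr (_ + _).
  rewrite (reindex_omap Some id) /=; last by case.
  by apply: eq_bigl => v; rewrite eqxx.
have P0 i : 0 <= P i by case: i => [v|] //=; rewrite subr_ge0.
have P1 : \sum_i P i = 1 by rewrite bigo /= subrK.
have PX u : \sum_i P i * X u i = l u.
  rewrite bigo /= mulr0 add0r; apply: eq_bigr => v _; rewrite /w.
  by field; rewrite !gt_eqF.
have XM u i : `|X u i - l u| <= 32 * (l u + V / p%:R).
  have Vp : 0 <= V / p%:R by rewrite divr_ge0 // ltW.
  case: i => [v|] /=; last by rewrite sub0r normrN ger0_norm //; have := l0 u; lra.
  have X0 : 0 <= 2 * p%:R / (c v)%:R * d u v.
    by rewrite mulr_ge0 ?(d_ge0 met) // divr_ge0 ?mulr_ge0 ?(ltW p0) // ltW.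
  have X1 : 2 * p%:R / (c v)%:R * d u v <= 2 * l u + 32 * (V / p%:R).
    have h : p%:R * d u v <= l u + l v.
      by have := dist_le_pulls inst u v x0; rewrite (sum_mix O_opt hA).
    have lv : l v <= 16 * (V / p%:R) * (c v)%:R.
      have := cl v; rewrite ler_pdivrMr ?mulr_gt0 // => h2.
      rewrite -(ler_pM2l p0); apply: le_trans h2 _.
      rewrite le_eqVlt; apply/orP; left; apply/eqP; field; by rewrite gt_eqF.
    have lu : l u <= l u * (c v)%:R by rewrite ler_peMr // ler1n.
    rewrite mulrAC ler_pdivrMr //; lra.
  by rewrite ler_norml; have := l0 u; move=> lu0; apply/andP; split; lra.
have e128 : 0 < e / 128 by rewrite divr_gt0.
(* With [lam = e / 128] both error terms are at most [e k / 64], the first because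
   [8192 = 128 * 64]; their sum times the range factor 32 is [e k]. *)
have [|q [sq hq]] := @exists_sample R _ _ P X l _ k (e / 128) P0 P1 PX XM e128 _; first by lra.
exists [seq if i is Some v then (val v, c v) else (n, 1%N) | i <- q]; split.
- by rewrite size_map.
- rewrite all_map; apply/allP => -[v|] _ /=; first by rewrite ltnW //= cn.
  by rewrite leqnn /=; move: hp; clear; lia.
move=> u; rewrite big_map.
have -> : \sum_(j <- q) dist_at d u (match j with Some v => (val v, c v) | None => (n, 1%N) end).1 /
    (match j with Some v => (val v, c v) | None => (n, 1%N) end).2%:R = (\sum_(i <- q) X u i) / (2 * p%:R).
  rewrite big_distrl; apply: eq_bigr => -[v|] _ /=; last by rewrite dist_at_out !mul0r.
  by rewrite dist_at_ord; field; rewrite !gt_eqF.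
have -> : 2 * p%:R / k%:R * ((\sum_(i <- q) X u i) / (2 * p%:R)) = (\sum_(i <- q) X u i) / k%:R.
  by field; rewrite !gt_eqF.
have -> : (\sum_(i <- q) X u i) / k%:R - l u = (\sum_(i <- q) X u i - k%:R * l u) / k%:R.
  by field; rewrite !gt_eqF.
rewrite normrM normfV (gtr0_norm kR) ler_pdivrMr //; apply: le_trans (hq u) _.
have M0 : 0 <= l u + V / p%:R by rewrite addr_ge0 // divr_ge0 // ltW.
have : ln (2 * #|'I_n|%:R) / (e / 128) + 2 * (e / 128) * k%:R <= e / 32 * k%:R.
  rewrite card_ord; have : ln (2 * n%:R) / (e / 128) <= e / 64 * k%:R.
    rewrite ler_pdivrMr //; move: hk; rewrite expr2; lra.
  lra.
move=> h; have : 0 <= 32 * (l u + V / p%:R) by rewrite mulr_ge0.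
move/ler_wpM2l => /(_ _ _ h); lra.
Qed.

End SampleDigits.

(** Rounding down costs at most [2 / k]. From [e^2 k >= 4] and [e <= 1 / 4] follows [e k >= 16], so
    [e * beta >= 4 / k] covers this cost. *)
Lemma trunc_weight_close (R : realType) (beta e : R) (k : nat) : 1 / 4 <= beta ->
  0 < e -> e <= 1 / 4 -> 4 <= e ^+ 2 * k%:R ->
  `|2 * (Num.truncn (beta * k%:R / 2))%:R / k%:R - beta| <= e * beta.
Proof.
move=> b4 e0 e1 hk4; set b := Num.truncn _.
have kR : 0 < k%:R :> R.
  rewrite ltr0n lt0n; apply/eqP => k0; move: hk4; rewrite k0 mulr0; lra.
have b0 : 0 <= beta by lra.
have b_le : b%:R <= beta * k%:R / 2 by rewrite truncn_le divr_ge0 ?mulr_ge0.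
have b_ge : beta * k%:R / 2 - 1 <= b%:R.
  have := truncnS_gt (beta * k%:R / 2); rewrite -/b -natr1; lra.
have ek0 : 0 <= e * k%:R by rewrite mulr_ge0 // ltW.
have ek : 16 <= e * k%:R.
  have : e * (e * k%:R) <= 1 / 4 * (e * k%:R) by rewrite ler_wpM2r.
  move: hk4; rewrite expr2; lra.
have h2 : 2 / k%:R <= e * beta.
  rewrite ler_pdivrMr //.
  have : 1 / 4 * (e * k%:R) <= beta * (e * k%:R) by rewrite ler_wpM2r.
  lra.
have h3 : 2 * b%:R / k%:R <= beta by rewrite ler_pdivrMr //; lra.
have h4 : beta - 2 / k%:R <= 2 * b%:R / k%:R.
  have -> : beta - 2 / k%:R = (beta * k%:R / 2 - 1) * (2 / k%:R) by field; rewrite gt_eqF.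
  have -> : 2 * b%:R / k%:R = b%:R * (2 / k%:R) :> R by ring.
  by rewrite ler_wpM2r // divr_ge0 // ltW.
by rewrite ler_norml; apply/andP; split; lra.
Qed.

Lemma half_le_truncn (R : realType) (x : R) : 1 <= x -> x / 2 <= (Num.truncn x)%:R.
Proof.
move=> x1; have h1 : (0 < Num.truncn x)%N by rewrite truncn_gt0.
have := truncnS_gt x; rewrite -natr1; have : 1 <= (Num.truncn x)%:R :> R by rewrite ler1n.
lra.
Qed.

Section Guess.
Variables (R : realType) (n p : nat) (d : 'I_n -> 'I_n -> R) (f : {set 'I_n} -> R).
Variables (O : {set 'I_n}).
Hypotheses (inst : msd_instance p d f) (O_opt : optimal p d f O).
Implicit Types (A B S T Y : {set 'I_n}) (G : nat -> nat).
Local Notation V := (opt_value d f O).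
Local Notation met := (instance_metric inst).
Local Notation rho := (completion_rate R p O).
Local Notation mix := (completion R p O).
Local Notation potential := (estimator p d f O).
Local Notation future := (future_gain p d f O).
Local Notation progress := (accrued d f O).
Local Notation run_stage := (run_stage p d f).

Let p_gt0 : 0 < p%:R :> R. Proof. by rewrite ltr0n; move: (instance_size inst); lia. Qed.
Let p_le : (p <= n)%N. Proof. by case/andP: (instance_size inst). Qed.

Lemma pull_digitsE (G : nat -> nat) k i :
  pull_digits d G k i = \sum_(j < k) dist_at d i (G (j + j)%N) / (G (j + j).+1)%:R.
Proof. by elim: k => [|k IH] /=; rewrite ?big_ord0 // big_ord_recr /= IH. Qed.

Lemma pull_digits_ge0 (G : nat -> nat) k i : 0 <= pull_digits d G k i.
Proof.
rewrite pull_digitsE; apply: sumr_ge0 => j _; rewrite mulr_ge0 ?invr_ge0 //.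
rewrite /dist_at; case: insub => // u; case: insub => // v; exact: (d_ge0 met).
Qed.

Definition stage_digits (s b : nat) (q : seq (nat * nat)) (i : nat) : nat :=
  match i with
  | 0 => s
  | 1 => b
  | i.+2 => let x := nth (0, 0)%N q i./2 in if odd i then x.2 else x.1
  end.

Lemma pull_stage_digits s b q i :
  pull_digits d (fun i => stage_digits s b q i.+2) (size q) i =
  \sum_(x <- q) dist_at d i x.1 / x.2%:R.
Proof.
rewrite pull_digitsE (big_nth (0, 0)%N) big_mkord; apply: eq_bigr => j _ /=.
by rewrite addnn odd_double doubleK /= uphalf_double.
Qed.

Lemma stage_digits_le s b q i : (s <= n)%N -> (b <= n)%N ->
  all (fun x => (x.1 <= n) && (x.2 <= n))%N q -> (stage_digits s b q i <= n)%N.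
Proof.
move=> hs hb hq; case: i => [|[|i]] //=.
have h : ((nth (0, 0) q i./2).1 <= n)%N && ((nth (0, 0) q i./2).2 <= n)%N.
  case: (ltnP i./2 (size q)) => hi; last by rewrite nth_default.
  exact: (all_nthP (0, 0)%N hq).
by case/andP: h => h1 h2; case: ifP.
Qed.

Lemma exists_stage A (e : R) (k : nat) : (#|A| < p)%N -> 0 < V -> 0 < e -> e <= 1 / 4 -> (k < p)%N ->
  8192 * ln (2 * n%:R) <= e ^+ 2 * k%:R -> 4 <= e ^+ 2 * k%:R -> 1 <= e * (p - #|A|)%:R ->
  exists g : nat -> nat, [/\ forall i, (g i <= n)%N, A \subset run_stage k g A,
    (#|run_stage k g A| <= p)%N,
    e / 2 * (rho A * future A) <= 2 * (progress (run_stage k g A) - progress A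
       + (#|run_stage k g A|%:R - #|A|%:R) * (V / p%:R)) &
    potential A <= potential (run_stage k g A) + 26 * (e * (progress (run_stage k g A) - progress A
       + (#|run_stage k g A|%:R - #|A|%:R) * (V / p%:R)))].
Proof.
move=> hA V0 e0 e1 kp hk hk4 hr.
have kR : 0 < k%:R :> R.
  rewrite ltr0n lt0n; apply/eqP => k0; move: hk4; rewrite k0 mulr0; lra.
have k0 : (0 < k)%N by rewrite -(ltr0n R).
have e1' : e <= 1 by lra.
have [q [sq hq hclose]] := exists_digits inst O_opt hA V0 e0 e1' k0 hk.
set beta := expR (- rho A).
have b4 : 1 / 4 <= beta := expR_ge_quarter (rho_le1 O_opt A).
have b1 : beta <= 1 := beta_le1 R p O A.
(* The longest stage that [stage_bounds] allows; rounding at most halves it because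
   [e * (p - |A|) >= 1]. *)
pose s := Num.truncn (e * (p - #|A|)%:R).
pose b := Num.truncn (beta * k%:R / 2).
have s_le : s%:R <= e * (p - #|A|)%:R by rewrite truncn_le mulr_ge0 // ltW.
have s_half : e * (p - #|A|)%:R / 2 <= s%:R := half_le_truncn hr.
have sn : (s <= n)%N.
  rewrite -(ler_nat R); apply: le_trans s_le _.
  apply: (@le_trans _ _ (1 * p%:R)); last by rewrite mul1r ler_nat.
  by apply: ler_pM => //; rewrite ?(ltW e0) // ler_nat leq_subr.
have b_le : b%:R <= beta * k%:R / 2 by rewrite truncn_le divr_ge0 ?mulr_ge0 ?expR_ge0.
have bn : (b <= n)%N.
  rewrite -(ler_nat R); apply: le_trans b_le _.
  apply: (@le_trans _ _ p%:R); last by rewrite ler_nat.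
  have : k%:R <= p%:R :> R by rewrite ler_nat ltnW.
  have : beta * k%:R <= 1 * k%:R by rewrite ler_wpM2r // ltW.
  lra.
pose g := stage_digits s b q.
have gl i : pull_digits d (fun i => g i.+2) k i = \sum_(x <- q) dist_at d i x.1 / x.2%:R.
  by rewrite -sq pull_stage_digits.
pose lh (u : 'I_n) : R := 2 * p%:R / k%:R * pull_digits d (fun i => g i.+2) k u.
pose bh : R := 2 * b%:R / k%:R.
pose S j := iter j (greedy_step p f (pull_digits d (fun i => g i.+2) k) b) A.
have lh_close u : `|lh u - pull d (mix A) u| <= e * (pull d (mix A) u + V / p%:R).
  by rewrite /lh gl; exact: hclose.
have bh_close : `|bh - beta| <= e * beta := trunc_weight_close b4 e0 e1 hk4.
have hs : (s < p - #|A|)%N := steps_lt hA e1 s_le.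
have S_card j : (j <= s)%N -> #|S j| = (#|A| + j)%N.
  elim: j => [|j IH] hj; first by rewrite addn0.
  have hc := IH (ltnW hj).
  have [|v [vS e' _]] := greedy_step_spec b (pull_digits_ge0 (fun i => g i.+2) k) (instance_ge0 inst) (S := S j) _ p_le.
    by rewrite hc; move: hj hs; clear; lia.
  by rewrite /S iterS e' cardsU1 vS hc add1n addnS.
have S_step j : (j < s)%N -> exists2 v, greedy_choice f lh bh (S j) v & S j.+1 = v |: S j.
  move=> hj; have hc := S_card j (ltnW hj).
  have [|v [vS e' hmax]] := greedy_step_spec b (pull_digits_ge0 (fun i => g i.+2) k) (instance_ge0 inst) (S := S j) _ p_le.
    by rewrite hc; move: hj hs; clear; lia.
  exists v => //; split=> // u uS; have := hmax u uS.
  have k2 : 0 <= 2 / k%:R :> R by rewrite divr_ge0.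
  move/(ler_wpM2l k2); rewrite !mulrDr /lh /bh.
  congr (_ <= _); ring.
have eS : run_stage k g A = S s by [].
have hSs := S_card s (leqnn s).
have [sub_A _] := run_card (erefl : S 0%N = A) S_step (leqnn s).
have [h1 h2] := stage_bounds inst O_opt hA e0 e1 s_le lh_close bh_close erefl S_step.
have eN : #|S s|%:R - #|A|%:R = s%:R :> R by rewrite hSs natrD addrAC subrr add0r.
exists g; rewrite eS eN; split=> //.
- by move=> i; apply: stage_digits_le.
- by rewrite hSs; move: hs; clear; lia.
- apply: le_trans h1; rewrite /completion_rate mulrA ler_wpM2r ?(future_ge0 O inst) //.
  by rewrite mulrA ler_wpM2r ?invr_ge0 // mulrAC.
Qed.

End Guess.

(** * Guesses as flat sequences of digits *)

Section Encoding.
Variables (R : realType) (n p : nat) (d : 'I_n -> 'I_n -> R) (f : {set 'I_n} -> R).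
Implicit Types (A S Y : {set 'I_n}) (G : nat -> nat).

(** Consumes the first stage first, which suits the induction in [exists_stages]; [run_stages]
    exposes the last stage, which suits the invariant of the program loop. *)
Fixpoint stages_from k (gs : nat -> nat -> nat) (t : nat) A : {set 'I_n} :=
  if t is t'.+1 then stages_from k (fun i => gs i.+1) t' (run_stage p d f k (gs 0%N) A) else A.

Lemma stages_fromS k gs t A :
  stages_from k gs t.+1 A = run_stage p d f k (gs t) (stages_from k gs t A).
Proof. by elim: t gs A => //= t IH gs A; rewrite -(IH (fun i => gs i.+1)). Qed.

Lemma stages_from0 k t A : stages_from k (fun _ _ => 0%N) t A = A.
Proof. by elim: t => //= t IH. Qed.

Lemma eq_pull_digits G G' k i : (forall j, (j < k + k)%N -> G j = G' j) ->
  pull_digits d G k i = pull_digits d G' k i.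
Proof.
elim: k => //= k IH h; rewrite IH => [|j hj]; last by apply: h; move: hj; clear; lia.
by rewrite !h //; clear; lia.
Qed.

Lemma eq_run_stage k G G' A : (forall j, (j < k + k + 2)%N -> G j = G' j) ->
  run_stage p d f k G A = run_stage p d f k G' A.
Proof.
move=> h; rewrite /run_stage !h; try by rewrite addn2.
apply: eq_iter => S; congr (add1 _ _ (pick_best _ _ _).1).
apply/funext => i; rewrite /score (@eq_pull_digits _ (fun j => G' j.+2)) // => j hj.
by apply: h; rewrite addn2 !ltnS.
Qed.

Definition encode k L (gs : nat -> nat -> nat) (r : nat -> nat) (i : nat) : nat :=
  let w := (k + k + 2)%N in
  if (i < L * w)%N then gs (i %/ w)%N (i %% w)%N
  else if (i < L * w + k)%N then r (i - L * w)%N else 0%N.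

Lemma candidate_encode k L gs r : candidate p d f k L (encode k L gs r) =
  add_list p id n (add_list p r k (stages_from k gs L set0)).
Proof.
rewrite /candidate; set w := (k + k + 2)%N; congr (add_list _ _ _ _).
have -> : run_stages p d f k (encode k L gs r) L = stages_from k gs L set0.
  suff h t : (t <= L)%N -> run_stages p d f k (encode k L gs r) t = stages_from k gs t set0 by exact: h.
  elim: t => [//|t IH] ht; rewrite stages_fromS /= IH; last exact: ltnW.
  apply: eq_run_stage => j hj; rewrite /shift /encode -/w.
  have w0 : (0 < w)%N by rewrite /w addn2.
  have -> : (t * w + j < L * w)%N.
    by apply: (@leq_trans (t.+1 * w)); rewrite ?leq_mul2r ?ht ?orbT // mulSn addnC ltn_add2r.
  by rewrite divnMDl // divn_small // addn0 modnMDl modn_small.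
by apply: eq_add_list => i hi; rewrite /shift /encode -/w ltnNge leq_addr /= ltn_add2l hi addKn.
Qed.

Lemma add_list_enum A Y k : [disjoint A & Y] -> (#|A| + #|Y| <= p)%N -> (#|Y| <= k)%N ->
  A :|: Y \subset add_list p (nth n (map val (enum Y))) k A.
Proof.
move=> dAY hp hk; set s := enum Y.
have h j : (j <= #|Y|)%N -> add_list p (nth n (map val s)) j A = A :|: [set x in take j s].
  elim: j => [|j IH] hj /=.
    by apply/setP => u; rewrite !inE take0 in_nil orbF.
  have [v0 _] : exists v0, v0 \in Y by apply/card_gt0P; move: hj; case: #|Y|.
  have js : (j < size s)%N by rewrite -cardE.
  rewrite IH ?(ltnW hj) // (nth_map v0) // add1_ord (take_nth v0) //.
  set v := nth v0 s j.
  have vY : v \in Y by rewrite -mem_enum mem_nth.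
  have vt : v \notin take j s.
    have : uniq (take j s ++ v :: drop j.+1 s) by rewrite -drop_nth // cat_take_drop enum_uniq.
    by rewrite cat_uniq /= negb_or => /and3P[_ /andP[]].
  have vA : v \notin A by rewrite (disjointFl dAY vY).
  have ct : #|[set x in take j s]| = j.
    have /card_uniqP e : uniq (take j s) by rewrite take_uniq // enum_uniq.
    by rewrite -[RHS](size_takel (ltnW js)) -e; apply: eq_card => x; rewrite inE.
  have -> : (v \notin A :|: [set x in take j s]) && (#|A :|: [set x in take j s]| < p)%N.
    rewrite !inE negb_or vA vt /=; apply: leq_ltn_trans (leq_card_setU _ _) _.
    by rewrite ct; move: hj hp; clear; lia.
  by apply/setP => u; rewrite !inE mem_rcons in_cons orbCA.
have hsub : add_list p (nth n (map val s)) #|Y| A \subset add_list p (nth n (map val s)) k A.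
  rewrite -(subnKC hk); elim: (k - #|Y|)%N => [|j IH]; rewrite ?addn0 // addnS /=.
  by apply: subset_trans IH (add1_sub _ _ _).
apply: subset_trans hsub; rewrite h // cardE take_size.
by apply/subsetP => u; rewrite !inE mem_enum.
Qed.

End Encoding.

Section Guess.
Variables (R : realType) (n p : nat) (d : 'I_n -> 'I_n -> R) (f : {set 'I_n} -> R).
Variables (O : {set 'I_n}).
Hypotheses (inst : msd_instance p d f) (O_opt : optimal p d f O).
Implicit Types (A B S T Y : {set 'I_n}) (G : nat -> nat).
Local Notation V := (opt_value d f O).
Local Notation met := (instance_metric inst).
Local Notation rho := (completion_rate R p O).
Local Notation potential := (estimator p d f O).
Local Notation future := (future_gain p d f O).
Local Notation progress := (accrued d f O).

Let p_gt0 : 0 < p%:R :> R. Proof. by rewrite ltr0n; move: (instance_size inst); lia. Qed.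
Let p_le : (p <= n)%N. Proof. by case/andP: (instance_size inst). Qed.

(** [V] for the value of [A], [6 V] for its interaction with [O], and [V] for the size term, which
    absorbs the error [V / p] of each addition. *)
Lemma progress_le A : (#|A| <= p)%N -> progress A + #|A|%:R * (V / p%:R) <= 8 * V.
Proof.
move=> hA; have V0 := opt_ge0 O inst.
have h1 := diversity_le_opt inst O_opt hA; have h2 := form_opt_le inst O_opt hA.
have h3 : #|A|%:R * (V / p%:R) <= V.
  by rewrite mulrCA ler_piMr // ler_pdivrMr // mul1r ler_nat.
by move: h1; rewrite /accrued (formC met (ind R A)) {1}/diversity; lra.
Qed.

Lemma nth_enum_le Y j : (nth n (map val (enum Y)) j <= n)%N.
Proof.
case: (ltnP j (size (map val (enum Y)))) => h; last by rewrite nth_default.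
have /mapP[v _ ->] := mem_nth n h; exact: ltnW (ltn_ord v).
Qed.

(** The hypothesis says that [j] more stages would push the progress past its bound [8 V]: a stage
    is run only if [rho A * future A > e V], and then progress rises by at least [e^2 V / 4]. The
    term [26 e (8 V - ...)] is the credit from which the losses of later stages are paid. *)
Lemma exists_stages (e : R) (k j : nat) A : 0 < V -> 0 < e -> e <= 1 / 4 -> (k < p)%N ->
  8192 * ln (2 * n%:R) <= e ^+ 2 * k%:R -> 4 <= e ^+ 2 * k%:R ->
  (#|A| <= p)%N -> 8 * V < progress A + #|A|%:R * (V / p%:R) + j%:R * (e ^+ 2 * V / 4) ->
  exists gs : nat -> nat -> nat, exists r : nat -> nat,
    [/\ forall t i, (gs t i <= n)%N, forall i, (r i <= n)%N &
     potential A <= diversity d f (add_list p id n (add_list p r k (stages_from p d f k gs j A)))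
       + 26 * (e * (8 * V - (progress A + #|A|%:R * (V / p%:R)))) + 4 * (e * V)].
Proof.
move=> V0 e0 e1 kp hk hk4; elim: j A => [|j IH] A hA hj.
  by have := progress_le hA; move: hj; rewrite mul0r addr0; lra.
have eV : 0 < e * V by rewrite mulr_gt0.
have hM := progress_le hA.
have slack : 0 <= 26 * (e * (8 * V - (progress A + #|A|%:R * (V / p%:R)))).
  by rewrite mulr_ge0 // mulr_ge0 ?(ltW e0) // subr_ge0.
have hdiv B r : B \subset add_list p r k A ->
    diversity d f B <= diversity d f (add_list p id n (add_list p r k A)).
  by move=> h; apply: (le_diversity inst); apply: subset_trans h (add_list_sub _ _ _ _).
case: (leP (rho A * future A) (e * V)) => hstop.
  exists (fun _ _ => 0%N), (fun _ => n); split=> //; rewrite stages_from0.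
  have := potential_le_stop inst O_opt hA hstop.
  have := hdiv A (fun _ => n) (add_list_sub _ _ _ _); lra.
case: (ltP (e * (p - #|A|)%:R) 1) => hr.
  have [Y [dY cY hY]] := exists_completion inst O_opt hA.
  exists (fun _ _ => 0%N), (nth n (map val (enum Y))); split=> //.
    by move=> i; exact: nth_enum_le.
  rewrite stages_from0.
  (* [e (p - |A|) < 1 <= e^2 k / 4]; so the missing labels fit among the [k] explicit ones, and
     their total loss is at most [e V]. *)
  have kR : (p - #|A|)%:R <= e * k%:R / 4 :> R.
    rewrite -(ler_pM2l e0); move: hk4; rewrite expr2 -!mulrA; lra.
  have hYk : (#|Y| <= k)%N.
    rewrite cY -(ler_nat R); apply: le_trans kR _.
    have : e * k%:R <= 1 / 4 * k%:R by rewrite ler_wpM2r.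
    have : 0 <= k%:R :> R by [].
    lra.
  have := hdiv _ _ (add_list_enum dY _ hYk); rewrite cY subnKC // => /(_ (leqnn _)).
  have : (p - #|A|)%:R * (4 * V / p%:R) <= e * V.
    apply: (@le_trans _ _ (e * p%:R / 4 * (4 * V / p%:R))).
      rewrite ler_wpM2r ?divr_ge0 ?mulr_ge0 ?(ltW V0) ?(ltW p_gt0) //.
      apply: le_trans kR _; rewrite ler_wpM2r ?invr_ge0 // ler_wpM2l ?(ltW e0) //.
      by rewrite ler_nat ltnW.
    rewrite le_eqVlt; apply/orP; left; apply/eqP; field; by rewrite gt_eqF.
  lra.
have hA' : (#|A| < p)%N.
  rewrite ltnNge; apply/negP => h; move: hr.
  by rewrite (eqP (h : p - #|A| == 0)%N) mulr0; lra.
have [g [hg sub hc h1 h2]] := exists_stage inst O_opt hA' V0 e0 e1 kp hk hk4 hr.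
set A' := run_stage p d f k g A in sub hc h1 h2.
have hnext : 8 * V < progress A' + #|A'|%:R * (V / p%:R) + j%:R * (e ^+ 2 * V / 4).
  have : e / 2 * (e * V) <= e / 2 * (rho A * future A).
    by rewrite ler_wpM2l ?divr_ge0 ?(ltW e0) // ltW.
  move: hj; rewrite -natr1 expr2; move: h1; lra.
have [gs [r [hgs hr' hlast]]] := IH A' hc hnext.
exists (fun t => if t is t'.+1 then gs t' else g), r; split=> //; first by case.
move: hlast h2; rewrite /= -/A'; lra.
Qed.

(** The initial credit [26 * 8] and the final stop 4 make 212; [e^2 L > 32] lets [L] stages exceed
    [8 V]. *)
Lemma exists_guess (e : R) (k L : nat) : 0 < e -> e <= 1 / 4 ->
  8192 * ln (2 * n%:R) <= e ^+ 2 * k%:R -> 4 <= e ^+ 2 * k%:R -> 32 < e ^+ 2 * L%:R ->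
  exists G : nat -> nat, [/\ forall i, (G i <= n)%N,
    forall i, (L * (k + k + 2) + k <= i)%N -> G i = 0%N &
    potential set0 <= diversity d f (candidate p d f k L G) + 212 * (e * V)].
Proof.
move=> e0 e1 hk hk4 hL.
have V0 := opt_ge0 O inst; have eV : 0 <= e * V by rewrite mulr_ge0 // ltW.
have enc gs r : (forall t i, (gs t i <= n)%N) -> (forall i, (r i <= n)%N) ->
    (forall i, (encode k L gs r i <= n)%N) /\
    (forall i, (L * (k + k + 2) + k <= i)%N -> encode k L gs r i = 0%N).
  move=> h1 h2; split=> i; rewrite /encode; first by case: ifP => // _; case: ifP.
  move=> hi; rewrite ltnNge (leq_trans (leq_addr _ _) hi) /=.
  by rewrite ltnNge hi.
have potV : potential set0 <= V.
  rewrite -[leRHS]addr0 /estimator.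
  have r1 : rho set0 = 1.
    by rewrite /completion_rate setD0 cards0 subn0 (cardO O_opt) divff // gt_eqF.
  rewrite (form_mixE O inst) r1 setD0 /opt_value /diversity.
  have -> : disp d set0 = 0 by rewrite /disp big_set0.
  have -> : form d (ind R set0) (ind R O) = 0.
    by rewrite (formC met) form_ind big_set0.
  have : 0 <= expR (- (1 : R)) * (f O - f set0).
    by rewrite mulr_ge0 ?expR_ge0 // subr_ge0; apply: (instance_monotone inst); exact: sub0set.
  lra.
(* If [p <= k], the explicit labels can list the optimum itself. *)
case: (leqP p k) => hpk.
  have [hle hz] := enc (fun _ _ => 0%N) (nth n (map val (enum O))) (fun _ _ => leq0n _) (nth_enum_le O).
  exists (encode k L (fun _ _ => 0%N) (nth n (map val (enum O)))); split=> //.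
  rewrite candidate_encode stages_from0; apply: le_trans potV _.
  apply: (@le_trans _ _ (diversity d f (add_list p id n (add_list p (nth n (map val (enum O))) k set0)))).
    apply: (le_diversity inst); apply: subset_trans (add_list_sub _ _ _ _).
    rewrite -{1}(set0U O); apply: add_list_enum; rewrite ?cards0 ?(cardO O_opt) //.
    by rewrite -setI_eq0 set0I.
  lra.
have [hV|hV] := eqVneq V 0.
  have [hle hz] := enc (fun _ _ => 0%N) (fun _ => 0%N) (fun _ _ => leq0n _) (fun _ => leq0n _).
  exists (encode k L (fun _ _ => 0%N) (fun _ => 0%N)); split=> //.
  have : 0 <= diversity d f (candidate p d f k L (encode k L (fun _ _ => 0%N) (fun _ => 0%N))).
    by rewrite addr_ge0 ?(disp_ge0 met) ?(instance_ge0 inst).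
  move: potV; rewrite hV; lra.
have V1 : 0 < V by rewrite lt_def hV V0.
have c0 : (#|set0 : {set 'I_n}| <= p)%N by rewrite cards0.
have p0 : 0 <= progress set0 + #|set0 : {set 'I_n}|%:R * (V / p%:R).
  rewrite cards0 mul0r addr0 /accrued !addr_ge0 ?(disp_ge0 met) ?(instance_ge0 inst) //.
  by apply: (form_ge0 met) => v; exact: ind_ge0.
have hj : 8 * V < progress set0 + #|set0 : {set 'I_n}|%:R * (V / p%:R) + L%:R * (e ^+ 2 * V / 4).
  have : 32 * (V / 4) < e ^+ 2 * L%:R * (V / 4) by rewrite ltr_pM2r // divr_gt0.
  lra.
have [gs [r [hgs hr h]]] := exists_stages V1 e0 e1 hpk hk hk4 c0 hj.
have [hle hz] := enc gs r hgs hr.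
exists (encode k L gs r); split=> //; rewrite candidate_encode.
have := ler_wpM2l (ltW e0) p0; lra.
Qed.

End Guess.

(** * Reasoning about programs *)

Fixpoint nmods (c : cmd) : seq nat :=
  match c with
  | Skip | RSet _ _ _ => [::]
  | NSet a _ _ | Flip a _ => [:: a]
  | Seq c1 c2 | If _ c1 c2 => nmods c1 ++ nmods c2
  | While _ c1 => nmods c1
  end.

Fixpoint rmods (c : cmd) : seq nat :=
  match c with
  | Skip | NSet _ _ _ | Flip _ _ => [::]
  | RSet a _ _ => [:: a]
  | Seq c1 c2 | If _ c1 c2 => rmods c1 ++ rmods c2
  | While _ c1 => rmods c1
  end.

Definition var (a : nat) : nexp := NGet a (NLit 0).
Definition setv (a : nat) (e : nexp) : cmd := NSet a (NLit 0) e.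
Definition setr (a : nat) (e : rexp) : cmd := RSet a (NLit 0) e.
Definition blt (e1 e2 : nexp) : bexp := BNot (BNle e2 e1).

Definition For (x : nat) (hi : nexp) (c : cmd) : cmd :=
  Seq (setv x (NLit 0))
    (While (blt (var x) hi) (Seq c (setv x (NAdd (var x) (NLit 1))))).

Section Runs.
Variables (R : realType) (n : nat) (d : 'I_n -> 'I_n -> R) (f : {set 'I_n} -> R).
Implicit Types (c : cmd) (s : state R) (T N : nat) (Q : state R -> Prop).

(** Total correctness with a step budget: halting is part of the claim. *)
Definition runs c s T Q : Prop := exists t s', [/\ exec d f c s t s', (t <= T)%N & Q s'].

Definition same (A B : seq nat) s s' : Prop :=
  (forall a, a \notin A -> nmem s' a =1 nmem s a) /\ (forall a, a \notin B -> rmem s' a =1 rmem s a).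

Lemma same_trans A B s1 s2 s3 : same A B s1 s2 -> same A B s2 s3 -> same A B s1 s3.
Proof. by move=> [h1 h2] [h3 h4]; split=> a ha i; rewrite ?h3 ?h4 ?h1 ?h2. Qed.

Lemma same_sub A B A' B' s s' : {subset A <= A'} -> {subset B <= B'} -> same A B s s' -> same A' B' s s'.
Proof.
by move=> hA hB [h1 h2]; split=> a ha; [apply: h1; apply: contra ha; exact: hA | apply: h2; apply: contra ha; exact: hB].
Qed.

Lemma update_out X (m : nat -> nat -> X) a i x b : b != a -> update m a i x b =1 m b.
Proof. by move=> h j; rewrite /update (negPf h). Qed.

Lemma exec_same c s t s' : exec d f c s t s' -> same (nmods c) (rmods c) s s'.
Proof.
have cat1 (A A' B B' : seq nat) s1 s2 : same A B s1 s2 -> same (A ++ A') (B ++ B') s1 s2.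
  by apply: same_sub => x h; rewrite mem_cat h.
have cat2 (A A' B B' : seq nat) s1 s2 : same A' B' s1 s2 -> same (A ++ A') (B ++ B') s1 s2.
  by apply: same_sub => x h; rewrite mem_cat h orbT.
elim=> {c s t s'} //=.
- by move=> a i e s; split=> b; rewrite ?inE //= => h j; rewrite update_out.
- by move=> a i e s; split=> b; rewrite ?inE //= => h j; rewrite update_out.
- by move=> a i s b w _; split=> b'; rewrite ?inE //= => h j; rewrite update_out.
- by move=> c1 c2 s s1 s2 t1 t2 _ h1 _ h2; apply: same_trans (cat1 _ _ _ _ _ _ h1) (cat2 _ _ _ _ _ _ h2).
- by move=> b c1 c2 s s' t _; case: (beval d f s b) => h; [exact: cat1|exact: cat2].
- by move=> b c s s1 s2 t1 t2 _ _ h1 _ h2; exact: same_trans h1 h2.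
Qed.

Lemma runs_frame c s T Q : runs c s T Q ->
  runs c s T (fun s' => Q s' /\ same (nmods c) (rmods c) s s').
Proof. by move=> [t [s' [h1 h2 h3]]]; exists t, s'; split=> //; split=> //; exact: exec_same h1. Qed.

Lemma runs_weaken c s T T' Q Q' : runs c s T Q -> (T <= T')%N -> (forall s', Q s' -> Q' s') ->
  runs c s T' Q'.
Proof.
move=> [t [s' [h1 h2 h3]]] hT hQ; exists t, s'; split=> //; [exact: leq_trans hT|exact: hQ].
Qed.

Lemma runs_le c s T T' Q : runs c s T Q -> (T <= T')%N -> runs c s T' Q.
Proof. by move=> h hT; exact: runs_weaken h hT _. Qed.

Lemma runs_skip s Q : Q s -> runs Skip s 1 Q.
Proof. by move=> h; exists 1%N, s; split=> //; exact: exec_Skip. Qed.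

Lemma runs_nset a i e s Q :
  Q (State (update (nmem s) a (neval s i) (neval s e)) (rmem s) (coins s)) ->
  runs (NSet a i e) s (ncost i + ncost e).+1 Q.
Proof. by move=> h; eexists; eexists; split; [exact: exec_NSet| |exact: h]. Qed.

Lemma runs_rset a i e s Q :
  Q (State (nmem s) (update (rmem s) a (neval s i) (reval d f s e)) (coins s)) ->
  runs (RSet a i e) s (ncost i + rcost e).+1 Q.
Proof. by move=> h; eexists; eexists; split; [exact: exec_RSet| |exact: h]. Qed.

Lemma runs_seq c1 c2 s T1 T2 Q1 Q : runs c1 s T1 Q1 -> (forall s1, Q1 s1 -> runs c2 s1 T2 Q) ->
  runs (Seq c1 c2) s (T1 + T2).+1 Q.
Proof.
move=> [t1 [s1 [h1 h2 h3]]] /(_ s1 h3)[t2 [s2 [h4 h5 h6]]].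
by exists (t1 + t2).+1, s2; split=> //; [exact: exec_Seq h1 h4|rewrite ltnS leq_add].
Qed.

Lemma runs_seqf c1 c2 s T1 T2 Q1 Q : runs c1 s T1 Q1 ->
  (forall s1, Q1 s1 -> same (nmods c1) (rmods c1) s s1 -> runs c2 s1 T2 Q) ->
  runs (Seq c1 c2) s (T1 + T2).+1 Q.
Proof. by move=> /runs_frame h1 h2; apply: runs_seq h1 _ => s1 [a b]; exact: h2. Qed.

Lemma runs_nseq a i e c s T Q :
  runs c (State (update (nmem s) a (neval s i) (neval s e)) (rmem s) (coins s)) T Q ->
  runs (Seq (NSet a i e) c) s ((ncost i + ncost e).+1 + T).+1 Q.
Proof.
move=> h; apply: (runs_seq (Q1 := fun s1 => s1 = State (update (nmem s) a (neval s i) (neval s e)) (rmem s) (coins s))).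
  exact: runs_nset.
by move=> s1 ->.
Qed.

Lemma runs_rseq a i e c s T Q :
  runs c (State (nmem s) (update (rmem s) a (neval s i) (reval d f s e)) (coins s)) T Q ->
  runs (Seq (RSet a i e) c) s ((ncost i + rcost e).+1 + T).+1 Q.
Proof.
move=> h; apply: (runs_seq (Q1 := fun s1 => s1 = State (nmem s) (update (rmem s) a (neval s i) (reval d f s e)) (coins s))).
  exact: runs_rset.
by move=> s1 ->.
Qed.

Lemma runs_if b c1 c2 s T1 T2 Q :
  (beval d f s b -> runs c1 s T1 Q) -> (~~ beval d f s b -> runs c2 s T2 Q) ->
  runs (If b c1 c2) s (bcost b + maxn T1 T2).+1 Q.
Proof.
move=> h1 h2; have [t [s' [e1 e2 e3]]] : runs (if beval d f s b then c1 else c2) s (maxn T1 T2) Q.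
  case: (boolP (beval d f s b)) => hb; first by apply: runs_le (h1 hb) _; exact: leq_maxl.
  by apply: runs_le (h2 hb) _; exact: leq_maxr.
by exists (bcost b + t).+1, s'; split=> //; [exact: exec_If|rewrite ltnS leq_add2l].
Qed.

(** Indexing the invariant by the iteration fixes the number of rounds, from which the step count
    follows. *)
Lemma runs_while b c N T (I : nat -> state R -> Prop) s :
  (forall k s1, (k < N)%N -> I k s1 -> beval d f s1 b /\ runs c s1 T (I k.+1)) ->
  (forall s1, I N s1 -> ~~ beval d f s1 b) -> I 0%N s ->
  runs (While b c) s (N * (bcost b + T).+1 + (bcost b).+1) (I N).
Proof.
move=> hstep hend; have h k s1 : (k <= N)%N -> I (N - k)%N s1 ->
    runs (While b c) s1 (k * (bcost b + T).+1 + (bcost b).+1) (I N).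
  elim: k s1 => [|k IH] s1 hk hI.
    rewrite subn0 in hI; exists (bcost b).+1, s1; split=> //.
    by apply: exec_WhileF; exact: hend.
  have hlt : (N - k.+1 < N)%N by move: hk; clear; lia.
  have [hb [t1 [s2 [h1 h2 h3]]]] := hstep _ _ hlt hI.
  have e : (N - k.+1).+1 = (N - k)%N by move: hk; clear; lia.
  rewrite e in h3; have [t2 [s3 [h4 h5 h6]]] := IH s2 (ltnW hk) h3.
  exists (bcost b + t1 + t2).+1, s3; split=> //; first exact: exec_WhileT hb h1 h4.
  by rewrite mulSn; move: h2 h5; clear; lia.
by move=> hI; apply: h => //; rewrite subnn.
Qed.

Definition set_scalar s x v : state R := State (update (nmem s) x 0 v) (rmem s) (coins s).

(** The loop itself writes the counter, so the invariant must tolerate any value there; the body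
    gets the actual value as a separate hypothesis. *)
Lemma runs_for x hi c N T (I : nat -> state R -> Prop) s :
  x \notin nmods c ->
  (forall s1, same (x :: nmods c) (rmods c) s s1 -> neval s1 hi = N) ->
  (forall k s1 v, I k s1 -> I k (set_scalar s1 x v)) ->
  I 0%N s ->
  (forall k s1, (k < N)%N -> I k s1 -> same (x :: nmods c) (rmods c) s s1 -> nmem s1 x 0 = k ->
     runs c s1 T (I k.+1)) ->
  runs (For x hi c) s (N * (T + ncost hi + 12) + (ncost hi + 9))
    (fun s' => I N s' /\ same (x :: nmods c) (rmods c) s s').
Proof.
move=> hx hhi hI0 h0 hbody.
pose J k s1 := [/\ I k s1, same (x :: nmods c) (rmods c) s s1 & nmem s1 x 0 = k].
have same_x s1 v : same (x :: nmods c) (rmods c) s1 (set_scalar s1 x v).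
  by split=> // a; rewrite inE negb_or => /andP[ha _] i; rewrite /= update_out.
apply: (@runs_le _ _ (3 + (N * (bcost (blt (var x) hi) + (T + 6).+1).+1 + (bcost (blt (var x) hi)).+1)).+1); last first.
  by rewrite /=; clear; nia.
apply: (@runs_seq _ _ _ 3 _ (J 0%N)).
  apply: (@runs_nset x (NLit 0) (NLit 0)); split; rewrite /=.
  - exact: (hI0 0%N s 0%N).
  - exact: (same_x s 0%N).
  - by rewrite /update !eqxx.
move=> s1 hJ; apply: (runs_weaken (Q := J N)); last by move=> s' [].
  apply: (@runs_while _ _ _ _ J) => //.
    move=> k s2 hk [hI hs hxk]; split; first by rewrite /= hxk hhi // -ltnNge.
    apply: (@runs_seq _ _ _ T 6 (fun s3 => I k.+1 s3 /\ same (nmods c) (rmods c) s2 s3)).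
      by apply: runs_frame; apply: hbody.
    move=> s3 [hI3 hs3]; apply: (@runs_nset x (NLit 0)).
    have hx3 : nmem s3 x 0 = k by case: hs3 => h _; rewrite h.
    have hss3 : same (x :: nmods c) (rmods c) s s3.
      apply: same_trans hs _; apply: same_sub hs3 => // a ha; by rewrite inE ha orbT.
    split; rewrite /= hx3.
    - exact: (hI0 _ s3 (k + 1)%N hI3).
    - exact: same_trans hss3 (same_x s3 (k + 1)%N).
    - by rewrite /update !eqxx addn1.
  by move=> s2 [_ hs hxk]; rewrite /= hxk hhi // negbK.
by [].
Qed.

Lemma runs_for_post (x : nat) (hi : nexp) c N T (I : nat -> state R -> Prop) s Q :
  x \notin nmods c ->
  (forall s1, same (x :: nmods c) (rmods c) s s1 -> neval s1 hi = N) ->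
  (forall k s1 v, I k s1 -> I k (set_scalar s1 x v)) ->
  I 0%N s ->
  (forall k s1, (k < N)%N -> I k s1 -> same (x :: nmods c) (rmods c) s s1 -> nmem s1 x 0 = k ->
     runs c s1 T (I k.+1)) ->
  (forall s', I N s' -> same (x :: nmods c) (rmods c) s s' -> Q s') ->
  runs (For x hi c) s (N * (T + ncost hi + 12) + (ncost hi + 9)) Q.
Proof.
move=> h1 h2 h3 h4 h5 h6; apply: runs_weaken (runs_for h1 h2 h3 h4 h5) (leqnn _) _.
by move=> s' []; exact: h6.
Qed.

End Runs.

(** * The program *)

(* Natural arrays: 0 n, 1 p, 2 output, 3 current set, 4 digits of the guess, 5 size of the current
   set, 6 read position, 7-11 and 22 loop counters, 12 label to add, 13 and 14 length and weight of
   the stage, 15 and 16 sampled label and divisor, 17 number of digits, 18 sample size, 19 and 20 a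
   logarithm and a power of 2, 21 carry, 23 end flag.
   Real arrays: 0 linear part of the score, 1 best score, 2 current value, 3 best diversity. *)

Definition try_add : cmd :=
  If (BAnd (blt (var 12) (var 0)) (BAnd (blt (NGet 3 (var 12)) (NLit 1)) (blt (var 5) (var 1))))
    (Seq (NSet 3 (var 12) (NLit 1)) (setv 5 (NAdd (var 5) (NLit 1)))) Skip.

(** The oracle reads only stored sets, so the label is inserted into array 3 for one query and then
    removed. *)
Definition score_label : cmd :=
  Seq (NSet 3 (var 10) (NLit 1))
 (Seq (setr 2 (RAdd (RMul (RNat (var 1)) (RGet 0 (var 10))) (RMul (RNat (var 14)) (RVal 3))))
 (Seq (NSet 3 (var 10) (NLit 0))
   (If (BRle (RGet 1 (NLit 0)) (RGet 2 (NLit 0)))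
     (Seq (setr 1 (RGet 2 (NLit 0))) (setv 12 (var 10))) Skip))).

Definition pick_label : cmd :=
  Seq (setv 12 (var 0)) (Seq (setr 1 (RNat (NLit 0)))
    (For 10 (var 0) (If (blt (NGet 3 (var 10)) (NLit 1)) score_label Skip))).

Definition read_pair : cmd :=
  Seq (setv 15 (NGet 4 (var 6))) (Seq (setv 16 (NGet 4 (NAdd (var 6) (NLit 1))))
 (Seq (setv 6 (NAdd (var 6) (NLit 2)))
   (For 10 (var 0)
     (RSet 0 (var 10) (RAdd (RGet 0 (var 10)) (RDiv (RDist (var 10) (var 15)) (RNat (var 16)))))))).

Definition stage : cmd :=
  Seq (setv 13 (NGet 4 (var 6))) (Seq (setv 14 (NGet 4 (NAdd (var 6) (NLit 1))))
 (Seq (setv 6 (NAdd (var 6) (NLit 2)))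
 (Seq (For 10 (var 0) (RSet 0 (var 10) (RNat (NLit 0))))
 (Seq (For 8 (var 18) read_pair)
   (For 9 (var 13) (Seq pick_label try_add)))))).

Section Specs.
Variables (R : realType) (n p : nat) (d : 'I_n -> 'I_n -> R) (f : {set 'I_n} -> R).
Implicit Types (s : state R) (S : {set 'I_n}) (G : nat -> nat).
Local Notation runs := (runs d f).

Definition env s : Prop := nmem s 0 0 = n /\ nmem s 1 0 = p.

Definition holds S s : Prop := stored_set n 3 s = S /\ nmem s 5 0 = #|S|.

Lemma eq_stored_set a s s' : nmem s' a =1 nmem s a -> stored_set n a s' = stored_set n a s.
Proof. by move=> h; apply/setP => u; rewrite !inE h. Qed.

Lemma env_same A B s s' : same A B s s' -> env s -> 0 \notin A -> 1 \notin A -> env s'.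
Proof. by move=> [h _] [e0 e1] h0 h1; split; rewrite h. Qed.

Lemma holds_same A B S s s' : same A B s s' -> holds S s -> 3 \notin A -> 5 \notin A -> holds S s'.
Proof. by move=> [h _] [e0 e1] h3 h5; split; rewrite ?(eq_stored_set (h _ h3)) ?h. Qed.

Lemma has_label_stored a s i : (i < n)%N -> has_label (stored_set n a s) i = (nmem s a i != 0%N).
Proof. by move=> hi; rewrite -[i]/(val (Ordinal hi)) has_label_ord inE. Qed.

Lemma stored_set_add a s i x : x != 0%N ->
  stored_set n a (State (update (nmem s) a i x) (rmem s) (coins s)) = add_label i (stored_set n a s).
Proof.
by move=> hx; apply/setP => u; rewrite !inE /= /update eqxx /=; case: (nat_of_ord u == i); rewrite ?hx.
Qed.

Lemma card_add_label i S : (i < n)%N -> ~~ has_label S i -> #|add_label i S| = #|S|.+1.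
Proof.
move=> hi; rewrite -[i]/(val (Ordinal hi)) has_label_ord add_label_ord cardsU1 => ->.
by rewrite add1n.
Qed.

Lemma try_add_spec s S : env s -> holds S s ->
  runs try_add s 40 (holds (add1 p S (nmem s 12 0))).
Proof.
move=> [en ep] [eS e5]; apply: runs_le; first apply: runs_if.
- rewrite /= en ep e5 -!ltnNge ltnS leqn0 => /and3P[h1 h2 h3].
  have hl : ~~ has_label S (nmem s 12 0) by rewrite -eS has_label_stored // negbK.
  apply: runs_nseq; apply: runs_nset.
  rewrite /add1 h1 hl h3; split; last by rewrite /update /= e5 card_add_label // addn1.
  rewrite -eS -(stored_set_add 3 s (nmem s 12 0) (isT : 1%N != 0%N)).
  exact: eq_stored_set.
- rewrite /= en ep e5 -!ltnNge => hno; apply: runs_skip.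
  rewrite /add1; case: ifP => // /and3P[h1 h2 h3]; case/negP: hno.
  by rewrite h1 h3 andbT ltnS leqn0 /=; rewrite -eS has_label_stored // negbK in h2.
- by [].
Qed.

Lemma eq_pick_best (sc sc' : nat -> R) S m : (forall i, (i < m)%N -> sc i = sc' i) ->
  pick_best sc S m = pick_best sc' S m.
Proof.
by elim: m => //= m IH h; rewrite IH ?h // => i hi; apply: h; exact: ltnW.
Qed.

Lemma score_label_spec s S k (v := score p f (rmem s 0) (nmem s 14 0) S k) :
  nmem s 1 0 = p -> stored_set n 3 s = S -> nmem s 3 k = 0%N -> nmem s 10 0 = k ->
  runs score_label s 60 (fun s' => stored_set n 3 s' = S /\
    (nmem s' 12 0, rmem s' 1 0) =
      if rmem s 1 0 <= v then (k, v) else (nmem s 12 0, rmem s 1 0)).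
Proof.
move=> ep eS h3 hk; apply: runs_le.
  apply: runs_nseq; apply: runs_rseq; apply: runs_nseq; set s4 := State _ _ _.
  have e4 : stored_set n 3 s4 = S.
    rewrite -eS; apply/setP => u; rewrite !inE /= /update /= hk.
    by have [->|_] := eqVneq (nat_of_ord u) k; rewrite ?h3.
  have ev : rmem s4 2 0 = v.
    rewrite /s4 /= /update /= ep hk /v /score -eS -(stored_set_add 3 s k (isT : 1%N != 0%N)).
    by congr (_ + _ * f _); apply: eq_stored_set => i /=; rewrite /update hk.
  have e1 : rmem s4 1 0 = rmem s 1 0 by [].
  have e10 : nmem s4 10 0 = k by [].
  have e12 : nmem s4 12 0 = nmem s 12 0 by [].
  move: s4 e4 ev e1 e10 e12 => s4 e4 ev e1 e10 e12.
  apply: runs_if; rewrite [beval _ _ _ _]/= e1 ev => hle.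
    apply: runs_rseq; apply: runs_nset; rewrite hle; split; first by rewrite -e4; exact: eq_stored_set.
    by rewrite /= /update /= e10 ev.
  by apply: runs_skip; rewrite (negPf hle) e4 e12 e1.
by [].
Qed.

Lemma pick_spec s S (l := fun i => rmem s 0 i) (b := nmem s 14 0) : env s -> holds S s ->
  runs pick_label s (n * 100 + 100)%N (fun s' => holds S s' /\
    nmem s' 12 0 = (pick_best (score p f l b S) S n).1).
Proof.
move=> [en ep] [eS e5]; apply: runs_le.
  apply: runs_nseq; apply: runs_rseq; set s0 := State _ _ _.
  apply: (@runs_for_post _ _ _ _ 10 (var 0) _ n _ (fun k s1 => [/\ stored_set n 3 s1 = S,
    nmem s1 12 0 = (pick_best (score p f l b S) S k).1 &
    rmem s1 1 0 = (pick_best (score p f l b S) S k).2])) => //.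
  - by move=> s1 [h _]; rewrite /= (h 0%N isT).
  - move=> k s1 hk [h1 h2 h3] [hn hr] hx.
    have e1 : nmem s1 1 0 = p by rewrite (hn 1%N isT).
    have el i : rmem s1 0 i = l i by rewrite (hr 0%N isT).
    have e14 : nmem s1 14 0 = b by rewrite (hn 14%N isT).
    have hlab : has_label S k = (nmem s1 3 k != 0%N) by rewrite -h1 has_label_stored.
    apply: runs_if; rewrite [beval _ _ _ _]/= hx => hc.
      have h30 : nmem s1 3 k = 0%N by apply/eqP; rewrite -leqn0 -ltnS ltnNge.
      apply: runs_weaken (score_label_spec e1 h1 h30 hx) (leqnn _) _.
      move=> s2 [g1 g2] /=; rewrite hlab h30 /=.
      have -> : score p f l b S k = score p f (rmem s1 0) (nmem s1 14 0) S k.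
        by rewrite e14 /score el.
      move: h2 h3; case: (pick_best _ S k) => x y /= <- <-.
      by move: g2; case: ifP => _ [-> ->].
    apply: runs_skip; rewrite /= hlab.
    by move: hc; rewrite negbK => hc; rewrite -lt0n hc.
  - by move=> s' [h1 h2 _] [hn _]; split=> //; split=> //; rewrite (hn 5%N isT).
by rewrite /=; clear; lia.
Qed.

Lemma read_pair_spec s (l := fun i => rmem s 0 i) (q := nmem s 4 (nmem s 6 0))
    (c := nmem s 4 (nmem s 6 0).+1) : env s ->
  runs read_pair s (n * 100 + 100)%N (fun s' => nmem s' 6 0 = (nmem s 6 0 + 2)%N /\
    forall i, (i < n)%N -> rmem s' 0 i = l i + dist_at d i q / c%:R).
Proof.
move=> [en ep]; apply: runs_le.
  apply: runs_nseq; apply: runs_nseq; apply: runs_nseq; set s0 := State _ _ _.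
  have e15 : nmem s0 15 0 = q by [].
  have e16 : nmem s0 16 0 = c by rewrite /s0 /= /update /= addn1.
  have e6 : nmem s0 6 0 = (nmem s 6 0 + 2)%N by [].
  have e0 : nmem s0 0 0 = n by [].
  have el i : rmem s0 0 i = l i by [].
  move: s0 e15 e16 e6 e0 el => s0 e15 e16 e6 e0 el.
  apply: (@runs_for_post _ _ _ _ 10 (var 0) _ n _ (fun k s1 =>
    forall i, rmem s1 0 i = l i + (if (i < k)%N then dist_at d i q / c%:R else 0))) => //.
  - by move=> s1 [h _]; rewrite /= (h 0%N isT).
  - by move=> i; rewrite addr0.
  - move=> k s1 hk hI [hn hr] hx; apply: runs_rset => i /=; rewrite /update hx.
    rewrite !hI (hn 15%N isT) (hn 16%N isT) e15 e16 ltnS eqxx /=.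
    case: eqP => [->|/eqP ik]; first by rewrite leqnn ltnn addr0.
    by rewrite [in RHS]leq_eqVlt (negPf ik).
  - by move=> s' hI [hn _]; rewrite (hn 6%N isT); split=> // i hi; rewrite hI hi.
by rewrite /=; clear; lia.
Qed.

End Specs.

(** * Evaluating one guess *)

Definition add_next : cmd :=
  Seq (setv 12 (NGet 4 (var 6))) (Seq (setv 6 (NAdd (var 6) (NLit 1))) try_add).

Definition add_dist : cmd :=
  If (BAnd (blt (NLit 0) (NGet 3 (var 11))) (blt (var 10) (var 11)))
    (setr 2 (RAdd (RGet 2 (NLit 0)) (RDist (var 10) (var 11)))) Skip.

Definition compute_diversity : cmd :=
  Seq (setr 2 (RVal 3))
    (For 10 (var 0) (If (blt (NLit 0) (NGet 3 (var 10))) (For 11 (var 0) add_dist) Skip)).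

(** With a non-strict comparison the first candidate is always stored: the best value starts at 0
    and diversities are nonnegative. *)
Definition keep_best : cmd :=
  If (BRle (RGet 3 (NLit 0)) (RGet 2 (NLit 0)))
    (Seq (setr 3 (RGet 2 (NLit 0))) (For 10 (var 0) (NSet 2 (var 10) (NGet 3 (var 10))))) Skip.

Definition evaluate (L : nat) : cmd :=
  Seq (For 10 (var 0) (NSet 3 (var 10) (NLit 0)))
 (Seq (setv 5 (NLit 0)) (Seq (setv 6 (NLit 0))
 (Seq (For 7 (NLit L) stage)
 (Seq (For 8 (var 18) add_next)
 (Seq (For 10 (var 0) (Seq (setv 12 (var 10)) try_add))
 (Seq compute_diversity keep_best)))))).

Section Specs2.
Variables (R : realType) (n p : nat) (d : 'I_n -> 'I_n -> R) (f : {set 'I_n} -> R).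
Implicit Types (s : state R) (S : {set 'I_n}) (G : nat -> nat).
Local Notation runs := (runs d f).
Local Notation env := (@env R n p).

Lemma stage_spec k s S (G := nmem s 4) (a := nmem s 6 0) : env s -> holds S s ->
  nmem s 18 0 = k -> (G a <= n)%N ->
  runs stage s (500 * ((n + k + 1) * (n + k + 1)))%N (fun s' =>
    holds (run_stage p d f k (shift a G) S) s' /\ nmem s' 6 0 = (a + (k + k + 2))%N).
Proof.
move=> [en ep] hS hk hG; apply: runs_le.
  apply: runs_nseq; apply: runs_nseq; apply: runs_nseq; set s0 := State _ _ _.
  have e13 : nmem s0 13 0 = G a by [].
  have e14 : nmem s0 14 0 = G a.+1 by rewrite /s0 /= /update /= addn1.
  have e6 : nmem s0 6 0 = (a + 2)%N by [].
  have ee : env s0 by [].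
  have e18 : nmem s0 18 0 = k by [].
  have e4 i : nmem s0 4 i = G i by [].
  have {}hS : holds S s0 by case: hS.
  move: s0 e13 e14 e6 ee e18 e4 hS => s0 e13 e14 e6 ee e18 e4 hS.
  have [en0 _] := ee.
  apply: (runs_seqf (Q1 := fun s1 => forall i, (i < n)%N -> rmem s1 0 i = 0)).
    apply: (@runs_for_post _ _ _ _ 10 (var 0) _ n _ (fun m s1 =>
      forall i, (i < m)%N -> rmem s1 0 i = 0)) => //.
    - by move=> s1 [h _]; rewrite /= (h 0%N isT).
    - move=> m s1 hm hI _ hx; apply: runs_rset => i; rewrite /= /update hx ltnS leq_eqVlt /=.
      by case: eqP => //= _; exact: hI.
  move=> s1 h0 hs1.
  have ee1 : env s1 by exact: env_same hs1 ee isT isT.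
  have {}hS : holds S s1 by exact: holds_same hs1 hS isT isT.
  have [g1 _] := hs1.
  rewrite -(g1 13%N isT) in e13; rewrite -(g1 14%N isT) in e14; rewrite -(g1 6%N isT) in e6.
  rewrite -(g1 18%N isT) in e18.
  have {}e4 i : nmem s1 4 i = G i by rewrite (g1 4%N isT).
  move: {s0 en0 ee hs1 g1} s1 h0 ee1 hS e13 e14 e6 e18 e4 => s0 h0 ee hS e13 e14 e6 e18 e4.
  set l := pull_digits d (fun i => shift a G i.+2).
  apply: (runs_seqf (Q1 := fun s1 => nmem s1 6 0 = (a + (k + k + 2))%N /\
     forall i, (i < n)%N -> rmem s1 0 i = l k i)).
    apply: (@runs_for_post _ _ _ _ 8 (var 18) _ k _ (fun j s1 =>
      nmem s1 6 0 = (a + (j + j + 2))%N /\ forall i, (i < n)%N -> rmem s1 0 i = l j i)) => //.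
    - by move=> s1 [h _]; rewrite /= (h 18%N isT).
    - move=> j s1 hj [hI6 hI0] hs1 hx.
      apply: runs_weaken (read_pair_spec d f (env_same hs1 ee isT isT)) (leqnn _) _.
      move=> s2 [h6 hl]; split; first by rewrite h6 hI6; clear; lia.
      move=> i hi; rewrite hl // hI0 // hI6 /=; have [gn _] := hs1.
      rewrite !(gn 4%N isT) !e4 /shift.
      have -> : (a + (j + j + 2) = a + (j + j).+2)%N by clear; lia.
      by rewrite /l /= /shift !addnS.
  move=> s1 [h6 hl] hs1.
  have ee1 : env s1 by exact: env_same hs1 ee isT isT.
  have {}hS : holds S s1 by exact: holds_same hs1 hS isT isT.
  have [g1 _] := hs1.
  rewrite -(g1 13%N isT) in e13; rewrite -(g1 14%N isT) in e14.
  apply: (@runs_for_post _ _ _ _ 9 (var 13) _ (G a) _ (fun t s2 =>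
      holds (iter t (greedy_step p f (l k) (G a.+1)) S) s2)) => //.
  - by move=> s2 [h _]; rewrite /= (h 13%N isT).
  - move=> t s2 ht hI hs2 _; have [gn gr] := hs2.
    have ee2 := env_same hs2 ee1 isT isT.
    apply: (runs_seqf (pick_spec d f ee2 hI)) => s3 [h3 h12] hs3.
    have ee3 := env_same hs3 ee2 isT isT.
    apply: runs_weaken (try_add_spec d f ee3 h3) (leqnn _) _ => s4; rewrite h12 /greedy_step.
    rewrite (@eq_pick_best _ _ _ (score p f (l k) (G a.+1) (iter t (greedy_step p f (l k) (G a.+1)) S))) //.
    by move=> i hi; rewrite /score (gn 14%N isT) e14 (gr 0%N isT) hl.
  - move=> s2 hI [gn _]; rewrite (gn 6%N isT) h6; split=> //.
    by rewrite /run_stage /shift addn0 addn1.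
(* The number of greedy rounds is the digit [G a], so its bound by [n] enters the time. *)
rewrite /=; move: hG; rewrite -/G -/a; move: (G a) => g; clear; nia.
Qed.

End Specs2.

Section Specs3.
Variables (R : realType) (n p : nat) (d : 'I_n -> 'I_n -> R) (f : {set 'I_n} -> R).
Implicit Types (s : state R) (S : {set 'I_n}) (G : nat -> nat).
Local Notation runs := (runs d f).
Local Notation env := (@env R n p).

(** Excluded pairs count 0, so that [disp] becomes a double sum over all labels, as the nested loops
    traverse them. *)
Definition pair_dist S (i j : nat) : R :=
  if has_label S i && has_label S j && (i < j)%N then dist_at d i j else 0.

Lemma disp_pair_dist S : disp d S = \sum_(i < n) \sum_(j < n) pair_dist S i j.
Proof.
rewrite /disp big_mkcond; apply: eq_bigr => u _; rewrite /pair_dist has_label_ord.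
case: (u \in S) => /=; last by rewrite big1.
by rewrite big_mkcond; apply: eq_bigr => v _; rewrite has_label_ord dist_at_ord.
Qed.

Lemma add_dist_spec s S i j : stored_set n 3 s = S -> nmem s 10 0 = i -> nmem s 11 0 = j ->
  has_label S i -> (j < n)%N ->
  runs add_dist s 30 (fun s' => stored_set n 3 s' = S /\ rmem s' 2 0 = rmem s 2 0 + pair_dist S i j).
Proof.
move=> hS h10 h11 hi hj.
have hlj : has_label S j = (nmem s 3 j != 0%N) by rewrite -hS has_label_stored.
apply: runs_le.
  apply: runs_if; rewrite /= h10 h11 -!ltnNge lt0n -hlj /pair_dist hi /= => hc.
    rewrite hc; apply: runs_rset; split; first by rewrite -hS; exact: eq_stored_set.
    by rewrite /= /update /= h10 h11.
  by apply: runs_skip; rewrite (negPf hc) addr0.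
by [].
Qed.

Lemma compute_diversity_spec s S : env s -> stored_set n 3 s = S ->
  runs compute_diversity s (100 * ((n + 1) * (n + 1)))%N (fun s' =>
    stored_set n 3 s' = S /\ rmem s' 2 0 = diversity d f S).
Proof.
move=> ee hS; apply: runs_le.
  apply: runs_rseq; set s0 := State _ _ _.
  have e2 : rmem s0 2 0 = f S by rewrite /s0 /= /update /= hS.
  have {}ee : env s0 by [].
  have {}hS : stored_set n 3 s0 = S by [].
  move: s0 e2 ee hS => s0 e2 ee hS; have [en _] := ee.
  apply: (@runs_for_post _ _ _ _ 10 (var 0) _ n _ (fun k s1 => stored_set n 3 s1 = S /\
     rmem s1 2 0 = f S + \sum_(i < k) \sum_(j < n) pair_dist S i j)) => //.
  - by move=> s1 [h _]; rewrite /= (h 0%N isT).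
  - by rewrite big_ord0 addr0.
  - move=> k s1 hk [hS1 hI] hs1 hx; have [hn _] := hs1.
    have hlk : has_label S k = (nmem s1 3 k != 0%N) by rewrite -hS1 has_label_stored.
    apply: runs_if; rewrite [beval _ _ _ _]/= hx -ltnNge lt0n -hlk => hl.
      apply: (@runs_for_post _ _ _ _ 11 (var 0) _ n _ (fun m s2 => stored_set n 3 s2 = S /\
        rmem s2 2 0 = f S + \sum_(i < k) \sum_(j < n) pair_dist S i j + \sum_(j < m) pair_dist S k j)) => //.
      + by move=> s2 [h _]; rewrite /= (h 0%N isT) (hn 0%N isT).
      + by rewrite big_ord0 addr0.
      + move=> m s2 hm [hS2 hI2] [gn _] hx2.
        have h10 : nmem s2 10 0 = k by rewrite (gn 10%N isT).
        apply: runs_weaken (add_dist_spec hS2 h10 hx2 hl hm) (leqnn _) _ => s3 [hS3 hI3].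
        by split=> //; rewrite hI3 hI2 [in RHS]big_ord_recr /= addrA.
      + by move=> s2 [hS2 hI2] _; split=> //; rewrite hI2 [in RHS]big_ord_recr /= addrA.
    apply: runs_skip; split=> //; rewrite hI [in RHS]big_ord_recr /= [X in _ = _ + (_ + X)]big1 ?addr0 //.
    by move=> j _; rewrite /pair_dist (negPf hl).
  - by move=> s1 [hS1 hI] _; split=> //; rewrite hI /diversity disp_pair_dist addrC.
by rewrite /=; clear; nia.
Qed.

Lemma keep_best_spec s S : env s -> stored_set n 3 s = S ->
  runs keep_best s (100 * (n + 1))%N (fun s' =>
    if rmem s 3 0 <= rmem s 2 0 then rmem s' 3 0 = rmem s 2 0 /\ stored_set n 2 s' = S
    else rmem s' 3 0 = rmem s 3 0 /\ stored_set n 2 s' = stored_set n 2 s).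
Proof.
move=> [en _] hS; apply: runs_le.
  apply: runs_if; rewrite [beval _ _ _ _]/= => hle; last first.
    by apply: runs_skip; rewrite (negPf hle).
  rewrite hle; apply: runs_rseq; set s0 := State _ _ _.
  apply: (@runs_for_post _ _ _ _ 10 (var 0) _ n _ (fun k s1 =>
     forall i, (i < k)%N -> nmem s1 2 i = nmem s0 3 i)) => //.
  - by move=> s1 [h _]; rewrite /= (h 0%N isT).
  - move=> k s1 hk hI [hn _] hx; apply: runs_nset => i; rewrite /= /update /= hx ltnS leq_eqVlt.
    by case: eqP => [->|] //= _; [rewrite (hn 3%N isT)|exact: hI].
  - move=> s1 hI [_ hr]; split; first by rewrite (hr 3%N isT).
    by rewrite -hS; apply/setP => u; rewrite !inE hI.
by rewrite /=; clear; lia.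
Qed.

Lemma evaluate_spec k L s (G := nmem s 4) (c := candidate p d f k L G) : env s ->
  nmem s 18 0 = k -> (forall i, (G i <= n)%N) ->
  runs (evaluate L) s (2000 * ((L + 1) * ((n + k + 1) * (n + k + 1))))%N (fun s' =>
    if rmem s 3 0 <= diversity d f c then rmem s' 3 0 = diversity d f c /\ stored_set n 2 s' = c
    else rmem s' 3 0 = rmem s 3 0 /\ stored_set n 2 s' = stored_set n 2 s).
Proof.
move=> ee hk hG; apply: runs_le.
  apply: (runs_seqf (Q1 := fun s1 => forall i, (i < n)%N -> nmem s1 3 i = 0%N)).
    apply: (@runs_for_post _ _ _ _ 10 (var 0) _ n _ (fun m s1 =>
      forall i, (i < m)%N -> nmem s1 3 i = 0%N)) => //.
    - by move=> s1 [h _]; rewrite /= (h 0%N isT); case: ee.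
    - move=> m s1 hm hI _ hx; apply: runs_nset => i; rewrite /= /update hx ltnS leq_eqVlt /=.
      by case: eqP => //= _; exact: hI.
  move=> s1 h0 hs1; apply: runs_nseq; apply: runs_nseq; set s2 := State _ _ _.
  have [g1 r1] := hs1.
  have {h0} hS : holds (set0 : {set 'I_n}) s2.
    split; last by rewrite cards0.
    by apply/setP => u; rewrite !inE /= /update /= h0.
  have e6 : nmem s2 6 0 = 0%N by [].
  have e18 : nmem s2 18 0 = k by rewrite -hk -(g1 18%N isT).
  have ee2 : env s2 by have := env_same hs1 ee isT isT.
  have e4 i : nmem s2 4 i = G i by exact: (g1 4%N isT i).
  have r3 : rmem s2 3 0 = rmem s 3 0 by rewrite -(r1 3%N isT).
  have e2 : stored_set n 2 s2 = stored_set n 2 s.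
    by apply: eq_stored_set => i; rewrite -(g1 2%N isT).
  move: s2 hS e6 e18 ee2 e4 r3 e2 {hs1 g1 r1} => s2 hS e6 e18 ee2 e4 r3 e2.
  set w := (k + k + 2)%N.
  apply: (runs_seqf (Q1 := fun s3 => holds (run_stages p d f k G L) s3 /\ nmem s3 6 0 = (L * w)%N)).
    apply: (@runs_for_post _ _ _ _ 7 (NLit L) _ L _ (fun t s3 =>
      holds (run_stages p d f k G t) s3 /\ nmem s3 6 0 = (t * w)%N)) => //.
    move=> t s3 ht [hI h6] hs3 _; have [gn _] := hs3.
    have h18 : nmem s3 18 0 = k by rewrite (gn 18%N isT).
    have e4' : nmem s3 4 = G by apply/funext => i; rewrite (gn 4%N isT).
    apply: runs_weaken (stage_spec d f (env_same hs3 ee2 isT isT) hI h18 _) (leqnn _) _; first by rewrite e4'.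
    by move=> s4; rewrite e4' h6 => -[h1 ->]; split=> //; rewrite mulSn addnC.
  move=> s3 [hI h6] hs3; have [gn gr] := hs3.
  have ee3 := env_same hs3 ee2 isT isT.
  apply: (runs_seqf (Q1 := holds (add_list p (shift (L * w) G) k (run_stages p d f k G L)))).
    apply: (@runs_for_post _ _ _ _ 8 (var 18) _ k _ (fun j s4 => nmem s4 6 0 = (L * w + j)%N /\
      holds (add_list p (shift (L * w) G) j (run_stages p d f k G L)) s4)) => //.
    - by move=> s4 [h _]; rewrite /= (h 18%N isT) (gn 18%N isT).
    - by rewrite addn0.
    - move=> j s4 hj [h6' hI'] hs4 _; have ee4 := env_same hs4 ee3 isT isT; have [hn _] := hs4.
      apply: runs_nseq; apply: runs_nseq; set s5 := State _ _ _.
      have ee5 : env s5 by [].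
      have h5 : holds (add_list p (shift (L * w) G) j (run_stages p d f k G L)) s5 by case: hI'.
      have e12 : nmem s5 12 0 = shift (L * w) G j.
        by rewrite /s5 /= /update /= h6' (hn 4%N isT) (gn 4%N isT) e4.
      have e6' : nmem s5 6 0 = (L * w + j.+1)%N by rewrite /s5 /= /update /= h6' addn1 addnS.
      apply: runs_weaken (runs_frame (try_add_spec d f ee5 h5)) (leqnn _) _.
      by move=> s6 [h [fr _]]; split; [rewrite (fr 6%N isT)|rewrite /= -e12].
    - by move=> s4 [].
  move=> s4 hI4 hs4; have ee4 := env_same hs4 ee3 isT isT; have [hn4 hr4] := hs4.
  apply: (runs_seqf (Q1 := holds c)).
    apply: (@runs_for_post _ _ _ _ 10 (var 0) _ n _ (fun j s5 =>
      holds (add_list p id j (add_list p (shift (L * w) G) k (run_stages p d f k G L))) s5)) => //.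
    - by move=> s5 [h _]; rewrite /= (h 0%N isT); case: ee4.
    - move=> j s5 hj hI5 hs5 hx; have ee5 := env_same hs5 ee4 isT isT.
      apply: runs_nseq; set s6 := State _ _ _.
      have ee6 : env s6 by [].
      have h6' : holds (add_list p id j (add_list p (shift (L * w) G) k (run_stages p d f k G L))) s6 by case: hI5.
      have e12 : nmem s6 12 0 = j by rewrite /s6 /= /update /= hx.
      by apply: runs_weaken (try_add_spec d f ee6 h6') (leqnn _) _ => s7; rewrite e12.
  move=> s5 [hc _] hs5; have ee5 := env_same hs5 ee4 isT isT; have [hn5 hr5] := hs5.
  apply: (runs_seqf (compute_diversity_spec ee5 hc)) => s6 [hc6 h2] hs6.
  have ee6 := env_same hs6 ee5 isT isT; have [hn6 hr6] := hs6.
  apply: runs_weaken (keep_best_spec ee6 hc6) (leqnn _) _ => s7.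
  have -> : rmem s6 3 0 = rmem s 3 0.
    by rewrite (hr6 3%N isT) (hr5 3%N isT) (hr4 3%N isT) (gr 3%N isT).
  rewrite h2; case: ifP => // _ [-> ->]; split=> //.
  rewrite -e2; apply: eq_stored_set => i.
  by rewrite (hn6 2%N isT) (hn5 2%N isT) (hn4 2%N isT) (gn 2%N isT).
rewrite [X in (X <= _)%N]/=; clear; set X := ((n + k + 1) * (n + k + 1))%N.
have h1 : (n + k + 1 <= X)%N by rewrite /X; nia.
have h2 : ((n + 1) * (n + 1) <= X)%N by rewrite /X; nia.
have h3 : (L <= L * X)%N by rewrite leq_pmulr // /X muln_gt0 addn1.
move: h1 h2 h3; move: ((n + 1) * (n + 1))%N; rewrite -/X; move: X => X Y h1 h2 h3.
lia.
Qed.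

End Specs3.

(** * Enumerating guesses as numbers in base [n + 1] *)

Section Digits.
Variable n : nat.
Local Notation B := n.+1.

Definition digit (c i : nat) : nat := ((c %/ B ^ i) %% B)%N.

Lemma digit_le c i : (digit c i <= n)%N.
Proof. by rewrite -ltnS ltn_pmod. Qed.

Lemma digit_small c i K : (c < B ^ K)%N -> (K <= i)%N -> digit c i = 0%N.
Proof.
move=> hc hi; rewrite /digit divn_small ?mod0n //; apply: leq_trans hc _.
by rewrite leq_pexp2l.
Qed.

Lemma exists_code (G : nat -> nat) K : (forall i, (G i <= n)%N) ->
  (forall i, (K <= i)%N -> G i = 0%N) -> exists2 c, (c < B ^ K)%N & forall i, digit c i = G i.
Proof.
move=> hG hz.
suff [c hc h] : exists2 c, (c < B ^ K)%N & forall i, (i < K)%N -> digit c i = G i.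
  exists c => // i; case: (ltnP i K) => hi; first exact: h.
  by rewrite (digit_small hc hi) hz.
elim: K G hG {hz} => [|K IH] G hG; first by exists 0%N.
have [c hc h] := IH (fun i => G i.+1) (fun i => hG i.+1).
exists (c * B + G 0%N)%N.
  rewrite expnSr; apply: (@leq_trans (c.+1 * B)); last by rewrite leq_mul2r hc orbT.
  by rewrite mulSn addnC ltn_add2r ltnS hG.
move=> [_|i hi]; rewrite /digit.
  by rewrite expn0 divn1 modnMDl modn_small // ltnS.
rewrite expnS divnMA divnMDl // [(G 0%N %/ _)%N]divn_small ?ltnS // addn0.
exact: h.
Qed.

(** The carry passes a position exactly when the digit there is maximal. *)
Lemma dvd_last q : (B %| q.+1)%N = ~~ (q %% B < n)%N.
Proof.
have hq : (q %% B < B)%N by rewrite ltn_pmod.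
rewrite -leqNgt /dvdn -(addn1 q) -modnDml addn1.
apply/idP/idP => h; last first.
  have -> : (q %% B = n)%N by (apply/eqP; rewrite eqn_leq h andbT -ltnS).
  by apply/eqP; exact: modnn.
rewrite leqNgt; apply/negP => h2; move: h; rewrite modn_small //.
Qed.

End Digits.

(** Incrementing in place avoids dividing by the base, for which there is no instruction; a carry
    out of the last digit signals the end of the enumeration. *)
Definition odometer : cmd :=
  Seq (setv 21 (NLit 1))
 (Seq (For 22 (var 17)
        (If (blt (NLit 0) (var 21))
          (If (blt (NGet 4 (var 22)) (var 0))
            (Seq (NSet 4 (var 22) (NAdd (NGet 4 (var 22)) (NLit 1))) (setv 21 (NLit 0)))
            (NSet 4 (var 22) (NLit 0)))
          Skip))
   (setv 23 (var 21))).

(** The sample size must grow like [ln (2 n)]. A binary logarithm found by doubling replaces [ln],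
    and repeated addition replaces multiplication. *)
Definition setup (kappa L : nat) : cmd :=
  Seq (setv 20 (NLit 1))
 (Seq (While (blt (var 20) (NAdd (var 0) (var 0)))
        (Seq (setv 20 (NAdd (var 20) (var 20))) (setv 19 (NAdd (var 19) (NLit 1)))))
 (Seq (For 22 (var 19) (setv 18 (NAdd (var 18) (NLit kappa))))
 (Seq (setv 17 (var 18))
   (For 22 (NLit L) (setv 17 (NAdd (var 17) (NAdd (var 18) (NAdd (var 18) (NLit 2))))))))).

Definition program (kappa L : nat) : cmd :=
  Seq (setup kappa L)
    (While (blt (var 23) (NLit 1)) (Seq (evaluate L) odometer)).

Section Specs4.
Variables (R : realType) (n p : nat) (d : 'I_n -> 'I_n -> R) (f : {set 'I_n} -> R).
Implicit Types (s : state R) (S : {set 'I_n}) (G : nat -> nat).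
Local Notation runs := (runs d f).
Local Notation env := (@env R n p).
Local Notation B := n.+1.

Lemma odometer_spec K c s : nmem s 0 0 = n -> nmem s 17 0 = K -> (forall i, nmem s 4 i = digit n c i) ->
  (c < B ^ K)%N ->
  runs odometer s (100 * (K + 1))%N (fun s' => nmem s' 23 0 = (c.+1 == B ^ K)%N /\
    ((c.+1 < B ^ K)%N -> forall i, nmem s' 4 i = digit n c.+1 i)).
Proof.
move=> en hK h4 hc; apply: runs_le.
  apply: runs_nseq; set s0 := State _ _ _.
  have {}en : nmem s0 0 0 = n by [].
  have {}hK : nmem s0 17 0 = K by [].
  have {}h4 i : nmem s0 4 i = digit n c i by rewrite -h4.
  have h21 : nmem s0 21 0 = 1%N by [].
  move: s0 en hK h4 h21 => s0 en hK h4 h21.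
  apply: (runs_seqf (Q1 := fun s1 => nmem s1 21 0 = (B ^ K %| c.+1)%N :> nat /\
     forall j, nmem s1 4 j = digit n (if (j < K)%N then c.+1 else c) j)).
    (* A carry reaches position [m] exactly when all lower digits of [c] are maximal, that is, when
       [B ^ m] divides [c.+1]. *)
    apply: (@runs_for_post _ _ _ _ 22 (var 17) _ K _ (fun m s1 => nmem s1 21 0 = (B ^ m %| c.+1)%N :> nat /\
     forall j, nmem s1 4 j = digit n (if (j < m)%N then c.+1 else c) j)) => //.
    - by move=> s1 [h _]; rewrite /= (h 17%N isT).
    - by split=> //; rewrite expn0 dvd1n h21.
    - move=> m s1 hm [hI1 hI2] [hn _] hx.
      have hlt j : (j < m.+1)%N = (j == m) || (j < m)%N by rewrite ltnS leq_eqVlt.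
      have hdig : digit n c.+1 m = (((B ^ m %| c.+1) + c %/ B ^ m) %% B)%N.
        by rewrite /digit divnS ?expn_gt0.
      have h4m : nmem s1 4 m = digit n c m by rewrite hI2 ltnn.
      have e0 : nmem s1 0 0 = n by rewrite (hn 0%N isT).
      have dvS : (B ^ m.+1 %| c.+1)%N = (B ^ m %| c.+1)%N && (B %| (c %/ B ^ m).+1)%N.
        case: (boolP (B ^ m %| c.+1)%N) => hd /=; last first.
          by apply/negP => h; case/negP: hd; apply: dvdn_trans h; rewrite expnS dvdn_mull.
        have e := divnS c (_ : 0 < B ^ m)%N; rewrite expn_gt0 /= hd add1n in e.
        rewrite -[in LHS](divnK hd) (e isT) expnS dvdn_pmul2r // expn_gt0 //.
      apply: runs_if; rewrite [beval _ _ _ _]/= hI1 -ltnNge lt0b => hd; last first.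
        apply: runs_skip; rewrite dvS (negPf hd) hI1 (negPf hd); split=> // j.
        rewrite hlt; case: eqP => [->|_] /=; last exact: hI2.
        by rewrite h4m hdig (negPf hd).
      rewrite hd add1n in hdig.
      apply: runs_if; rewrite [beval _ _ _ _]/= hx h4m e0 -ltnNge => hlast.
        apply: runs_nseq; apply: runs_nset; rewrite dvS hd dvd_last hlast; split=> // j.
        rewrite /= /update /= hx hlt h4m; case: eqP => [->|_] /=; last exact: hI2.
        rewrite hdig modnS dvd_last.
        by move: hlast; rewrite /digit => ->; rewrite addn1.
      apply: runs_nset; rewrite dvS hd dvd_last hlast /= /update /= hI1 hd; split=> // j.
      rewrite hx hlt; case: eqP => [->|_] /=; last exact: hI2.
      by rewrite hdig; apply/esym/eqP; move: hlast; rewrite -dvd_last.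
  move=> s1 [h21' h4'] _; apply: runs_nset; rewrite /= /update /=; split.
    rewrite h21'; congr nat_of_bool; apply/idP/eqP => [h|->]; last exact: dvdnn.
    by apply/eqP; rewrite eqn_leq hc dvdn_leq.
  move=> hc' i; rewrite h4'; case: (ltnP i K) => // hi.
  by rewrite (digit_small hc hi) (digit_small hc' hi).
by rewrite /=; clear; lia.
Qed.

Lemma setup_spec kappa L s (k := (up_log 2 (n + n) * kappa)%N) : env s ->
  (forall a i, (1 < a)%N -> nmem s a i = 0%N) -> (0 < n)%N ->
  runs (setup kappa L) s (200 * (up_log 2 (n + n) + L + 1))%N (fun s' =>
    nmem s' 18 0 = k /\ nmem s' 17 0 = (L * (k + k + 2) + k)%N).
Proof.
move=> [en ep] hz n0; apply: runs_le.
  apply: runs_nseq; set s0 := State _ _ _.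
  have {}en : nmem s0 0 0 = n by [].
  have h20 : nmem s0 20 0 = 1%N by [].
  have h19 : nmem s0 19 0 = 0%N by rewrite /s0 /= /update /= hz.
  have h18 : nmem s0 18 0 = 0%N by rewrite /s0 /= /update /= hz.
  move: s0 en h20 h19 h18 => s0 en h20 h19 h18.
  apply: (runs_seqf (Q1 := fun s1 => nmem s1 19 0 = up_log 2 (n + n))).
    apply: (runs_weaken (runs_while (N := up_log 2 (n + n)) (I := fun j s1 =>
      [/\ nmem s1 20 0 = (2 ^ j)%N, nmem s1 19 0 = j & nmem s1 0 0 = n]) _ _ _) (leqnn _)) => //.
    - move=> j s1 hj [e20 e19 e0]; split.
        rewrite /= e20 e0 -ltnNge ltnNge; apply/negP => h; move: hj; rewrite ltnNge; case/negP.
        exact: up_log_min.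
      apply: runs_nseq; apply: runs_nset; rewrite /= /update /=; split=> //; last by rewrite e19 addn1.
      by rewrite e20 addnn -mul2n -expnS.
    - move=> s1 [e20 _ e0]; rewrite /= e20 e0 negbK; apply: up_logP => //.
    - by move=> s1 [].
  move=> s1 e19 [hn _].
  have e18 : nmem s1 18 0 = 0%N by rewrite (hn 18%N isT).
  apply: (runs_seqf (Q1 := fun s1 => nmem s1 18 0 = k)).
    apply: (@runs_for_post _ _ _ _ 22 (var 19) _ (up_log 2 (n + n)) _ (fun m s2 => nmem s2 18 0 = (m * kappa)%N)) => //.
    - by move=> s2 [h _]; rewrite /= (h 19%N isT).
    - by move=> m s2 _ hI _ _; apply: runs_nset; rewrite /= /update /= hI mulSn addnC.
  move=> s2 e18' _; apply: runs_nseq; set s3 := State _ _ _.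
  have f17 : nmem s3 17 0 = k by rewrite /s3 /= /update /=.
  have f18 : nmem s3 18 0 = k by [].
  move: s3 f17 f18 => s3 f17 f18.
  apply: (@runs_for_post _ _ _ _ 22 (NLit L) _ L _ (fun m s4 => nmem s4 17 0 = (m * (k + k + 2) + k)%N)) => //.
  - move=> m s4 _ hI [gn _] _; apply: runs_nset; rewrite /= /update /= hI (gn 18%N isT) f18.
    by rewrite mulSn; clear; lia.
  - by move=> s4 hI [gn _]; rewrite (gn 18%N isT).
by rewrite /=; clear; lia.
Qed.

Definition time_bound kappa L : nat :=
  let k := (up_log 2 (n + n) * kappa)%N in let K := (L * (k + k + 2) + k)%N in
  (200 * (up_log 2 (n + n) + L + 1) +
   B ^ K * (2000 * ((L + 1) * ((n + k + 1) * (n + k + 1))) + 100 * (K + 1) + 10) + 10)%N.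

Lemma program_spec kappa L w (k := (up_log 2 (n + n) * kappa)%N) : (2 <= p <= n)%N ->
  (forall u v, 0 <= d u v) -> (forall S, 0 <= f S) ->
  exists S : {set 'I_n}, [/\ outputs d f (program kappa L) p (time_bound kappa L) w S, #|S| = p &
    forall G, (forall i, (G i <= n)%N) -> (forall i, (L * (k + k + 2) + k <= i)%N -> G i = 0%N) ->
      diversity d f (candidate p d f k L G) <= diversity d f S].
Proof.
move=> /andP[p2 pn] d0 f0; set K := (L * (k + k + 2) + k)%N; set s0 := init_state R n p w.
have ee0 : env s0 by [].
have hz a i : (1 < a)%N -> nmem s0 a i = 0%N.
  by rewrite /s0 /= /update; case: a => [|[|a]].
have n0 : (0 < n)%N by apply: leq_trans pn; exact: ltnW.
have div0 S : 0 <= diversity d f S.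
  by rewrite addr_ge0 // sumr_ge0 // => u _; rewrite sumr_ge0.
pose best_of c := candidate p d f k L (digit n c).
(* The clause for [c = 0] guarantees that guess 0 is stored; from then on the recorded value belongs
   to the stored set, whose size is [p]. *)
pose I (c : nat) (s : state R) := [/\ env s, nmem s 18 0 = k, nmem s 17 0 = K,
  nmem s 23 0 = (c == B ^ K)%N /\ ((c < B ^ K)%N -> forall i, nmem s 4 i = digit n c i) &
  [/\ forall c', (c' < c)%N -> diversity d f (best_of c') <= rmem s 3 0, c = 0%N -> rmem s 3 0 = 0 &
    (0 < c)%N -> rmem s 3 0 = diversity d f (stored_set n 2 s) /\ #|stored_set n 2 s| = p]].
have BK : (0 < B ^ K)%N by rewrite expn_gt0.
have main : runs (program kappa L) s0 (time_bound kappa L) (I (B ^ K)%N).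
  apply: runs_le.
    apply: (runs_seqf (setup_spec kappa L ee0 hz n0)) => s1 [e18 e17] hs1; have [g1 r1] := hs1.
    apply: (runs_while (I := I) (N := (B ^ K)%N)).
    - move=> c s2 hc [ee2 h18 h17 [h23 h4] [hb1 hb2 hb3]].
      have {}h4 := h4 hc; have h4' : nmem s2 4 = digit n c by apply/funext.
      split; first by rewrite /= h23 (ltn_eqF hc).
      apply: (runs_seqf (evaluate_spec d f L ee2 h18 _)); first by move=> i; rewrite h4; exact: digit_le.
      rewrite h4' -/(best_of c) => s3 hbest hs3; have [g3 _] := hs3.
      have ee3 := env_same hs3 ee2 isT isT; have [en3 _] := ee3.
      have k17 : nmem s3 17 0 = K by rewrite (g3 17%N isT).
      have k4 i : nmem s3 4 i = digit n c i by rewrite (g3 4%N isT).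
      apply: runs_weaken (runs_frame (odometer_spec en3 k17 k4 hc)) (leqnn _) _.
      move=> s4 [[h23' h4''] hs4]; have [g4 r4] := hs4.
      have e3 : rmem s4 3 0 = rmem s3 3 0 by rewrite (r4 3%N isT).
      have e2 : stored_set n 2 s4 = stored_set n 2 s3 by apply: eq_stored_set; exact: (g4 2%N isT).
      split=> //; first exact: env_same hs4 ee3 isT isT.
      + by rewrite (g4 18%N isT) (g3 18%N isT).
      + by rewrite (g4 17%N isT).
      rewrite e3 e2; split=> //.
        move=> c'; rewrite ltnS leq_eqVlt => /orP[/eqP ->|hc'].
          by move: hbest; case: (leP (rmem s2 3 0) (diversity d f (best_of c))) => hle [-> _] //; exact: ltW.
        apply: le_trans (hb1 _ hc') _.
        by move: hbest; case: (leP (rmem s2 3 0) (diversity d f (best_of c))) => hle [-> _].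
      move=> _; move: hbest; case: (leP (rmem s2 3 0) (diversity d f (best_of c))) => hle [-> ->].
        by split=> //; exact: candidate_card.
      apply: hb3; rewrite lt0n; apply/eqP => c0; move: hle; rewrite hb2 // ltNge div0 //.
    - by move=> s2 [_ _ _ [h23 _] _]; rewrite /= h23 eqxx.
    - have r3 : rmem s1 3 0 = 0 by rewrite (r1 3%N isT).
      split=> //; first exact: env_same hs1 ee0 isT isT.
      + split; first by rewrite (g1 23%N isT) hz // ltn_eqF.
        by move=> _ i; rewrite (g1 4%N isT) hz // /digit div0n mod0n.
  rewrite /time_bound -/k -/K /=; move: (B ^ K)%N (_ * ((L + 1) * _))%N (up_log 2 (n + n)); clear.
  by move=> b y z; nia.
have [t [s' [ht htT [_ _ _ _ [hb _ hp]]]]] := main.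
have [hbest hcard] := hp BK.
exists (stored_set n 2 s'); split=> //; first by exists t, s'.
move=> G hG hG0; have [c hc hcG] := exists_code hG hG0.
rewrite -hbest; have := hb c hc; rewrite /best_of; suff -> : digit n c = G by [].
exact/funext.
Qed.

End Specs4.

(** * Running time and conclusion *)

Lemma up_log_dbl_le n : (up_log 2 (n + n) <= n.+1)%N.
Proof. by apply: up_log_min => //; rewrite expnS mul2n -addnn leq_add // ltnW // ltn_expl. Qed.

Lemma leq_exp2rW m n e : (m <= n)%N -> (m ^ e <= n ^ e)%N.
Proof. by case: e => // e h; rewrite leq_exp2r. Qed.

(** There are [(n + 1)^K <= n^(2 K)] guesses. The cost per guess is at most [9000 N], where
    [9000 <= n^14], [N = n^2 D^3] and [D = K + 1 <= n^K]. *)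
Lemma time_bound_le n kappa L (k := (up_log 2 (n + n) * kappa)%N)
    (K := (L * (k + k + 2) + k)%N) : (2 <= n)%N ->
  (time_bound n kappa L <= n ^ (5 * K + 16))%N.
Proof.
move=> n2; rewrite /time_bound -/k -/K; set lg := up_log 2 (n + n).
have lgn : (lg <= n.+1)%N := up_log_dbl_le n.
pose D := K.+1; have n0 : (0 < n)%N by apply: leq_trans n2.
have D_le : (D <= n ^ K)%N.
  by apply: (@leq_trans (2 ^ K)); [exact: ltn_expl|exact: leq_exp2rW].
have LD : (L + 1 <= D)%N by rewrite /D /K addn1 ltnS; move: (k) => k'; clear; nia.
have kD : (k + 1 <= D)%N by rewrite /D /K addn1 ltnS leq_addl.
have nD : (n + k + 1 <= 2 * (n * D))%N.
  rewrite -addnA mul2n -addnn leq_add //; first by rewrite leq_pmulr.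
  by apply: leq_trans kD _; rewrite leq_pmull.
set N := (n ^ 2 * D ^ 3)%N.
have D1 : (1 <= D)%N by [].
have nN : (n <= N)%N.
  by rewrite /N expnS -mulnA leq_pmulr // muln_gt0 expn_gt0 n0 expn_gt0.
have DN : (D <= N)%N.
  by rewrite /N mulnC expnS -mulnA leq_pmulr // muln_gt0 !expn_gt0 n0.
have XN : ((L + 1) * ((n + k + 1) * (n + k + 1)) <= 4 * N)%N.
  apply: (@leq_trans (D * ((2 * (n * D)) * (2 * (n * D))))).
    by rewrite leq_mul // leq_mul.
  by rewrite /N !expnS !expn0; clear; nia.
have hB : (n.+1 ^ K <= n ^ (2 * K))%N.
  rewrite expnM leq_exp2rW // expnS expn1; apply: (@leq_trans (2 * n)); last by rewrite leq_mul2r n2 orbT.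
  by rewrite mul2n -addnn -addn1 leq_add2l.
have hN : (N <= n ^ (3 * K + 2))%N.
  by rewrite /N expnD mulnC leq_mul2r mulnC expnM (leq_exp2rW 3 D_le) orbT.
have h14 : (4500 + 4500 <= n ^ 14)%N by apply: (@leq_trans (2 ^ 14)) => //; exact: leq_exp2rW.
apply: (@leq_trans (n.+1 ^ K * (4500 * N + 4500 * N))).
  have B1 : (1 <= n.+1 ^ K)%N by rewrite expn_gt0.
  rewrite [(K + 1)%N]addn1 -/D.
  move: B1 XN; set Z := ((L + 1) * _)%N; move: Z (n.+1 ^ K)%N => Z b B1 XN.
  have [N' eN] : exists N', N' = N by exists N.
  have [D' eD] : exists D', D' = D by exists D.
  rewrite -eN -eD in LD nN DN D1 XN *.
  have h1 : (200 * (lg + L + 1) + 10 <= 610 * N')%N by move: lgn LD nN DN D1; clear; lia.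
  have h2 : (2000 * Z + 100 * D' + 10 <= 4000 * N' + 4210 * N')%N by move: XN DN D1; clear; lia.
  apply: (@leq_trans (b * (610 * N') + b * (4000 * N' + 4210 * N'))); last by rewrite -mulnDr leq_mul2l; apply/orP; right; clear; lia.
  rewrite addnAC leq_add //; last by rewrite leq_mul2l h2 orbT.
  by apply: leq_trans h1 _; rewrite leq_pmull.
have -> : (5 * K + 16 = 2 * K + (14 + (3 * K + 2)))%N by clear; lia.
by rewrite -mulnDl (expnD n (2 * K)) (expnD n 14) leq_mul // leq_mul.
Qed.

Section Constants.
Variable R : realType.

Lemma half_le_ln2 : 1 / 2 <= ln 2 :> R.
Proof.
have h : expR (1 / 2) <= 2 :> R.
  by apply: le_trans (expR_le_quad _) _; rewrite ?ger0_norm ?expr2 //; lra.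
by rewrite -[leLHS]expRK ler_ln // posrE ?expR_gt0.
Qed.

Lemma ln_dbl_le n : (0 < n)%N -> ln (2 * n%:R) <= (up_log 2 (n + n))%:R :> R.
Proof.
move=> n0; set lg := up_log 2 (n + n).
have h : 2 * n%:R <= 2 ^+ lg :> R.
  by rewrite -natrM -natrX ler_nat mul2n -addnn; exact: up_logP.
have n0' : 0 < 2 * n%:R :> R by rewrite mulr_gt0 // ltr0n.
apply: (@le_trans _ _ (ln (2 ^+ lg))); first by rewrite ler_ln // posrE exprn_gt0.
rewrite lnXn // -[_ *+ lg]mulr_natl ler_piMr //.
by have := @le_ln1Dx R 1; rewrite (_ : 1 + 1 = 2 :> R) //; apply; lra.
Qed.

(** With [lg] the logarithm, [(lg - 1) / 2 <= (lg - 1) * ln 2 <= ln (2 n) <= 2 ln n], so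
    [lg <= 4 ln n + 1], and [ln n >= 1 / 2] absorbs the 1. *)
Lemma up_log_le_ln n : (2 <= n)%N -> (up_log 2 (n + n))%:R <= 6 * ln n%:R :> R.
Proof.
move=> n2; have n0 : (0 < n)%N by apply: leq_trans n2.
have nR : 0 < n%:R :> R by rewrite ltr0n.
have ln2n : ln 2 <= ln n%:R :> R by rewrite ler_ln ?posrE // ler_nat.
have h12 := half_le_ln2.
have hlg : (0 < up_log 2 (n + n))%N by rewrite up_log_gt0 /=; move: n2; clear; lia.
have h : 2 ^+ (up_log 2 (n + n)).-1 <= 2 * n%:R :> R.
  rewrite -natrM -natrX ler_nat mul2n -addnn; apply: ltnW.
  by apply: up_log_gtn => //; move: n2; clear; lia.
have : ln (2 ^+ (up_log 2 (n + n)).-1) <= ln (2 * n%:R) :> R.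
  by rewrite ler_ln // posrE ?exprn_gt0 // mulr_gt0.
rewrite lnXn // lnM ?posrE // -[_ *+ _]mulr_natl => h1.
have e : (up_log 2 (n + n))%:R = (up_log 2 (n + n)).-1%:R + 1 :> R.
  by rewrite natr1 prednK.
rewrite e; have := ler_wpM2l (ler0n R (up_log 2 (n + n)).-1) h12; lra.
Qed.

End Constants.

Section Conclusion.
Variable R : realType.

Lemma exists_multiplier (x c : R) : 0 < x -> x <= 1 -> 0 <= c ->
  exists m : nat, c < x * m%:R /\ m%:R <= (c + 1) / x.
Proof.
move=> x0 x1 c0; exists (Num.truncn (c / x)).+1; split.
  by rewrite mulrC -ltr_pdivrMr // truncnS_gt.
rewrite -natr1 mulrDl lerD // ?truncn_le ?divr_ge0 ?(ltW x0) //.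
by rewrite div1r invf_ge1.
Qed.

(** There are at most [5 L k] digits, and [5 * 33 * 6 = 990]. As [a] will be [(220 / eps)^2], its
    square yields [eps^4] in the exponent. *)
Lemma exponent_le (L k : nat) (a b l lg' : R) : (0 < k)%N -> (0 < L)%N -> 
  L%:R <= 33 * a -> k%:R <= lg' * (b * a) -> 0 <= b -> 0 <= a -> 0 <= lg' -> lg' <= 6 * l ->
  (L * (k + k + 2) + k)%:R <= 990 * b * (l * a ^+ 2).
Proof.
move=> k0 L0 hL hk b0 a0 lg0 hlg.
have h : (L * (k + k + 2) + k <= 5 * (L * k))%N.
  have : (L <= L * k)%N by rewrite leq_pmulr.
  have : (k <= L * k)%N by rewrite leq_pmull.
  rewrite !mulnDr; move: (L * k)%N; clear; lia.
apply: (@le_trans _ _ (5 * (L * k))%:R); first by rewrite ler_nat.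
rewrite !natrM; have h1 : L%:R * k%:R <= 33 * a * (lg' * (b * a)) by apply: ler_pM.
have h2 : 33 * a * (lg' * (b * a)) <= 33 * a * (6 * l * (b * a)).
  by rewrite ler_wpM2l ?mulr_ge0 // ler_wpM2r // mulr_ge0.
have := le_trans h1 h2; rewrite expr2; lra.
Qed.

Lemma coin_expectation_ge (T : nat) (X : T.-tuple bool -> R) (c : R) :
  (forall w, c <= X w) -> c <= coin_expectation X.
Proof.
move=> h; rewrite /coin_expectation ler_pdivlMr ?exprn_gt0 //.
apply: (@le_trans _ _ (\sum_(w : T.-tuple bool) c)); last by apply: ler_sum => w _; exact: h.
by rewrite sumr_const card_tuple card_bool -natrX mulr_natr.
Qed.

(** [212 / 220 <= 1], and a loss of [eps * v] splits into [eps * disp] and [eps * f]. *)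
Lemma accuracy_budget (eps v disp f c pot div : R) : 0 <= v -> 0 <= eps -> v = disp + f ->
  disp + (1 - c) * f <= pot -> pot <= div + 212 * (eps / 220 * v) ->
  (1 - eps) * disp + (1 - c - eps) * f <= div.
Proof.
move=> v0 e0 ev h1 h2; have := mulr_ge0 e0 v0; rewrite ev in h2 *; lra.
Qed.

Definition exponent_factor : R := 990 * (8192 + 1) * 220 ^+ 4.

Lemma exponent_factor_ge0 : 0 <= exponent_factor.
Proof. by rewrite !mulr_ge0 // addr_ge0. Qed.

Lemma exponent_bound (eps : R) (L kappa n : nat) (x := (eps / 220) ^+ 2)
    (k := (up_log 2 (n + n) * kappa)%N) : 0 < eps -> (2 <= n)%N -> (0 < L)%N -> (0 < kappa)%N ->
  L%:R <= (32 + 1) / x -> kappa%:R <= (8192 + 1) / x ->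
  (5 * (L * (k + k + 2) + k) + 16)%:R <=
    (5 * exponent_factor + 16) * Num.max 1 (ln n%:R / eps ^+ 4).
Proof.
move=> eps0 n2 L0 kap0 hL hkap.
have x0 : 0 < x by rewrite exprn_gt0 // divr_gt0.
have lg0 : (0 < up_log 2 (n + n))%N by rewrite up_log_gt0 /=; move: n2; clear; lia.
have ex : ln n%:R * x^-1 ^+ 2 = 220 ^+ 4 * (ln n%:R / eps ^+ 4).
  by rewrite /x; field; rewrite gt_eqF.
have hexp : (L * (k + k + 2) + k)%:R <= exponent_factor * (ln n%:R / eps ^+ 4).
  rewrite /exponent_factor -mulrA -ex.
  apply: (@exponent_le _ _ _ (8192 + 1) (ln n%:R) (up_log 2 (n + n))%:R) => //.
  - by rewrite muln_gt0 lg0.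
  - by move: hL; rewrite natr1.
  - by rewrite /k natrM ler_wpM2l.
  - exact: addr_ge0.
  - by rewrite invr_ge0 ltW.
  - exact: up_log_le_ln.
rewrite (natrD _ (5 * _)%N 16) (natrM _ 5) [leRHS]mulrDl; apply: lerD.
  rewrite -mulrA ler_wpM2l //; apply: le_trans hexp _.
  by rewrite ler_wpM2l ?exponent_factor_ge0 // le_max lexx orbT.
by rewrite ler_peMr // le_max lexx.
Qed.

Lemma program_approximation (eps : R) (L kappa n p : nat) (d : 'I_n -> 'I_n -> R)
    (f : {set 'I_n} -> R) w (x := (eps / 220) ^+ 2) : 0 < eps -> eps <= 1 ->
  32 < x * L%:R -> 8192 < x * kappa%:R -> msd_instance p d f ->
  exists S : {set 'I_n}, [/\ outputs d f (program kappa L) p (time_bound n kappa L) w S, #|S| = p &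
    forall Sopt : {set 'I_n}, optimal p d f Sopt ->
      (1 - eps) * disp d Sopt + (1 - (expR 1)^-1 - eps) * f Sopt <= diversity d f S].
Proof.
move=> eps0 eps1 hL hkap inst; have e0 : 0 < eps / 220 by rewrite divr_gt0.
have e1 : eps / 220 <= 1 / 4 by lra.
have n2 : (2 <= n)%N by have /andP[p2 pn] := instance_size inst; exact: leq_trans p2 pn.
have [S [h1 h2 h3]] := program_spec kappa L w (instance_size inst) (d_ge0 (instance_metric inst)) (instance_ge0 inst).
exists S; split=> // O O_opt; set k := (up_log 2 (n + n) * kappa)%N in h3.
have lgR : 1 <= (up_log 2 (n + n))%:R :> R.
  by rewrite ler1n up_log_gt0 /=; move: n2; clear; lia.
have hk : 8192 * ln (2 * n%:R) <= x * k%:R.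
  rewrite /k natrM mulrCA mulrC; apply: ler_pM => //; last exact: ltW.
    by apply: ln_ge0; rewrite -natrM ler1n muln_gt0; exact: leq_trans n2.
  exact: ln_dbl_le (leq_trans _ n2).
have hk4 : 4 <= x * k%:R.
  rewrite /k natrM mulrCA; apply: (@le_trans _ _ (1 * 8192)); first by rewrite mul1r ler_nat.
  by apply: ler_pM => //; exact: ltW.
have [G [hG hG0 hpot]] := exists_guess inst O_opt e0 e1 hk hk4 hL.
apply: le_trans (h3 G hG hG0).
exact: (accuracy_budget (opt_ge0 O inst) (ltW eps0) erefl (potential0 inst O_opt) hpot).
Qed.

End Conclusion.

Theorem theorem16 (R : realType) :
  exists C : R, 0 < C /\
  forall eps : R, 0 < eps ->
  exists A : cmd,
  forall (n p : nat) (d : 'I_n -> 'I_n -> R) (f : {set 'I_n} -> R),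
    msd_instance p d f ->
    exists (T : nat) (S : T.-tuple bool -> {set 'I_n}),
      [/\ T%:R <= n%:R `^ (C * Num.max 1 (ln n%:R / eps ^+ 4)),
          forall w : T.-tuple bool, outputs d f A p T w (S w),
          forall w : T.-tuple bool, #|S w| = p
        & forall Sopt : {set 'I_n}, optimal p d f Sopt ->
            (1 - eps) * disp d Sopt + (1 - (expR 1)^-1 - eps) * f Sopt
              <= coin_expectation (fun w => diversity d f (S w))].
Proof.
have M0 := exponent_factor_ge0 R.
exists (5 * exponent_factor R + 16); split; first by rewrite (ltr_wpDl (mulr_ge0 (ler0n _ 5) M0)) ?ltr0n.
move=> eps eps0.
(* A bound that holds on every tape holds in expectation, and choice collects the outputs into a
   function of the tape. *)
have reduce (A : cmd) (T : nat -> nat) (E : nat -> nat) :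
    (forall n, (2 <= n)%N -> (T n <= n ^ E n)%N /\
       (E n)%:R <= (5 * exponent_factor R + 16) * Num.max 1 (ln n%:R / eps ^+ 4)) ->
    (forall (n p : nat) (d : 'I_n -> 'I_n -> R) (f : {set 'I_n} -> R), msd_instance p d f ->
       forall w, exists S : {set 'I_n}, [/\ outputs d f A p (T n) w S, #|S| = p &
         forall Sopt : {set 'I_n}, optimal p d f Sopt ->
           (1 - eps) * disp d Sopt + (1 - (expR 1)^-1 - eps) * f Sopt <= diversity d f S]) ->
    exists A : cmd, forall (n p : nat) (d : 'I_n -> 'I_n -> R) (f : {set 'I_n} -> R),
    msd_instance p d f ->
    exists (T : nat) (S : T.-tuple bool -> {set 'I_n}),
      [/\ T%:R <= n%:R `^ ((5 * exponent_factor R + 16) * Num.max 1 (ln n%:R / eps ^+ 4)),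
          forall w : T.-tuple bool, outputs d f A p T w (S w),
          forall w : T.-tuple bool, #|S w| = p
        & forall Sopt : {set 'I_n}, optimal p d f Sopt ->
            (1 - eps) * disp d Sopt + (1 - (expR 1)^-1 - eps) * f Sopt
              <= coin_expectation (fun w => diversity d f (S w))].
  move=> hT hA; exists A => n p d f inst; exists (T n).
  have /choice[S hS] := fun w : (T n).-tuple bool => hA n p d f inst w.
  exists S; have /andP[p2 pn] := instance_size inst.
  have n2 : (2 <= n)%N := leq_trans p2 pn.
  have [h1 h2] := hT n n2; split.
  - apply: (@le_trans _ _ (n%:R ^+ E n)); first by rewrite -natrX ler_nat.
    by rewrite -(powR_mulrn (E n)) // ler_powR // ler1n; apply: leq_trans n2.
  - by move=> w; case: (hS w).
  - by move=> w; case: (hS w).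
  - by move=> Sopt hopt; apply: coin_expectation_ge => w; case: (hS w) => _ _; exact.
(* For [eps >= 1] both coefficients on the left are at most 0, so any set of size [p] will do;
   [L = kappa = 0] leaves a single guess and time at most [n ^ 16]. *)
case: (leP 1 eps) => he.
  apply: (reduce (program 0 0) (fun n => time_bound n 0 0) (fun=> 16%N)).
    move=> n n2; split; first by have := time_bound_le 0 0 n2; rewrite muln0 add0n muln0.
    rewrite -[leLHS]mulr1; apply: ler_pM => //; last by rewrite le_max lexx.
    by rewrite lerDr; exact: mulr_ge0 (ler0n _ 5) M0.
  move=> n p d f inst w.
  have [S [h1 h2 _]] := program_spec 0 0 w (instance_size inst) (d_ge0 (instance_metric inst)) (instance_ge0 inst).
  exists S; split=> // Sopt _.
  apply: (@le_trans _ _ 0); last by rewrite addr_ge0 ?(disp_ge0 (instance_metric inst)) ?(instance_ge0 inst).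
  have c0 : 0 <= (expR 1)^-1 :> R by rewrite invr_ge0 expR_ge0.
  rewrite -[leRHS]addr0; apply: lerD; rewrite mulr_le0_ge0 ?(disp_ge0 (instance_metric inst)) ?(instance_ge0 inst) ?subr_le0 //.
  by apply: le_trans he; rewrite gerBl.
pose x := (eps / 220) ^+ 2.
have x0 : 0 < x by rewrite exprn_gt0 // divr_gt0.
have x1 : x <= 1.
  by rewrite expr_le1 // ?divr_ge0 ?(ltW eps0) // ler_pdivrMr // mul1r (le_trans (ltW he)) // ler1n.
have [L [hL1 hL2]] := exists_multiplier x0 x1 (ler0n R 32).
have [kappa [hk1 hk2]] := exists_multiplier x0 x1 (ler0n R 8192).
have pos (m : nat) (c : R) : 0 <= c -> c < x * m%:R -> (0 < m)%N.
  by move=> c0; rewrite lt0n; apply: contraTneq => ->; rewrite mulr0 -leNgt.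
apply: (reduce (program kappa L) (fun n => time_bound n kappa L) (fun n =>
    let k := (up_log 2 (n + n) * kappa)%N in 5 * (L * (k + k + 2) + k) + 16)%N).
  move=> n n2; split; first exact: time_bound_le.
  by apply: exponent_bound => //; [exact: pos hL1|exact: pos hk1].
by move=> n p d f inst w; exact: program_approximation (ltW he) hL1 hk1 inst.
Qed.
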